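(* For every positive integer $n$, every $9.8\cdot 10^{-5}$-dense partial Latin square of order $n$ is completable.
   Context: A Latin square of order $n$ is an $n\times n$ array filled with symbols from $\{1,\dots,n\}$ such that no symbol is repeated in any row or column. A partial Latin square of order $n$ is an $n\times n$ array in which each cell is either blank or contains one symbol from $\{1,\dots,n\}$, such that no symbol is repeated in any row or column. It is completable if its blank cells can be filled so that the resulting array is a Latin square. A partial Latin square of order $n$ is $\epsilon$-dense if each row contains at most $\epsilon n$ filled (nonblank) cells, each column contains at most $\epsilon n$ filled cells, and each symbol occurs in at most $\epsilon n$ cells. *)

(* Defs.v *)
From mathcomp Require Import all_boot all_order all_algebra.
Set Implicit Arguments.
Unset Strict Implicit.
Unset Printing Implicit Defensive.
Import Order.TTheory GRing.Theory Num.Theory.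
Local Open Scope ring_scope.

(* Rows, columns and symbols are all indexed by 'I_n; the ordinal k stands for
   the symbol k + 1. In a partial square, None marks a blank cell. *)

Definition latin_square (n : nat) (L : 'M['I_n]_n) : Prop :=
  (forall i, injective (fun j => L i j)) /\
  (forall j, injective (fun i => L i j)).

Definition partial_latin_square (n : nat) (P : 'M[option 'I_n]_n) : Prop :=
  (forall i j1 j2 s, P i j1 = Some s -> P i j2 = Some s -> j1 = j2) /\
  (forall i1 i2 j s, P i1 j = Some s -> P i2 j = Some s -> i1 = i2).

Definition completable (n : nat) (P : 'M[option 'I_n]_n) : Prop :=
  exists L : 'M['I_n]_n,
    latin_square L /\ forall i j s, P i j = Some s -> L i j = s.

Definition eps_dense (R : numDomainType) (eps : R) (n : nat)
    (P : 'M[option 'I_n]_n) : Prop :=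
  [/\ forall i, #|[set j | P i j != None]|%:R <= eps * n%:R,
      forall j, #|[set i | P i j != None]|%:R <= eps * n%:R
    & forall s, #|[set c : 'I_n * 'I_n | P c.1 c.2 == Some s]|%:R
                  <= eps * n%:R].

(* Main.v *)
(* A Latin square is viewed as a set of triples (row, column, symbol), so that
   rows, columns and symbols play symmetric roles.

   The starting square agrees, up to a bounded number of cells per line, with
   the table F of a generalised dihedral group. There a triple lies in an
   intercalate with every column of the opposite half, so about n/2 intercalates
   pass through each cell. A triple (r,c,s) of P is installed as follows. Let
   (r,c,s'), (r,c0,s), (r0,c,s) be the triples presently on its three pairs. For
   any c' in the half opposite to c0 let r' be the row with (r',c',s') in F;
   parity puts r' in the half opposite to r0. Two intercalate switches move s to
   column c' in row r and to row r' in column c, and switching the resulting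
   intercalate on r,r',c,c' creates (r,c,s). Each way in which one of the n/2
   choices of c' can fail is confined to a single line, so a choice survives as
   long as no line has been damaged too much and few lines are worn out.

   This needs the three triples to lie in F and to contain no other pair of P.
   Relabelling columns and symbols at random leaves only a small proportion of
   exceptions, for which each of the three triples is first displaced by a
   longer trade that makes no assumption on it. The exceptions are treated
   first. *)
Require Import Defs.
From mathcomp Require Import all_boot all_order all_algebra all_fingroup zify ring.
Set Implicit Arguments.
Unset Strict Implicit.
Unset Printing Implicit Defensive.
Import GRing.Theory Num.Theory.

(** * Intercalate switches *)

Section Triples.
Variable T : finType.
Implicit Types (a b c : T) (X : seq (T * T * T)).

(** The base must exist for every order, so a few lines have to be adjoined to a group table, and
    each adjunction consumes a transversal. By Hall and Paige the dihedral group of an abelian group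
    of odd order has none, its Sylow 2-subgroup being cyclic. A further factor [Z/2] cures this: the
    order becomes [4 * #|R|] with [#|R|] odd, halving in [R] and the field with four elements give
    explicit transversals, and at most seven lines are adjoined in each direction.

    Randomness bounds by a multiple of [m] how often a line is forced in this way, so that damage is
    prepaid. All other damage falls on chosen lines, and since its total is bounded, few lines ever
    reach a given multiple of [m]; these are avoided.

    The density comes from comparing such multiples of [m], where [m] bounds the filled cells per
    line, with the [N2] candidates, about [n / 2]. The inequality [10200 m <= n] suffices, also for
    [m = 1], where the additive constants weigh most. *)

Definition rel3 := T -> T -> T -> bool.
Definition swap12 (L : rel3) : rel3 := fun a b c => L b a c.
Definition swap13 (L : rel3) : rel3 := fun a b c => L c b a.

Record latin (L : rel3) : Prop := Latin {
  lat12 : forall a b, exists c, L a b c;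
  lat13 : forall a c, exists b, L a b c;
  lat23 : forall b c, exists a, L a b c;
  lat1 : forall a a' b c, L a b c -> L a' b c -> a = a';
  lat2 : forall a b b' c, L a b c -> L a b' c -> b = b';
  lat3 : forall a b c c', L a b c -> L a b c' -> c = c' }.

Lemma latin12 L : latin L -> latin (swap12 L).
Proof. by case=> *; split; rewrite /swap12 /=; eauto. Qed.

Lemma latin13 L : latin L -> latin (swap13 L).
Proof. by case=> *; split; rewrite /swap13 /=; eauto. Qed.

(* [X] may also list triples that are not in [L]. *)
Definition keeps (L L' : rel3) X :=
  forall a b c, L a b c -> (a, b, c) \notin X -> L' a b c.

(** [L'] differs from [L] in all eight triples of a 2 x 2 x 2 box: the four of the intercalate leave
    and the other four enter. Each cell of the box held exactly one of the two symbols, so the flip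
    exchanges them. One axis is treated here; the flip is symmetric, so [switch] reuses the argument
    along the other two. *)
Let switch3 (L L' : rel3) a a' b b' c c' :
  latin L -> a != a' -> b != b' -> c != c' ->
  L a b c -> L a b' c' -> L a' b c' -> L a' b' c ->
  (forall x y z, L' x y z = L x y z (+)
     [&& x \in [:: a; a'], y \in [:: b; b'] & z \in [:: c; c']]) ->
  (forall x y, exists z, L' x y z) /\
  (forall x y z z', L' x y z -> L' x y z' -> z = z').
Proof.
move=> lL na nb nc h1 h2 h3 h4 eL.
suff H x y : exists2 z, L' x y z & forall z', L' x y z' -> z' = z.
  split=> [x y|x y z z' hz hz']; first by have [z hz _] := H x y; exists z.
  by have [w _ hw] := H x y; rewrite (hw _ hz) (hw _ hz').
have key d d' : d != d' -> [:: c; c'] =i [:: d; d'] -> L x y d ->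
    x \in [:: a; a'] -> y \in [:: b; b'] ->
    exists2 z, L' x y z & forall z', L' x y z' -> z' = z.
  move=> nd ed Ld xa yb.
  have Ld' : L x y d' = false.
    by apply/negP=> Ld'; rewrite (lat3 lL Ld Ld') eqxx in nd.
  exists d' => [|z']; first by rewrite eL xa yb ed Ld' !inE eqxx orbT.
  rewrite eL xa yb ed !inE /=; case: (eqVneq z' d') => // _.
  by case: (eqVneq z' d) => [->|nz]; rewrite ?Ld // addbF => /(lat3 lL Ld) ed'; rewrite ed' eqxx in nz.
have ecc : [:: c; c'] =i [:: c'; c] by move=> z; rewrite !inE orbC.
have nc' : c' != c by rewrite eq_sym.
case xa: (x \in [:: a; a']); last first.
  have [z hz] := lat12 lL x y; exists z => [|z']; rewrite eL xa addbF //.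
  by move/(lat3 lL hz).
case yb: (y \in [:: b; b']); last first.
  have [z hz] := lat12 lL x y; exists z => [|z']; rewrite eL xa yb addbF //.
  by move/(lat3 lL hz).
move: (xa) (yb); rewrite !inE.
case/orP=> /eqP ex /orP[] /eqP ey; subst.
- exact: (key c c').
- exact: (key c' c).
- exact: (key c' c).
- exact: (key c c').
Qed.

Lemma switch L a a' b b' c c' :
  latin L -> a != a' -> b != b' -> c != c' ->
  L a b c -> L a b' c' -> L a' b c' -> L a' b' c ->
  exists L', [/\ latin L', keeps L L' [:: (a, b, c); (a, b', c'); (a', b, c'); (a', b', c)]
    & [/\ L' a b c', L' a b' c, L' a' b c & L' a' b' c']].
Proof.
move=> lL na nb nc h1 h2 h3 h4.
pose L' : rel3 := fun x y z => L x y z (+)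
     [&& x \in [:: a; a'], y \in [:: b; b'] & z \in [:: c; c']].
have [e3 u3] := switch3 lL na nb nc h1 h2 h3 h4 (fun _ _ _ => erefl : L' _ _ _ = _).
have na' : a' != a by rewrite eq_sym.
have nb' : b' != b by rewrite eq_sym.
have nc' : c' != c by rewrite eq_sym.
have [e2 u2] : (forall x y, exists z, L' x z y) /\
  (forall x y z z', L' x z y -> L' x z' y -> z = z').
  apply: (@switch3 (fun x y z => L x z y) (fun x y z => L' x z y) a a' c c' b b') => //.
    by case: lL => *; split; eauto.
  by move=> x y z; rewrite /L' (andbC (y \in _)).
have [e1 u1] : (forall x y, exists z, L' z y x) /\
  (forall x y z z', L' z y x -> L' z' y x -> z = z').
  apply: (@switch3 (swap13 L) (swap13 L') c c' b b' a a') => //.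
    exact: latin13.
  by move=> x y z; rewrite /swap13 /L'; congr (_ (+) _); rewrite andbA andbC (andbC (z \in _)).
exists L'; split.
- split=> [||y x|x x' y z h h'|x y y' z|].
  + exact: e3.
  + exact: e2.
  + exact: e1 x y.
  + exact: u1 h h'.
  + exact: u2.
  + exact: u3.
- move=> x y z hL; rewrite !inE !xpair_eqE /L' hL /= => hn.
  apply/negP; rewrite !inE => /and3P[] /orP[] /eqP ex /orP[] /eqP ey /orP[] /eqP ez; subst;
   move: hn; rewrite ?eqxx ?(negPf na) ?(negPf nb) ?(negPf nc) ?(negPf na') ?(negPf nb') ?(negPf nc') //=.
  + by have := lat3 lL h1 hL => e; rewrite e eqxx in nc.
  + by have := lat3 lL h2 hL => e; rewrite e eqxx in nc'.
  + by have := lat3 lL h3 hL => e; rewrite e eqxx in nc'.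
  + by have := lat3 lL h4 hL => e; rewrite e eqxx in nc.
- have F d d' x y : d != d' -> L x y d -> L x y d' = false.
    by move=> nd hd; apply/negP=> /(lat3 lL hd) e; rewrite e eqxx in nd.
  by rewrite /L' !inE !eqxx !orbT /= (F c c') // (F c' c) // (F c' c) // (F c c').
Qed.

(** Free choices in the trades are made here: each way in which a candidate can fail is one set of
    [Bs], and a union bound leaves a survivor. *)
Lemma pick_avoid (H : {set T}) (Bs : seq {set T}) :
  \sum_(B <- Bs) #|B| < #|H| -> exists2 x, x \in H & all (fun B : {set T} => x \notin B) Bs.
Proof.
move=> hs; have : H :\: \bigcup_(B <- Bs) B != set0.
  rewrite -card_gt0 cardsD subn_gt0; apply: leq_ltn_trans hs.
  apply: leq_trans (subset_leq_card (subsetIr _ _)) _.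
  elim: Bs => [|B Bs IH]; first by rewrite !big_nil cards0.
  by rewrite !big_cons (leq_trans (leq_card_setU _ _)) // leq_add2l.
case/set0Pn=> x; rewrite inE => /andP[nx xH]; exists x => //.
apply/allP=> B hB; apply: contra nx => xB.
elim: Bs hB {hs} => // B' Bs IH; rewrite inE big_cons inE => /orP[/eqP <-|/IH ->].
  by rewrite xB.
by rewrite orbT.
Qed.

(** A candidate that fails through a value it determines can be recovered from that value, so
    pulling a bad set back to the candidates does not enlarge it. Thus a failure confined to one
    line is counted on that line. *)
Lemma card_preim_rel (X Y : finType) (R : X -> Y -> bool) (B : {set Y}) :
  (forall x x' y, R x y -> R x' y -> x = x') ->
  #|[set x | [exists y, R x y && (y \in B)]]| <= #|B|.
Proof.
move=> inj; pose f x := [pick y | R x y && (y \in B)].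
have hf x : x \in [set x | [exists y, R x y && (y \in B)]] ->
    exists2 y, f x = Some y & R x y && (y \in B).
  rewrite inE => /existsP[y hy]; rewrite /f; case: pickP => [z hz|/(_ y)]; first by exists z.
  by rewrite hy.
rewrite -(card_imset B (@Some_inj _)) -(@card_in_imset _ _ f) => [|x x' /hf[y ey /andP[hx _]] /hf[y' ey' /andP[hx' _]] e].
  by apply/subset_leq_card/subsetP=> _ /imsetP[x /hf[y ey /andP[_ yB]] ->]; rewrite ey imset_f.
by move: e; rewrite ey ey' => -[e]; apply: inj hx _; rewrite e.
Qed.

Lemma notin_pre (R : T -> T -> bool) (B : {set T}) x y :
  x \notin [set x | [exists y, R x y && (y \in B)]] -> R x y -> y \notin B.
Proof.
by rewrite inE => /existsP h hR; apply/negP=> yB; apply: h; exists y; rewrite hR.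
Qed.

Lemma notin_miss (R : T -> T -> bool) x :
  x \notin [set x | ~~ [exists y, R x y]] -> exists y, R x y.
Proof. by rewrite in_set negbK => /existsP. Qed.

Lemma card_miss (R R' : T -> T -> bool) (X : seq (T * T)) :
  (forall x y, R x y -> (x, y) \notin X -> R' x y) ->
  #|[set x | ~~ [exists y, R' x y]]| <= #|[set x | ~~ [exists y, R x y]]| + size X.
Proof.
move=> h; rewrite -(size_map fst).
apply: leq_trans (leq_add (leqnn _) (card_size _)).
rewrite -[X in _ + X]cardsE -cardsUI; apply: leq_trans (leq_addr _ _).
apply/subset_leq_card/subsetP=> x; rewrite !inE; apply: contraR.
rewrite negb_or negbK => /andP[/existsP[y hy] hx]; apply/existsP; exists y.
by apply: h => //; apply: contra hx => hx; apply/mapP; exists (x, y).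
Qed.

End Triples.

(** * Dihedral tables and the damage bounds under which trades operate *)

Section Env.
Variable T : finType.

(* [h1], [h2], [h3] give the halves; they add up to 0 mod 2 along a triple of
   [F]. [N2] is the size of a half. *)
Record dihedral (F : rel3 T) (G1 G2 G3 : {set T}) (h1 h2 h3 : T -> bool) (N2 : nat) : Prop := Dih {
  d_dom : forall a b c, F a b c -> [/\ a \in G1, b \in G2 & c \in G3];
  d_par : forall a b c, F a b c -> h1 a (+) h2 b (+) h3 c = false;
  d12 : forall a b, a \in G1 -> b \in G2 -> exists c, F a b c;
  d13 : forall a c, a \in G1 -> c \in G3 -> exists b, F a b c;
  d23 : forall b c, b \in G2 -> c \in G3 -> exists a, F a b c;
  d1 : forall a a' b c, F a b c -> F a' b c -> a = a';
  d2 : forall a b b' c, F a b c -> F a b' c -> b = b';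
  d3 : forall a b c c', F a b c -> F a b c' -> c = c';
  d_int : forall a b c b', F a b c -> b' \in G2 -> h2 b' != h2 b ->
    exists a' c', [/\ F a b' c', F a' b c' & F a' b' c];
  d_h1 : forall x, N2 <= #|[set a in G1 | h1 a == x]|;
  d_h2 : forall x, N2 <= #|[set a in G2 | h2 a == x]|;
  d_h3 : forall x, N2 <= #|[set a in G3 | h3 a == x]| }.

(** By parity a row in the half opposite to [a] meets the symbol [c] in a column opposite to [b].
    Hence the intercalates postulated for columns also serve for rows, which makes the record
    symmetric in the three coordinates. *)
Lemma d_int1 F G1 G2 G3 h1 h2 h3 N2 : dihedral F G1 G2 G3 h1 h2 h3 N2 ->
  forall a b c a', F a b c -> a' \in G1 -> h1 a' != h1 a ->
    exists b' c', [/\ F a b' c', F a' b c' & F a' b' c].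
Proof.
move=> D a b c a' hF ha' hh; have [_ _ hc] := d_dom D hF.
have [b' hb'] := d13 D ha' hc; have [_ b'G _] := d_dom D hb'.
have [|a2 [c' [f1 f2 f3]]] := d_int D hF b'G.
  by move: hh (d_par D hF) (d_par D hb'); case: (h1 a) (h1 a') (h2 b) (h2 b') (h3 c) => [] [] [] [] [].
by exists b', c'; rewrite -(d1 D f3 hb').
Qed.

Lemma dihedral12 F G1 G2 G3 h1 h2 h3 N2 :
  dihedral F G1 G2 G3 h1 h2 h3 N2 -> dihedral (swap12 F) G2 G1 G3 h2 h1 h3 N2.
Proof.
move=> D; split; rewrite /swap12; try by case: D; eauto.
- by move=> a b c /(d_dom D)[].
- by move=> a b c /(d_par D); rewrite (addbC (h2 a)).
- move=> a b c b' hF hb hh.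
  have [x [y [? ? ?]]] := d_int1 D hF hb hh; by exists x, y.
Qed.

Lemma dihedral13 F G1 G2 G3 h1 h2 h3 N2 :
  dihedral F G1 G2 G3 h1 h2 h3 N2 -> dihedral (swap13 F) G3 G2 G1 h3 h2 h1 N2.
Proof.
move=> D; split; rewrite /swap13; try by case: D; eauto.
- by move=> a b c /(d_dom D)[].
- by move=> a b c /(d_par D); case: (h1 c) (h2 b) (h3 a) => [] [] [].
- move=> a b c b' hF hb hh.
  have [x [y [? ? ?]]] := d_int D hF hb hh; by exists y, x.
Qed.

Definition miss (R : T -> T -> bool) := #|[set x | ~~ [exists y, R x y]]|.

(* The last six bounds also cover the lines outside [G1], [G2], [G3], where [F]
   is empty. *)
Record env (L F free : rel3 T) (G1 G2 G3 : {set T}) (h1 h2 h3 : T -> bool)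
    (N2 be : nat) : Prop := Env {
  e_lat : latin L;
  e_dih : dihedral F G1 G2 G3 h1 h2 h3 N2;
  e12 : forall a, a \in G1 -> miss (fun b c => [&& L a b c, F a b c & free a b c]) <= be;
  e13 : forall a, a \in G1 -> miss (fun c b => [&& L a b c, F a b c & free a b c]) <= be;
  e21 : forall b, b \in G2 -> miss (fun a c => [&& L a b c, F a b c & free a b c]) <= be;
  e23 : forall b, b \in G2 -> miss (fun c a => [&& L a b c, F a b c & free a b c]) <= be;
  e31 : forall c, c \in G3 -> miss (fun a b => [&& L a b c, F a b c & free a b c]) <= be;
  e32 : forall c, c \in G3 -> miss (fun b a => [&& L a b c, F a b c & free a b c]) <= be;
  f12 : forall a, miss (fun b c => L a b c && free a b c) <= be;
  f13 : forall a, miss (fun c b => L a b c && free a b c) <= be;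
  f21 : forall b, miss (fun a c => L a b c && free a b c) <= be;
  f23 : forall b, miss (fun c a => L a b c && free a b c) <= be;
  f31 : forall c, miss (fun a b => L a b c && free a b c) <= be;
  f32 : forall c, miss (fun b a => L a b c && free a b c) <= be }.

Lemma env12 L F free G1 G2 G3 h1 h2 h3 N2 be :
  env L F free G1 G2 G3 h1 h2 h3 N2 be ->
  env (swap12 L) (swap12 F) (swap12 free) G2 G1 G3 h2 h1 h3 N2 be.
Proof. by case=> *; split=> //; [exact: latin12 | exact: dihedral12]. Qed.

Lemma env13 L F free G1 G2 G3 h1 h2 h3 N2 be :
  env L F free G1 G2 G3 h1 h2 h3 N2 be ->
  env (swap13 L) (swap13 F) (swap13 free) G3 G2 G1 h3 h2 h1 N2 be.
Proof. by case=> *; split=> //; [exact: latin13 | exact: dihedral13]. Qed.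

(** On a fixed line a lost triple occupies a single place, so every bound grows by at most the
    number of lost triples. *)
Lemma env_keeps L L' X F free G1 G2 G3 h1 h2 h3 N2 be d :
  env L F free G1 G2 G3 h1 h2 h3 N2 be ->
  latin L' -> keeps L L' X -> size X <= d ->
  env L' F free G1 G2 G3 h1 h2 h3 N2 (be + d).
Proof.
move=> E lL' t sX.
have gen (R R' : T -> T -> bool) (pi : T * T * T -> T * T) :
    miss R <= be ->
    (forall x y, R x y -> (x, y) \notin [seq pi z | z <- X] -> R' x y) ->
    miss R' <= be + d.
  move=> hR /card_miss hR'; apply: (leq_trans hR').
  by rewrite leq_add // size_map.
have nin (pi : T * T * T -> T * T) a b c : pi (a, b, c) \notin [seq pi z | z <- X] ->
    (a, b, c) \notin X.
  by apply: contra => h; apply/mapP; exists (a, b, c).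
case: E => e1 e2 e3 e4 e5 e6 e7 e8 g1 g2 g3 g4 g5 g6; split=> //.
- move=> a ha; apply: (gen _ _ (fun z => (z.1.2, z.2)) (e3 a ha)) => x y /and3P[hL -> ->].
  by move/(nin _ a x y)/(t _ _ _ hL) => ->.
- move=> a ha; apply: (gen _ _ (fun z => (z.2, z.1.2)) (e4 a ha)) => x y /and3P[hL -> ->].
  by move/(nin _ a y x)/(t _ _ _ hL) => ->.
- move=> a ha; apply: (gen _ _ (fun z => (z.1.1, z.2)) (e5 a ha)) => x y /and3P[hL -> ->].
  by move/(nin _ x a y)/(t _ _ _ hL) => ->.
- move=> a ha; apply: (gen _ _ (fun z => (z.2, z.1.1)) (e6 a ha)) => x y /and3P[hL -> ->].
  by move/(nin _ y a x)/(t _ _ _ hL) => ->.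
- move=> a ha; apply: (gen _ _ (fun z => (z.1.1, z.1.2)) (e7 a ha)) => x y /and3P[hL -> ->].
  by move/(nin _ x y a)/(t _ _ _ hL) => ->.
- move=> a ha; apply: (gen _ _ (fun z => (z.1.2, z.1.1)) (e8 a ha)) => x y /and3P[hL -> ->].
  by move/(nin _ y x a)/(t _ _ _ hL) => ->.
- move=> a; apply: (gen _ _ (fun z => (z.1.2, z.2)) (g1 a)) => x y /andP[hL ->].
  by move/(nin _ a x y)/(t _ _ _ hL) => ->.
- move=> a; apply: (gen _ _ (fun z => (z.2, z.1.2)) (g2 a)) => x y /andP[hL ->].
  by move/(nin _ a y x)/(t _ _ _ hL) => ->.
- move=> a; apply: (gen _ _ (fun z => (z.1.1, z.2)) (g3 a)) => x y /andP[hL ->].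
  by move/(nin _ x a y)/(t _ _ _ hL) => ->.
- move=> a; apply: (gen _ _ (fun z => (z.2, z.1.1)) (g4 a)) => x y /andP[hL ->].
  by move/(nin _ y a x)/(t _ _ _ hL) => ->.
- move=> a; apply: (gen _ _ (fun z => (z.1.1, z.1.2)) (g5 a)) => x y /andP[hL ->].
  by move/(nin _ x y a)/(t _ _ _ hL) => ->.
- move=> a; apply: (gen _ _ (fun z => (z.1.2, z.1.1)) (g6 a)) => x y /andP[hL ->].
  by move/(nin _ y x a)/(t _ _ _ hL) => ->.
Qed.

(** The report of a trade on the triples it removes. In the applications [free] excludes the pairs
    of [P], and [R1], [R2], [R3] are the lines open to choice together with those forced on the
    trade. *)
Definition within (free : rel3 T) (R1 R2 R3 : {set T}) (X : seq (T * T * T)) :=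
  forall a b c, (a, b, c) \in X -> [/\ free a b c, a \in R1, b \in R2 & c \in R3].

Definition cnt1 a (X : seq (T * T * T)) := count (fun t => t.1.1 == a) X.
Definition cnt2 b (X : seq (T * T * T)) := count (fun t => t.1.2 == b) X.
Definition cnt3 c (X : seq (T * T * T)) := count (fun t => t.2 == c) X.

End Env.

Ltac not_listed := apply/negP; rewrite !inE;
  let H := fresh in intro H; repeat (case/orP: H => H); move/eqP: H => H; congruence.

(** * Trades *)

Section Clean.
Variable T : finType.

(** The candidates [c'] fill a half, so there are at least [N2]. Seven times [be] pays for the seven
    further triples that must be present, in [F] and free; six times [al] pays for the lines [c'],
    [t], [b], [r'], [t2], [g], which must be allowed. The final counts concern the six lines forced
    on the trade, which have to absorb their share whatever their state. *)
Lemma install_clean (L F free : rel3 T) G1 G2 G3 h1 h2 h3 N2 be al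
    (al1 al2 al3 : {set T}) r r0 c c0 s s' :
  env L F free G1 G2 G3 h1 h2 h3 N2 be ->
  #|~: al1| <= al -> #|~: al2| <= al -> #|~: al3| <= al ->
  7 * be + 6 * al < N2 ->
  r \notin al1 -> r0 \notin al1 -> c \notin al2 -> c0 \notin al2 ->
  s \notin al3 -> s' \notin al3 -> s != s' ->
  L r c s' -> F r c s' -> L r c0 s -> F r c0 s -> L r0 c s -> F r0 c s ->
  exists L' rem, [/\ latin L', L' r c s,
    keeps L L' ([:: (r, c, s'); (r, c0, s); (r0, c, s)] ++ rem),
    within (fun a b d => [&& L a b d, F a b d & free a b d])
      (al1 :|: [set r; r0]) (al2 :|: [set c; c0]) (al3 :|: [set s; s']) rem &
    [/\ size rem = 7, cnt1 r rem <= 1, cnt2 c rem <= 1, cnt3 s rem <= 2 &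
      [/\ cnt1 r0 rem <= 1, cnt2 c0 rem <= 1 & cnt3 s' rem <= 1]]].
Proof.
move=> E A1 A2 A3 hn nr nr0 nc nc0 ns ns' ss' Lx Fx Ly Fy Lz Fz.
have [lL D] := (e_lat E, e_dih E).
pose k a b d := [&& L a b d, F a b d & free a b d].
have [rG cG s'G] := d_dom D Fx; have [_ c0G sG] := d_dom D Fy.
have [r0G _ _] := d_dom D Fz.
have rr0 : r != r0.
  by apply: contra_neq ss' => e; move: Fz; rewrite -e => /(d3 D) /(_ Fx).
have cc0 : c != c0.
  by apply: contra_neq ss' => e; move: Fy; rewrite -e => /(d3 D) /(_ Fx).
(* Through [F] the choice of [c'] forces the row [r'], the symbol [t2] of the cell [(r',c)] and the
   column [g] of [s] in row [r']; each is an injective function of [c']. *)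
pose row c' r' := F r' c' s'.
pose st c' t2 := [exists r', row c' r' && F r' c t2].
pose sg c' g := [exists r', row c' r' && F r' g s].
pose Bs := [::
  [set c' | ~~ [exists t, k r c' t]];
  [set c' | [exists t, F r c' t && (t \in [set t | ~~ [exists b, k b c0 t]])]];
  [set c' | ~~ [exists b, k b c' s]];
  [set c' | ~~ [exists b, k b c' s']];
  [set c' | [exists r', row c' r' && (r' \in [set r' | ~~ [exists t, k r' c t]])]];
  [set c' | [exists t, st c' t && (t \in [set t | ~~ [exists g, k r0 g t]])]];
  [set c' | [exists r', row c' r' && (r' \in [set r' | ~~ [exists g, k r' g s]])]];
  ~: al2;
  [set c' | [exists t, F r c' t && (t \in ~: al3)]];
  [set c' | [exists b, F b c' s && (b \in ~: al1)]];
  [set c' | [exists r', row c' r' && (r' \in ~: al1)]];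
  [set c' | [exists t, st c' t && (t \in ~: al3)]];
  [set c' | [exists g, sg c' g && (g \in ~: al2)]]].
have irow x x' y : row x y -> row x' y -> x = x' by move=> h; apply: (d2 D) h.
have ist x x' y : st x y -> st x' y -> x = x'.
  case/existsP=> a /andP[h1' h2'] /existsP[b /andP[h3' h4']].
  by rewrite (d1 D h2' h4') in h1'; apply: irow h1' h3'.
have isg x x' y : sg x y -> sg x' y -> x = x'.
  case/existsP=> a /andP[h1' h2'] /existsP[b /andP[h3' h4']].
  by rewrite (d1 D h2' h4') in h1'; apply: irow h1' h3'.
have iFr x x' y : F r x y -> F r x' y -> x = x' by apply: (d2 D).
have iFs x x' y : F y x s -> F y x' s -> x = x' by apply: (d2 D).
have [|c' c'H] := @pick_avoid _ [set c' in G2 | h2 c' == ~~ h2 c0] Bs.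
  apply: leq_trans (d_h2 D _); apply: leq_ltn_trans hn.
  rewrite !big_cons big_nil addn0.
  have := e12 E rG; rewrite /miss -/(k _ _ _) => b1.
  have := leq_trans (card_preim_rel _ iFr) (e23 E c0G) => b2.
  have := e32 E sG; rewrite /miss => b3.
  have := e32 E s'G; rewrite /miss => b4.
  have := leq_trans (card_preim_rel _ irow) (e21 E cG) => b5.
  have := leq_trans (card_preim_rel _ ist) (e13 E r0G) => b6.
  have := leq_trans (card_preim_rel _ irow) (e31 E sG) => b7.
  have := leq_trans (card_preim_rel _ iFr) A3 => b9.
  have := leq_trans (card_preim_rel _ iFs) A1 => b10.
  have := leq_trans (card_preim_rel _ irow) A1 => b11.
  have := leq_trans (card_preim_rel _ ist) A3 => b12.
  have := leq_trans (card_preim_rel _ isg) A2 => b13.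
  have -> : 7 * be + 6 * al = be + (be + (be + (be + (be + (be + (be +
     (al + (al + (al + (al + (al + al))))))))))) by clear; lia.
  apply: leq_add b1 (leq_add b2 (leq_add b3 (leq_add b4 (leq_add b5 (leq_add b6 (leq_add b7 _)))))).
  exact: leq_add A2 (leq_add b9 (leq_add b10 (leq_add b11 (leq_add b12 b13)))).
move: c'H; rewrite inE => /andP[c'G /eqP c'h].
rewrite /= => /and5P[/notin_miss[t kt] hb2 /notin_miss[b kb] /notin_miss[r' kr'] /and5P[hb5 hb6 hb7]].
rewrite in_setC negbK => c'al /and5P[hb9 hb10 hb11 hb12 /andP[hb13 _]].
have F3 a d e : k a d e -> F a d e by case/and3P.
have L3 a d e : k a d e -> L a d e by case/and3P.
have hh : h2 c' != h2 c0 by rewrite c'h; case: (h2 c0).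
have [b1 [t1 [g1 g2 g3]]] := d_int D Fy c'G hh.
have et := d3 D g1 (F3 _ _ _ kt); have eb := d1 D g3 (F3 _ _ _ kb); subst t1 b1.
have kbt : k b c0 t.
  have [b2 kb2] := notin_miss (notin_pre hb2 g1).
  by rewrite (d1 D g2 (F3 _ _ _ kb2)).
have rowr' : row c' r' by apply: F3 kr'.
have [t2 kt2] : exists t2, k r' c t2.
  exact: notin_miss (notin_pre hb5 rowr').
have [g kg] : exists g, k r' g s.
  exact: notin_miss (notin_pre hb7 rowr').
have stt : st c' t2 by apply/existsP; exists r'; rewrite rowr' F3.
have sgg : sg c' g by apply/existsP; exists r'; rewrite rowr' F3.
have r'G : r' \in G1 by case: (d_dom D rowr').
have hr' : h1 r' != h1 r0.
  move: (d_par D Fx) (d_par D Fy) (d_par D Fz) (d_par D rowr') hh.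
  by case: (h1 r) (h2 c) (h3 s) (h1 r0) (h2 c0) (h3 s') (h2 c') (h1 r') => [] [] [] [] [] [] [] [].
have [g2' [t2' [j1 j2 j3]]] := d_int1 D Fz r'G hr'.
have et := d3 D j2 (F3 _ _ _ kt2); have eg := d2 D j3 (F3 _ _ _ kg); subst g2' t2'.
have kgt : k r0 g t2.
  have [g0 kg0] := notin_miss (notin_pre hb6 stt).
  by rewrite (d2 D j1 (F3 _ _ _ kg0)).
have tal : t \in al3.
  by have := notin_pre hb9 g1; rewrite in_setC negbK.
have bal : b \in al1.
  by have := notin_pre hb10 g3; rewrite in_setC negbK.
have r'al : r' \in al1.
  by have := notin_pre hb11 rowr'; rewrite in_setC negbK.
have t2al : t2 \in al3.
  by have := notin_pre hb12 stt; rewrite in_setC negbK.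
have gal : g \in al2.
  by have := notin_pre hb13 sgg; rewrite in_setC negbK.
have ne (S : {set T}) x y : x \in S -> y \notin S -> x <> y by move=> xS yS e; rewrite -e xS in yS.
have n1 := ne _ _ _ bal nr; have n2 := ne _ _ _ bal nr0.
have n3 := ne _ _ _ r'al nr; have n4 := ne _ _ _ r'al nr0.
have n5 := ne _ _ _ c'al nc; have n6 := ne _ _ _ c'al nc0.
have n7 := ne _ _ _ gal nc; have n8 := ne _ _ _ gal nc0.
have n9 := ne _ _ _ tal ns; have n10 := ne _ _ _ tal ns'.
have n11 := ne _ _ _ t2al ns; have n12 := ne _ _ _ t2al ns'.
have n13 : s <> s' by apply/eqP.
have n14 : b <> r' by move=> e; apply: n13; apply: (d3 D (F3 _ _ _ kb)); rewrite e; apply: rowr'.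
have n15 : g <> c' by move=> e; apply: n13; apply: (d3 D (F3 _ _ _ kg)); rewrite e; apply: rowr'.
have n16 : r <> r0 by apply/eqP.
have n17 : c <> c0 by apply/eqP.
have [||| L1 [lL1 t01 [m1 m2 m3 m4]]] := switch lL _ _ _ Ly (L3 _ _ _ kt) (L3 _ _ _ kbt) (L3 _ _ _ kb).
- by apply/eqP/nesym.
- by apply/eqP/nesym.
- by apply/eqP/nesym.
have q1 : L1 r0 c s by apply: t01 => //; not_listed.
have q2 : L1 r0 g t2 by apply: t01 (L3 _ _ _ kgt) _; not_listed.
have q3 : L1 r' c t2 by apply: t01 (L3 _ _ _ kt2) _; not_listed.
have q4 : L1 r' g s by apply: t01 (L3 _ _ _ kg) _; not_listed.
have [||| L2 [lL2 t12 [p1 p2 p3 p4]]] := switch lL1 _ _ _ q1 q2 q3 q4.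
- by apply/eqP/nesym.
- by apply/eqP/nesym.
- by apply/eqP/nesym.
have w1 : L2 r c s' by apply: t12; [apply: t01 => //; not_listed | not_listed].
have w2 : L2 r c' s by apply: t12 m2 _; not_listed.
have w3 : L2 r' c' s' by apply: t12; [apply: t01 (L3 _ _ _ kr') _; not_listed | not_listed].
have [||| L3' [lL3 t23 [o1 o2 o3 o4]]] := switch lL2 _ _ _ w1 w2 p3 w3.
- by apply/eqP/nesym.
- by apply/eqP/nesym.
- by apply/eqP/nesym.
exists L3', [:: (r, c', t); (b, c0, t); (b, c', s); (r', c, t2); (r0, g, t2); (r', g, s); (r', c', s')].
split=> //.
- move=> x y z hL hx; apply: t23; [apply: t12; [apply: t01 => //|]|].
  + by apply: contra hx; rewrite !inE => /or4P[] ->; rewrite ?orbT.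
  + by apply: contra hx; rewrite !inE => /or4P[] ->; rewrite ?orbT.
  (* The last switch also removes [(r,c',s)] and [(r',c,s)], created by the two before it; [L]
     itself did not contain them. *)
  + apply: contra hx; rewrite !inE => /or4P[]; try by move=> ->; rewrite ?orbT.
    * by move=> /eqP[ex ey ez]; move: hL; rewrite ex ey ez => hL; case: n6; apply: (lat2 lL hL Ly).
    * by move=> /eqP[ex ey ez]; move: hL; rewrite ex ey ez => hL; case: n4; apply: (lat1 lL hL Lz).
- move=> x y z hx; rewrite !inE in hx.
  have kk : k x y z by repeat (case/orP: hx => hx); case/eqP: hx => -> -> ->.
  suff /and3P[? ? ?] : [&& x \in al1 :|: [set r; r0], y \in al2 :|: [set c; c0] & z \in al3 :|: [set s; s']].
    by split=> //; apply: kk.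
  repeat (case/orP: hx => hx); case/eqP: hx => -> -> ->;
  by rewrite !inE ?eqxx ?bal ?r'al ?c'al ?gal ?tal ?t2al ?orbT.
- rewrite /cnt1 /cnt2 /cnt3 /= !eqxx.
  have en (x y : T) : x <> y -> (x == y) = false by move/eqP/negPf.
  have en' (x y : T) : x <> y -> (y == x) = false by move/nesym/eqP/negPf.
  by rewrite !(en _ _ n1, en _ _ n2, en _ _ n3, en _ _ n4, en _ _ n16, en' _ _ n16,
    en _ _ n5, en _ _ n6, en _ _ n7, en _ _ n8, en _ _ n17, en' _ _ n17,
    en _ _ n9, en _ _ n10, en _ _ n11, en _ _ n12, en _ _ n13, en' _ _ n13).
Qed.

End Clean.

Section Move.
Variable T : finType.

Lemma within_cnt1 (free : rel3 T) R1 R2 R3 X a :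
  within free R1 R2 R3 X -> a \notin R1 -> cnt1 a X = 0.
Proof.
move=> h na; apply/eqP; rewrite -leqn0 leqNgt -has_count; apply/hasPn=> -[[x y] z] /h[_ hx _ _] /=.
by apply: contra na => /eqP <-.
Qed.

Lemma within_cnt2 (free : rel3 T) R1 R2 R3 X a :
  within free R1 R2 R3 X -> a \notin R2 -> cnt2 a X = 0.
Proof.
move=> h na; apply/eqP; rewrite -leqn0 leqNgt -has_count; apply/hasPn=> -[[x y] z] /h[_ _ hx _] /=.
by apply: contra na => /eqP <-.
Qed.

Lemma within_cnt3 (free : rel3 T) R1 R2 R3 X a :
  within free R1 R2 R3 X -> a \notin R3 -> cnt3 a X = 0.
Proof.
move=> h na; apply/eqP; rewrite -leqn0 leqNgt -has_count; apply/hasPn=> -[[x y] z] /h[_ _ _ hx] /=.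
by apply: contra na => /eqP <-.
Qed.

Lemma cardCD2 (S : {set T}) x y n : #|~: S| <= n -> #|~: (S :\: [set x; y])| <= n + 2.
Proof.
move=> h; rewrite setCD; apply: leq_trans (leq_card_setU _ _) _.
by rewrite leq_add // cards2; case: eqP.
Qed.

(* [A = (a,b',c')] is any free triple of row [a]. After one switch has put [c] into
   the cell [(a',b')] and [install_clean] has put [c'] into [(a',b)], the four
   triples on [a,a'] x [b,b'] x [c,c'] form an intercalate whose switch removes
   [(a,b,c)]. Nothing is asked of row [a], which may lie outside [F], nor of
   the parity of [(a,b,c)]. *)
Lemma displace1 (L F free : rel3 T) G1 G2 G3 h1 h2 h3 N2 be al ta
    (al1 al2 al3 tg1 tg2 tg3 : {set T}) a b c :
  env L F free G1 G2 G3 h1 h2 h3 N2 be ->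
  #|~: al1| <= al -> #|~: al2| <= al -> #|~: al3| <= al ->
  #|~: tg1| <= ta -> #|~: tg2| <= ta -> #|~: tg3| <= ta ->
  al1 \subset G1 -> al2 \subset G2 -> al3 \subset G3 ->
  tg1 \subset al1 -> tg2 \subset al2 -> tg3 \subset al3 ->
  7 * (be + 4) + 6 * (al + 2) < N2 -> 5 * be + 4 * al + ta < N2 ->
  3 * be + 2 * al + 2 * ta < #|T| ->
  a \notin al1 -> b \notin al2 -> c \notin al3 ->
  L a b c -> b \in G2 -> c \in G3 ->
  exists L' rem a' b' c', [/\ latin L', [/\ L' a' b c, L' a b' c & L' a b c'],
    [/\ a' \in tg1, b' \in tg2 & c' \in tg3],
    keeps L L' ((a, b, c) :: rem) &
    [/\ within free (a |: al1) (b |: al2) (c |: al3) rem,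
      size rem <= 15, cnt1 a rem <= 3, cnt2 b rem <= 3 & cnt3 c rem <= 3]].
Proof.
move=> E A1 A2 A3 T1 T2 T3 S1 S2 S3 U1 U2 U3 hn1 hn2 hn3 na nb nc Lv bG cG.
have [lL D] := (e_lat E, e_dih E).
pose k x y d := [&& L x y d, F x y d & free x y d].
pose q b' a2 := [exists c', L a b' c' && F a2 b c'].
pose Bs := [::
  [set b' | ~~ [exists c', L a b' c' && free a b' c']];
  ~: tg2;
  [set b' | [exists c', L a b' c' && (c' \in ~: tg3)]];
  [set b' | ~~ [exists a0, k a0 b' c]];
  [set b' | [exists a0, F a0 b' c && (a0 \in ~: al1)]];
  [set b' | [exists c', L a b' c' && (c' \in [set c' | ~~ [exists a2, k a2 b c']])]];
  [set b' | [exists a2, q b' a2 && (a2 \in ~: al1)]]].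
have iL x x' y : L a x y -> L a x' y -> x = x' by apply: (lat2 lL).
have iF x x' y : F y x c -> F y x' c -> x = x' by apply: (d2 D).
have iq x x' y : q x y -> q x' y -> x = x'.
  case/existsP=> z /andP[i1 i2] /existsP[w /andP[i3 i4]].
  by rewrite (d3 D i2 i4) in i1; apply: iL i1 i3.
(* No half is available in row [a], which may lie outside [F]; so [b'] ranges over all columns and
   no parity is asked of it. *)
have [|b' _] := @pick_avoid _ setT Bs.
  rewrite cardsT; apply: leq_ltn_trans hn3; rewrite !big_cons big_nil addn0.
  have -> : 3 * be + 2 * al + 2 * ta = be + (ta + (ta + (be + (al + (be + al))))) by clear; lia.
  apply: leq_add (f12 E a) (leq_add T2 (leq_add (leq_trans (card_preim_rel _ iL) T3) _)).
  apply: leq_add (e32 E cG) (leq_add (leq_trans (card_preim_rel _ iF) A1) _).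
  exact: leq_add (leq_trans (card_preim_rel _ iL) (e23 E bG)) (leq_trans (card_preim_rel _ iq) A1).
rewrite /= => /and5P[/notin_miss[c' /andP[Lc' fc']]].
rewrite in_setC negbK => b'tg hb3 /notin_miss[a0 ka0] /and4P[hb5 hb6 hb7 _].
have F3 x d e : k x d e -> F x d e by case/and3P.
have L3 x d e : k x d e -> L x d e by case/and3P.
have c'tg : c' \in tg3 by have := notin_pre hb3 Lc'; rewrite in_setC negbK.
have a0al : a0 \in al1 by have := notin_pre hb5 (F3 _ _ _ ka0); rewrite in_setC negbK.
have [a2 ka2] : exists a2, k a2 b c' := notin_miss (notin_pre hb6 Lc').
have a2al : a2 \in al1.
  have qq : q b' a2 by apply/existsP; exists c'; rewrite Lc' (F3 _ _ _ ka2).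
  by have := notin_pre hb7 qq; rewrite in_setC negbK.
have b'al := subsetP U2 _ b'tg; have b'G := subsetP S2 _ b'al.
have c'al := subsetP U3 _ c'tg; have c'G := subsetP S3 _ c'al.
have a0G := subsetP S1 _ a0al.
pose Ds := [::
  [set a' | ~~ [exists c1, k a' b' c1]];
  [set a' | [exists c1, F a' b' c1 && (c1 \in ~: al3)]];
  [set a' | [exists c1, F a' b' c1 && (c1 \in [set c1 | ~~ [exists b1, k a0 b1 c1]])]];
  [set a' | ~~ [exists b1, k a' b1 c]];
  [set a' | [exists b1, F a' b1 c && (b1 \in ~: al2)]];
  ~: tg1;
  [set a' | ~~ [exists c2, k a' b c2]];
  [set a' | [exists c2, F a' b c2 && (c2 \in ~: al3)]];
  [set a' | ~~ [exists b2, k a' b2 c']];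
  [set a' | [exists b2, F a' b2 c' && (b2 \in ~: al2)]]].
have i2 y x x' z : F x y z -> F x' y z -> x = x' by apply: (d1 D).
have i3 z x x' y : F x y z -> F x' y z -> x = x' by apply: (d1 D).
(* Being opposite to [a0], the row [a'] closes an intercalate with [(a0,b',c)], whose switch brings
   [c] into [(a',b')]. The last four sets of [Ds] prepare [(a',b,c2)] and [(a',b2,c')] for
   [install_clean]. *)
have [|a' a'H] := @pick_avoid _ [set a' in G1 | h1 a' == ~~ h1 a0] Ds.
  apply: leq_trans (d_h1 D _); apply: leq_ltn_trans hn2.
  rewrite !big_cons big_nil addn0.
  have -> : 5 * be + 4 * al + ta =
    be + (al + (be + (be + (al + (ta + (be + (al + (be + al)))))))) by clear; lia.
  apply: leq_add (e21 E b'G) (leq_add (leq_trans (card_preim_rel _ (i2 b')) A3) _).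
  apply: leq_add (leq_trans (card_preim_rel _ (i2 b')) (e13 E a0G)) (leq_add (e31 E cG) _).
  apply: leq_add (leq_trans (card_preim_rel _ (i3 c)) A2) (leq_add T1 (leq_add (e21 E bG) _)).
  apply: leq_add (leq_trans (card_preim_rel _ (i2 b)) A3) (leq_add (e31 E c'G) _).
  exact: (leq_trans (card_preim_rel _ (i3 c')) A2).
move: a'H; rewrite inE => /andP[a'G /eqP a'h].
rewrite /= => /and5P[/notin_miss[c1 kc1] hb2 hd3 /notin_miss[b1 kb1] /and3P[hd5]].
rewrite in_setC negbK => a'tg /and5P[/notin_miss[c2 kc2] hd8 /notin_miss[b2 kb2] hd10 _].
have hh : h1 a' != h1 a0 by rewrite a'h; case: (h1 a0).
have [b1' [c1' [g1 g2 g3]]] := d_int1 D (F3 _ _ _ ka0) a'G hh.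
have ec := d3 D g2 (F3 _ _ _ kc1); have eb := d2 D g3 (F3 _ _ _ kb1); subst b1' c1'.
have kb1c1 : k a0 b1 c1.
  have [b3 kb3] := notin_miss (notin_pre hd3 g2).
  by rewrite (d2 D g1 (F3 _ _ _ kb3)).
have c1al : c1 \in al3 by have := notin_pre hb2 g2; rewrite in_setC negbK.
have b1al : b1 \in al2 by have := notin_pre hd5 g3; rewrite in_setC negbK.
have c2al : c2 \in al3 by have := notin_pre hd8 (F3 _ _ _ kc2); rewrite in_setC negbK.
have b2al : b2 \in al2 by have := notin_pre hd10 (F3 _ _ _ kb2); rewrite in_setC negbK.
have a'al := subsetP U1 _ a'tg.
have ne (S : {set T}) x y : x \in S -> y \notin S -> x <> y by move=> xS yS e; rewrite -e xS in yS.
have n1 := ne _ _ _ a0al na; have n2 := ne _ _ _ a2al na; have n3 := ne _ _ _ a'al na.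
have n4 := ne _ _ _ b'al nb; have n5 := ne _ _ _ b1al nb; have n6 := ne _ _ _ b2al nb.
have n7 := ne _ _ _ c'al nc; have n8 := ne _ _ _ c1al nc; have n9 := ne _ _ _ c2al nc.
have n10 : a' <> a0 by move=> e; rewrite e eqxx in hh.
have n11 : b1 <> b'.
  by move=> e; move: (F3 _ _ _ kb1); rewrite e => /(d1 D (F3 _ _ _ ka0)) /nesym.
have n12 : c' <> c1.
  by move=> e; apply: n3; move: (L3 _ _ _ kc1); rewrite -e => /(lat1 lL) /(_ Lc').
have n13 : c' <> c2.
  by move=> e; apply: n6; move: (F3 _ _ _ kc2); rewrite -e => /(d2 D (F3 _ _ _ kb2)).
have n14 : a' <> a2.
  by move=> e; apply: n13; move: (F3 _ _ _ kc2); rewrite e => /(d3 D (F3 _ _ _ ka2)).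
have [||| L1 [lL1 t01 [m1 m2 m3 m4]]] :=
  switch lL _ _ _ (L3 _ _ _ ka0) (L3 _ _ _ kb1c1) (L3 _ _ _ kc1) (L3 _ _ _ kb1).
- by apply/eqP/nesym.
- by apply/eqP/nesym.
- by apply/eqP/nesym=> e; apply: n10; move: (F3 _ _ _ kc1); rewrite e => /(d1 D) /(_ (F3 _ _ _ ka0)).
have q0 : L1 a b c by apply: t01 => //; not_listed.
have q1 : L1 a b' c' by apply: t01 => //; not_listed.
have q2 : L1 a' b c2 by apply: t01 (L3 _ _ _ kc2) _; not_listed.
have q3 : L1 a' b2 c' by apply: t01 (L3 _ _ _ kb2) _; not_listed.
have q4 : L1 a2 b c' by apply: t01 (L3 _ _ _ ka2) _; not_listed.
(* The switch removed four triples, whence [be + 4]; two lines in each direction are forced on the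
   inner trade and barred from its choices, whence [al + 2]. *)
have E1 := env_keeps E lL1 t01 (leqnn _).
have [||||||| L2 [rem [lL2 p0 t12 wi [sr r1 r2 r3 _]]]] := install_clean E1 (cardCD2 a' a2 A1) (cardCD2 b b2 A2)
   (cardCD2 c' c2 A3) hn1 _ _ _ _ _ _ _ q2 (F3 _ _ _ kc2) q3 (F3 _ _ _ kb2) q4 (F3 _ _ _ ka2).
- by rewrite !inE eqxx.
- by rewrite !inE eqxx orbT.
- by rewrite !inE eqxx.
- by rewrite !inE eqxx orbT.
- by rewrite !inE eqxx.
- by rewrite !inE eqxx orbT.
- by apply/eqP.
have sub1 : (al1 :\: [set a'; a2]) :|: [set a'; a2] \subset al1.
  by rewrite subUset subsetDl; apply/subsetP=> x; rewrite !inE => /orP[] /eqP ->.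
have sub3 : (al3 :\: [set c'; c2]) :|: [set c'; c2] \subset al3.
  by rewrite subUset subsetDl; apply/subsetP=> x; rewrite !inE => /orP[] /eqP ->.
have sub2 : (al2 :\: [set b; b2]) :|: [set b; b2] \subset b |: al2.
  apply/subsetP=> x; rewrite !inE => /orP[/andP[_ ->]|/orP[/eqP->|/eqP->]]; by rewrite ?eqxx ?b2al ?orbT.
have nrem x y z : x = a -> (x, y, z) \notin rem.
  by move=> ->; apply/negP=> /wi[_ /(subsetP sub1)]; rewrite (negPf na).
have v2 : L2 a b c by apply: t12 => //; rewrite mem_cat negb_or nrem // andbT; not_listed.
have A2' : L2 a b' c' by apply: t12 => //; rewrite mem_cat negb_or nrem // andbT; not_listed.
have c2' : L2 a' b' c.
  apply: t12 => //; rewrite mem_cat negb_or; apply/andP; split; first by not_listed.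
  by apply/negP=> /wi[/and3P[_ /(d1 D (F3 _ _ _ ka0)) /nesym]].
have [||| L3' [lL3 t23 [o1 o2 o3 o4]]] := switch lL2 _ _ _ v2 A2' p0 c2'.
- by apply/eqP/nesym.
- by apply/eqP/nesym.
- by apply/eqP/nesym.
have free1 x y z : (x, y, z) \in rem -> free x y z by move/wi=> [/and3P[]].
(* The eight triples listed here and the seven of the inner trade make 15. *)
exists L3', ([:: (a, b', c'); (a0, b', c); (a0, b1, c1); (a', b', c1); (a', b1, c);
   (a', b, c2); (a', b2, c'); (a2, b, c')] ++ rem), a', b', c'; split=> //.
- move=> x y z hL; rewrite in_cons negb_or mem_cat negb_or => /and3P[hx0 hx hr].
  apply: t23; [apply: t12; [apply: t01 => //|]|].
  + by apply: contra hx; rewrite !inE => /or4P[] ->; rewrite ?orbT.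
  + rewrite mem_cat negb_or hr andbT.
    by apply: contra hx; rewrite !inE => /or3P[] ->; rewrite ?orbT.
  + rewrite !inE negb_or hx0 negb_or /=; apply/andP; split.
      by apply: contra hx; rewrite !inE => ->.
    rewrite negb_or; apply/andP; split; apply/eqP=> -[ex ey ez]; move: hL; rewrite ex ey ez => hL.
    * by case: n13; apply: (lat3 lL hL (L3 _ _ _ kc2)).
    * by case: n10; apply: (lat1 lL hL (L3 _ _ _ ka0)).
have kf x y z : k x y z -> free x y z by case/and3P.
split.
- move=> x y z; rewrite mem_cat => /orP[hx|hr]; last first.
    have [_ /(subsetP sub1) x1 /(subsetP sub2) x2 /(subsetP sub3) x3] := wi _ _ _ hr.
    by split; [exact: free1 | rewrite inE x1 orbT | | rewrite inE x3 orbT].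
  rewrite !inE in hx; repeat (case/orP: hx => hx); case/eqP: hx => -> -> ->;
  by split; rewrite ?inE ?eqxx ?a0al ?a2al ?a'al ?b'al ?b1al ?b2al ?c'al ?c1al ?c2al ?orbT // kf.
- by rewrite size_cat sr.
- rewrite /cnt1 count_cat -/(cnt1 a rem) (within_cnt1 wi); last first.
    by apply: contra na => /(subsetP sub1).
  have en x : x <> a -> (x == a) = false by move/eqP/negPf.
  by rewrite /= eqxx !(en _ n1, en _ n2, en _ n3).
- rewrite /cnt2 count_cat -/(cnt2 b rem).
  have en x : x <> b -> (x == b) = false by move/eqP/negPf.
  by rewrite /= eqxx !(en _ n4, en _ n5, en _ n6) /= -[3]/(2 + 1) leq_add2l.
- rewrite /cnt3 count_cat -/(cnt3 c rem) (within_cnt3 wi); last first.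
    by apply: contra nc => /(subsetP sub3).
  have en x : x <> c -> (x == c) = false by move/eqP/negPf.
  by rewrite /= eqxx !(en _ n7, en _ n8, en _ n9).
Qed.

End Move.

(** * Permuting the coordinates; installing an arbitrary triple *)

Section Conj.
Variable T : finType.
Implicit Types (X : seq (T * T * T)) (t : T * T * T).

Definition tswap12 t := (t.1.2, t.1.1, t.2).
Definition tswap13 t := (t.2, t.1.2, t.1.1).

Lemma tswap12K : involutive tswap12. Proof. by case=> [[a b] c]. Qed.
Lemma tswap13K : involutive tswap13. Proof. by case=> [[a b] c]. Qed.

Lemma mem_tswap12 X a b c : ((a, b, c) \in map tswap12 X) = ((b, a, c) \in X).
Proof. by rewrite -(mem_map (inv_inj tswap12K) X). Qed.
Lemma mem_tswap13 X a b c : ((a, b, c) \in map tswap13 X) = ((c, b, a) \in X).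
Proof. by rewrite -(mem_map (inv_inj tswap13K) X). Qed.

Lemma keeps12 (L L' : rel3 T) X : keeps L L' X -> keeps (swap12 L) (swap12 L') (map tswap12 X).
Proof. by move=> t a b c hL; rewrite mem_tswap12 => /(t _ _ _ hL). Qed.
Lemma keeps13 (L L' : rel3 T) X : keeps L L' X -> keeps (swap13 L) (swap13 L') (map tswap13 X).
Proof. by move=> t a b c hL; rewrite mem_tswap13 => /(t _ _ _ hL). Qed.

Lemma within12 (free : rel3 T) R1 R2 R3 X :
  within free R1 R2 R3 X -> within (swap12 free) R2 R1 R3 (map tswap12 X).
Proof. by move=> h a b c; rewrite mem_tswap12 => /h[]. Qed.
Lemma within13 (free : rel3 T) R1 R2 R3 X :
  within free R1 R2 R3 X -> within (swap13 free) R3 R2 R1 (map tswap13 X).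
Proof. by move=> h a b c; rewrite mem_tswap13 => /h[]. Qed.

Lemma cnt_tswap12 X a : (cnt1 a (map tswap12 X) = cnt2 a X) * (cnt2 a (map tswap12 X) = cnt1 a X)
   * (cnt3 a (map tswap12 X) = cnt3 a X).
Proof. by rewrite /cnt1 /cnt2 /cnt3 !count_map. Qed.
Lemma cnt_tswap13 X a : (cnt1 a (map tswap13 X) = cnt3 a X) * (cnt2 a (map tswap13 X) = cnt2 a X)
   * (cnt3 a (map tswap13 X) = cnt1 a X).
Proof. by rewrite /cnt1 /cnt2 /cnt3 !count_map. Qed.

(** This is what [displace] asks of a triple. The remaining triples of the base square lie on three
    adjoined lines, and the relabelling is chosen so that no pair of [P] occurs in them. *)
Definition almost_inside (G1 G2 G3 : {set T}) a b c :=
  [|| (b \in G2) && (c \in G3), (a \in G1) && (c \in G3) | (a \in G1) && (b \in G2)].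

(** [displace1] needs the lines [b] and [c] inside; a permutation of the coordinates brings any two
    inside lines into that position. *)
Lemma displace (L F free : rel3 T) G1 G2 G3 h1 h2 h3 N2 be al ta
    (al1 al2 al3 tg1 tg2 tg3 : {set T}) a b c :
  env L F free G1 G2 G3 h1 h2 h3 N2 be ->
  #|~: al1| <= al -> #|~: al2| <= al -> #|~: al3| <= al ->
  #|~: tg1| <= ta -> #|~: tg2| <= ta -> #|~: tg3| <= ta ->
  al1 \subset G1 -> al2 \subset G2 -> al3 \subset G3 ->
  tg1 \subset al1 -> tg2 \subset al2 -> tg3 \subset al3 ->
  7 * (be + 4) + 6 * (al + 2) < N2 -> 5 * be + 4 * al + ta < N2 ->
  3 * be + 2 * al + 2 * ta < #|T| ->
  a \notin al1 -> b \notin al2 -> c \notin al3 ->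
  L a b c -> almost_inside G1 G2 G3 a b c ->
  exists L' rem a' b' c', [/\ latin L', [/\ L' a' b c, L' a b' c & L' a b c'],
    [/\ a' \in tg1, b' \in tg2 & c' \in tg3],
    keeps L L' ((a, b, c) :: rem) &
    [/\ within free (a |: al1) (b |: al2) (c |: al3) rem,
      size rem <= 15, cnt1 a rem <= 3, cnt2 b rem <= 3 & cnt3 c rem <= 3]].
Proof.
move=> E A1 A2 A3 T1 T2 T3 S1 S2 S3 U1 U2 U3 hn1 hn2 hn3 na nb nc Lv.
case/or3P=> /andP[g1 g2].
- exact: (displace1 E A1 A2 A3 T1 T2 T3 S1 S2 S3 U1 U2 U3).
- have [L' [rem [b' [a' [c' [lL' [p1 p2 p3] [q1 q2 q3] t [w sz n1 n2 n3]]]]]]] :=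
    displace1 (env12 E) A2 A1 A3 T2 T1 T3 S2 S1 S3 U2 U1 U3 hn1 hn2 hn3 nb na nc Lv g1 g2.
  exists (swap12 L'), (map tswap12 rem), a', b', c'; split; rewrite ?cnt_tswap12 ?size_map //.
  + exact: latin12.
  + exact: (keeps12 t).
  + by split=> //; apply: (within12 w).
- have [L' [rem [c' [b' [a' [lL' [p1 p2 p3] [q1 q2 q3] t [w sz n1 n2 n3]]]]]]] :=
    displace1 (env13 E) A3 A2 A1 T3 T2 T1 S3 S2 S1 U3 U2 U1 hn1 hn2 hn3 nc nb na Lv g2 g1.
  exists (swap13 L'), (map tswap13 rem), a', b', c'; split; rewrite ?cnt_tswap13 ?size_map //.
  + exact: latin13.
  + exact: (keeps13 t).
  + by split=> //; apply: (within13 w).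
Qed.

Lemma cardCD (S B : {set T}) n m : #|~: S| <= n -> #|B| <= m -> #|~: (S :\: B)| <= n + m.
Proof.
by move=> h hB; rewrite setCD; apply: leq_trans (leq_card_setU _ _) _; rewrite leq_add.
Qed.

Lemma cardU (A B : {set T}) n m : #|A| <= n -> #|B| <= m -> #|A :|: B| <= n + m.
Proof. by move=> h hB; apply: leq_trans (leq_card_setU _ _) _; rewrite leq_add. Qed.

(* The three triples on the pairs of [(r,c,s)] are displaced onto fresh lines
   [s2], [c'], [r'] chosen so that [(r',c',s2)] can be installed cleanly. *)
Lemma install_any (L F free : rel3 T) G1 G2 G3 h1 h2 h3 N2 be al
    (al1 al2 al3 : {set T}) r r0 c c0 s s' :
  env L F free G1 G2 G3 h1 h2 h3 N2 be ->
  #|~: al1| <= al -> #|~: al2| <= al -> #|~: al3| <= al ->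
  al1 \subset G1 -> al2 \subset G2 -> al3 \subset G3 ->
  7 * (be + 48) + 7 * (al + 3) < N2 ->
  7 * (be + 48) + 8 * (al + 3) < #|T| ->
  r \notin al1 -> r0 \notin al1 -> c \notin al2 -> c0 \notin al2 ->
  s \notin al3 -> s' \notin al3 -> s != s' ->
  L r c s' -> L r c0 s -> L r0 c s ->
  almost_inside G1 G2 G3 r c s' -> almost_inside G1 G2 G3 r c0 s -> almost_inside G1 G2 G3 r0 c s ->
  (forall x, ~~ free r c x) -> (forall x, ~~ free r x s) -> (forall x, ~~ free x c s) ->
  exists L' rem, [/\ latin L', L' r c s,
    keeps L L' ([:: (r, c, s'); (r, c0, s); (r0, c, s)] ++ rem),
    within free (al1 :|: [set r; r0]) (al2 :|: [set c; c0]) (al3 :|: [set s; s']) rem &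
    [/\ size rem <= 55,
      cnt1 r rem <= 6 /\ cnt1 r0 rem <= 6,
      cnt2 c rem <= 6 /\ cnt2 c0 rem <= 6,
      cnt3 s rem <= 6 /\ cnt3 s' rem <= 6 &
     [/\ forall a b d, L' a b d -> ~~ L a b d -> (b, d) <> (c, s) ->
         (forall x, ~~ free x b d) -> a \in al1,
        forall a b d, L' a b d -> ~~ L a b d -> (a, d) <> (r, s) ->
         (forall x, ~~ free a x d) -> b \in al2 &
        forall a b d, L' a b d -> ~~ L a b d -> (a, b) <> (r, c) ->
         (forall x, ~~ free a b x) -> d \in al3]]].
Proof.
move=> E A1 A2 A3 S1 S2 S3 hn hT nr nr0 nc nc0 ns ns' /eqP ss' Lx Ly Lz ax ay az fx fy fz.
have lL := e_lat E; have D := e_dih E.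
have rr0 : r <> r0 by move=> e; apply: ss'; move: Lz; rewrite -e => /(lat3 lL) /(_ Lx).
have cc0 : c <> c0 by move=> e; apply: ss'; move: Ly; rewrite -e => /(lat3 lL) /(_ Lx).
have ne (S : {set T}) x y : x \in S -> y \notin S -> x <> y by move=> xS yS e; rewrite -e xS in yS.
have [||| L1 [rem1 [r1 [c1 [s2 [lL1 [x1 x2 x3] [v1 v2 v3] t1 [w1 z1 k11 k12 k13]]]]]]] :=
  displace E A1 A2 A3 A1 A2 A3 S1 S2 S3 (subxx _) (subxx _) (subxx _) _ _ _ nr nc ns' Lx ax.
- by move: hn; clear; lia.
- by move: hn; clear; lia.
- by move: hT; clear; lia.
have n1 := ne _ _ _ v1 nr; have n2 := ne _ _ _ v2 nc; have n3 := ne _ _ _ v3 ns'.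
have n3' := ne _ _ _ v3 ns.
have nf R1 R2 R3 X a b d : within free R1 R2 R3 X -> ~~ free a b d -> (a, b, d) \notin X.
  by move=> w h; apply/negP=> /w[]; rewrite (negPf h).
have y1 : L1 r c0 s by apply: t1 => //; rewrite in_cons negb_or (nf _ _ _ _ _ _ _ w1) // andbT; apply/eqP; congruence.
have zz1 : L1 r0 c s by apply: t1 => //; rewrite in_cons negb_or (nf _ _ _ _ _ _ _ w1) // andbT; apply/eqP; congruence.
(* A displacement removes its triple and at most 15 others, so it costs 16; three of them give the
   48 of the hypotheses. *)
have E1 : env L1 F free G1 G2 G3 h1 h2 h3 N2 (be + 16) by apply: env_keeps E lL1 t1 _.
have s2G := subsetP S3 _ v3.
pose k1 a b d := [&& L1 a b d, F a b d & free a b d].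
pose al3' := al3 :\ s2.
have A3' : #|~: al3'| <= al + 1 by apply: cardCD; rewrite ?cards1.
have S3' : al3' \subset G3 by apply: subset_trans (subsetDl _ _) S3.
have A1w : #|~: al1| <= al + 1 by apply: leq_trans A1 _; rewrite leq_addr.
have A2w : #|~: al2| <= al + 1 by apply: leq_trans A2 _; rewrite leq_addr.
(* The column [c'] reached next must contain a clean triple [(ro,c',s2)] in an allowed row, one of
   the three needed to install [(r',c',s2)]. *)
pose M1 := [set b | ~~ [exists a, k1 a b s2]].
pose M2 := [set b | [exists a, F a b s2 && (a \in ~: al1)]].
have cM1 : #|M1| <= be + 16 := e32 E1 s2G.
have cM2 : #|M2| <= al.
  by apply: leq_trans A1; apply: card_preim_rel => x x' y; apply: (d2 D).
pose tg2 := al2 :\: (M1 :|: M2).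
have ctg2 : #|~: tg2| <= al + (be + 16 + al) by apply: cardCD => //; apply: cardU.
have ctg1 : #|~: al1| <= al + (be + 16 + al) by apply: leq_trans A1 _; rewrite leq_addr.
have ctg3 : #|~: al3'| <= al + (be + 16 + al).
  by apply: leq_trans A3' _; clear; lia.
have [|||| L2 [rem2 [r2 [c' [s3 [lL2 [y2 y3 y4] [v4 v5 v6] t2 [w2 z2 k21 k22 k23]]]]]]] :=
  displace E1 A1w A2w A3' ctg1 ctg2 ctg3 S1 S2 S3' (subxx _) (subsetDl _ _) (subxx _) _ _ _ nr nc0 _ y1 ay.
- by move: hn; clear; lia.
- by move: hn; clear; lia.
- by move: hT; clear; lia.
- by rewrite in_setD1 negb_and ns orbT.
have c'al : c' \in al2 by move: v5; rewrite in_setD => /andP[].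
have [ro kro] : exists ro, k1 ro c' s2.
  by move: v5; rewrite in_setD in_setU negb_or => /andP[/andP[h _] _]; apply: notin_miss h.
have roal : ro \in al1.
  move: v5; rewrite in_setD in_setU negb_or => /andP[/andP[_ h] _].
  have := notin_pre h; move/(_ ro); rewrite in_setC negbK; apply.
  by case/and3P: kro.
have s3al : s3 \in al3 by move: v6; rewrite in_setD1 => /andP[].
have n4 := ne _ _ _ v4 nr; have n5 := ne _ _ _ c'al nc; have n6 := ne _ _ _ c'al nc0.
have n7 := ne _ _ _ s3al ns.
have n8 := ne _ _ _ roal nr.
have E2 : env L2 F free G1 G2 G3 h1 h2 h3 N2 (be + 32).
  by rewrite -[32]/(16 + 16) addnA; apply: env_keeps E1 lL2 t2 _.
pose k2 a b d := [&& L2 a b d, F a b d & free a b d].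
have kro2 : k2 ro c' s2.
  case/and3P: kro => h4 h5 h6; apply/and3P; split=> //; apply: t2 => //.
  rewrite in_cons negb_or; apply/andP; split; first by apply/eqP; congruence.
  by apply/negP=> /w2[_ _ _]; rewrite !inE eqxx /= orbF => /eqP.
have xx2 : L2 r c s2.
  apply: t2 => //; rewrite in_cons negb_or (nf _ _ _ _ _ _ _ w2) // andbT; apply/eqP; congruence.
have zz2 : L2 r0 c s.
  apply: t2 => //; rewrite in_cons negb_or (nf _ _ _ _ _ _ _ w2) // andbT; apply/eqP; congruence.
pose al2' := al2 :\ c'.
have A2' : #|~: al2'| <= al + 1 by apply: cardCD; rewrite ?cards1.
have S2' : al2' \subset G2 by apply: subset_trans (subsetDl _ _) S2.
have c'G := subsetP S2 _ c'al.
(* The row [r'] must supply the other two, [(r',c',d)] and [(r',e,s2)], again on allowed lines. *)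
pose K1 := [set a | ~~ [exists d, k2 a c' d]].
pose K2 := [set a | ~~ [exists b, k2 a b s2]].
pose K3 := [set a | [exists d, F a c' d && (d \in ~: al3)]].
pose K4 := [set a | [exists b, F a b s2 && (b \in ~: al2)]].
have cK1 : #|K1| <= be + 32 := e21 E2 c'G.
have cK2 : #|K2| <= be + 32 := e31 E2 s2G.
have cK3 : #|K3| <= al.
  by apply: leq_trans A3; apply: card_preim_rel => x x' y; apply: (d1 D).
have cK4 : #|K4| <= al.
  by apply: leq_trans A2; apply: card_preim_rel => x x' y; apply: (d1 D).
pose tg1 := al1 :\: (((K1 :|: K2) :|: (K3 :|: K4)) :|: [set ro]).
pose ta := al + ((((be + 32) + (be + 32)) + (al + al)) + 1).
have ctg1' : #|~: tg1| <= ta.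
  by apply: cardCD => //; apply: cardU; rewrite ?cards1 //; apply: cardU; apply: cardU.
have ctg2' : #|~: al2'| <= ta by apply: leq_trans A2' _; rewrite /ta; clear; lia.
have ctg3' : #|~: al3'| <= ta by apply: leq_trans A3' _; rewrite /ta; clear; lia.
have [||||| L3 [rem3 [r' [c4 [s4 [lL3 [u1 u2 u3] [v7 v8 v9] t3 [w3 z3 k31 k32 k33]]]]]]] :=
  displace E2 A1w A2' A3' ctg1' ctg2' ctg3' S1 S2' S3' (subsetDl _ _) (subxx _) (subxx _) _ _ _ nr0 _ _ zz2 az.
- by move: hn; clear; lia.
- by move: hn; rewrite /ta; clear; lia.
- by move: hT; rewrite /ta; clear; lia.
- by rewrite in_setD1 negb_and nc orbT.
- by rewrite in_setD1 negb_and ns orbT.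
have c4al : c4 \in al2 by move: v8; rewrite in_setD1 => /andP[].
have s4al : s4 \in al3 by move: v9; rewrite in_setD1 => /andP[].
move: v7; rewrite in_setD !in_setU !negb_or => /andP[/andP[/andP[/andP[q1 q2] /andP[q3 q4]] q5] r'al].
have [d kd] := notin_miss q1; have [e ke] := notin_miss q2.
have dal : d \in al3.
  by have := notin_pre q3; move/(_ d); rewrite in_setC negbK; apply; case/and3P: kd.
have eal : e \in al2.
  by have := notin_pre q4; move/(_ e); rewrite in_setC negbK; apply; case/and3P: ke.
have nr'ro : r' <> ro by move=> h; rewrite h inE eqxx in q5.
have n9 := ne _ _ _ r'al nr; have n10 := ne _ _ _ r'al nr0.
have E3 : env L3 F free G1 G2 G3 h1 h2 h3 N2 (be + 48).
  by rewrite -[48]/(32 + 16) addnA; apply: env_keeps E2 lL3 t3 _.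
have nin3 a b dd : (b == c') || (dd == s2) -> (a, b, dd) \notin (r0, c, s) :: rem3.
  move=> h; rewrite in_cons negb_or; apply/andP; split.
    by apply/eqP=> -[_ eb ed]; case/orP: h => /eqP; congruence.
  apply/negP=> /w3[_ _]; rewrite !inE.
  case/orP: h => /eqP ->; rewrite eqxx /= orbF.
    by move/eqP: n5 => /negPf ->.
  by move=> _; move/eqP: n3' => /negPf ->.
have kk3 a b dd : k2 a b dd -> (b == c') || (dd == s2) -> [&& L3 a b dd, F a b dd & free a b dd].
  by case/and3P=> h4 h5 h6 h7; rewrite h5 h6 /= andbT; apply: t3 => //; apply: nin3.
have kro3 := kk3 _ _ _ kro2; rewrite eqxx in kro3; case/and3P: (kro3 isT) => ro1 ro2 ro3.
have kd3 := kk3 _ _ _ kd; rewrite eqxx in kd3; case/and3P: (kd3 isT) => d1' d2' d3'.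
have ke3 := kk3 _ _ _ ke; rewrite eqxx orbT in ke3; case/and3P: (ke3 isT) => e1 e2 e3.
have nd : s2 <> d by move=> h; apply: nr'ro; apply: (d1 D d2'); rewrite -h.
have xx3 : L3 r c s2.
  apply: t3 => //; rewrite in_cons negb_or (nf _ _ _ _ _ _ _ w3) // andbT; apply/eqP; congruence.
have yy3 : L3 r c' s.
  apply: t3 => //; rewrite in_cons negb_or (nf _ _ _ _ _ _ _ w3) // andbT; apply/eqP; congruence.
have [|||||||| L4 [rem4 [lL4 p4 t4 w4 [z4 _ _ _ _]]]] :=
  install_clean E3 (cardCD2 r' ro A1) (cardCD2 c' e A2) (cardCD2 s2 d A3) _ _ _ _ _ _ _ _ d1' d2' e1 e2 ro1 ro2.
- by move: hn; clear; lia.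
- by rewrite !inE eqxx.
- by rewrite !inE eqxx orbT.
- by rewrite !inE eqxx.
- by rewrite !inE eqxx orbT.
- by rewrite !inE eqxx.
- by rewrite !inE eqxx orbT.
- by apply/eqP.
have w4' : within free al1 al2 al3 rem4.
  move=> a b dd /w4[/and3P[_ _ h4]]; rewrite !inE => h5 h6 h7; split=> //.
  - by case/orP: h5 => [/andP[]|/orP[]/eqP ->].
  - by case/orP: h6 => [/andP[]|/orP[]/eqP ->].
  - by case/orP: h7 => [/andP[]|/orP[]/eqP ->].
have nf4 a b dd : ~~ free a b dd ->
    (a, b, dd) \notin [:: (r', c', d); (r', e, s2); (ro, c', s2)] ++ rem4.
  move=> h; rewrite mem_cat negb_or (nf _ _ _ _ _ _ _ w4') // andbT.
  by apply: contra h; rewrite !inE => /or3P[] /eqP[-> -> ->].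
(* Now [(r,c,s2)], [(r,c',s)], [(r',c,s)] and [(r',c',s2)] form an intercalate, whose switch creates
   [(r,c,s)]. *)
have [||| L5 [lL5 t5 [o1 o2 o3 o4]]] :=
  switch lL4 _ _ _ (t4 _ _ _ xx3 (nf4 _ _ _ (fx _))) (t4 _ _ _ yy3 (nf4 _ _ _ (fy _)))
     (t4 _ _ _ u1 (nf4 _ _ _ (fz _))) p4.
- by apply/eqP/nesym.
- by apply/eqP/nesym.
- by apply/eqP.
pose rem := rem1 ++ rem2 ++ rem3 ++ [:: (r', c', d); (r', e, s2); (ro, c', s2)] ++ rem4.
have wi : within free (al1 :|: [set r; r0]) (al2 :|: [set c; c0]) (al3 :|: [set s; s']) rem.
  move=> a b dd; rewrite !mem_cat => /orP[/w1|/orP[/w2|/orP[/w3|/orP[]]]]; last by case/w4'; rewrite !inE => -> -> -> ->.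
  - by case=> ->; rewrite !inE => /orP[->|->] /orP[->|->] /orP[->|->]; rewrite ?orbT.
  - case=> ->; rewrite !inE => h4 h5 h6; split=> //.
    + by case/orP: h4 => ->; rewrite ?orbT.
    + by case/orP: h5 => ->; rewrite ?orbT.
    + by case/orP: h6 => [->|/andP[_ ->]]; rewrite ?orbT.
  - case=> ->; rewrite !inE => h4 h5 h6; split=> //.
    + by case/orP: h4 => ->; rewrite ?orbT.
    + by case/orP: h5 => [->|/andP[_ ->]]; rewrite ?orbT.
    + by case/orP: h6 => [->|/andP[_ ->]]; rewrite ?orbT.
  - by rewrite !inE => /or3P[] /eqP[-> -> ->]; rewrite ?r'al ?c'al ?dal ?eal ?v3 ?roal.
have T5 : keeps L L5 ([:: (r, c, s'); (r, c0, s); (r0, c, s)] ++ rem).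
  move=> a b dd hL.
  have ncat (X Y : seq (T * T * T)) t : (t \notin X ++ Y) = (t \notin X) && (t \notin Y).
    by rewrite mem_cat negb_or.
  have ncons u (X : seq (T * T * T)) t : (t \notin u :: X) = (t != u) && (t \notin X).
    by rewrite in_cons negb_or.
  rewrite /rem ncat (ncat rem1) (ncat rem2) (ncat rem3) => /and5P[m0 m4 m5 m6 m7].
  move: m0; rewrite 3!ncons => /and4P[m1 m2 m3 _].
  have l3 : L3 a b dd.
    apply: t3; last by rewrite in_cons negb_or m3 m6.
    apply: t2; last by rewrite in_cons negb_or m2 m5.
    by apply: t1 => //; rewrite in_cons negb_or m1 m4.
  apply: t5; first exact: t4.
  rewrite 4!ncons; apply/and5P; split=> //.
  - by apply/eqP=> -[ea eb ed]; move: hL; rewrite ea eb ed => /(lat3 lL Lx) /nesym.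
  - by apply/eqP=> -[ea eb ed]; move: hL; rewrite ea eb ed => /(lat2 lL Ly) /nesym.
  - by apply/eqP=> -[ea eb ed]; move: hL; rewrite ea eb ed => /(lat1 lL Lz) /nesym.
  - by apply/eqP=> -[ea eb ed]; move: l3; rewrite ea eb ed => /(lat3 lL3 d1') /nesym.
(* The triples of [rem] are all free, so a triple that is not free survives from each stage to the
   end unless it is one of the few listed. This locates the new place of every pair that a
   displacement moves. *)
have fin a b dd : L3 a b dd -> ~~ free a b dd ->
   (a, b, dd) \notin [:: (r, c, s2); (r, c', s); (r', c, s); (r', c', s2)] -> L5 a b dd.
  by move=> h4 h5; apply: t5; apply: t4 => //; apply: nf4.
have fin2 a b dd : L2 a b dd -> ~~ free a b dd ->
   (a, b, dd) \notin [:: (r0, c, s); (r, c, s2); (r, c', s); (r', c, s); (r', c', s2)] -> L5 a b dd.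
  move=> h4 h5; rewrite in_cons negb_or => /andP[h6]; apply: fin => //; apply: t3 => //.
  by rewrite in_cons negb_or h6 (nf _ _ _ _ _ _ _ w3).
have fin1 a b dd : L1 a b dd -> ~~ free a b dd ->
   (a, b, dd) \notin [:: (r, c0, s); (r0, c, s); (r, c, s2); (r, c', s); (r', c, s); (r', c', s2)] -> L5 a b dd.
  move=> h4 h5; rewrite in_cons negb_or => /andP[h6]; apply: fin2 => //; apply: t2 => //.
  by rewrite in_cons negb_or h6 (nf _ _ _ _ _ _ _ w2).
have old a b dd : L a b dd -> ~~ free a b dd ->
   [\/ (a, b, dd) = (r, c, s'), (a, b, dd) = (r, c0, s), (a, b, dd) = (r0, c, s) | L5 a b dd].
  move=> h4 h5; case h6: ((a, b, dd) \in [:: (r, c, s'); (r, c0, s); (r0, c, s)]).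
    by move: h6; rewrite !inE => /or3P[] /eqP ->; [constructor 1 | constructor 2 | constructor 3].
  by constructor 4; apply: T5 => //; rewrite mem_cat negb_or h6 (nf _ _ _ _ _ _ _ wi).
exists L5, rem; split=> //.
have en (S : {set T}) x y : x \in S -> y \notin S -> (x == y) = false.
  by move=> xS yS; apply/eqP; apply: ne yS.
have nU (S : {set T}) x y : x <> y -> x \notin S -> x \notin y |: S.
  by move=> h4 h5; rewrite in_setU1 negb_or h5 andbT; apply/eqP.
have nD (S : {set T}) x y : x \notin S -> x \notin S :\ y.
  by move=> h4; rewrite in_setD1 negb_and h4 orbT.
split.
- by rewrite !size_cat /= z4; move: z1 z2 z3; clear; lia.
- rewrite /cnt1 !count_cat -!/(cnt1 _ _) /=; split.
  + rewrite (within_cnt1 w3 (nU _ _ _ rr0 nr)) (within_cnt1 w4' nr) !(en al1) //.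
    by move: k11 k21; clear; lia.
  + rewrite (within_cnt1 w1 (nU _ _ _ (nesym rr0) nr0)) (within_cnt1 w2 (nU _ _ _ (nesym rr0) nr0)).
    by rewrite (within_cnt1 w4' nr0) !(en al1) //; move: k31; clear; lia.
- rewrite /cnt2 !count_cat -!/(cnt2 _ _) /=; split.
  + rewrite (within_cnt2 w2 (nU _ _ _ cc0 nc)) (within_cnt2 w4' nc) !(en al2) //.
    by move: k12 k32; clear; lia.
  + rewrite (within_cnt2 w1 (nU _ _ _ (nesym cc0) nc0)).
    rewrite (within_cnt2 w3 (nU _ _ _ (nesym cc0) (nD _ _ _ nc0))).
    by rewrite (within_cnt2 w4' nc0) !(en al2) //; move: k22; clear; lia.
- rewrite /cnt3 !count_cat -!/(cnt3 _ _) /=; split.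
  + rewrite (within_cnt3 w1 (nU _ _ _ ss' ns)) (within_cnt3 w4' ns) !(en al3) //.
    by move: k23 k33; clear; lia.
  + rewrite (within_cnt3 w2 (nU _ _ _ (nesym ss') (nD _ _ _ ns'))).
    rewrite (within_cnt3 w3 (nU _ _ _ (nesym ss') (nD _ _ _ ns'))).
    by rewrite (within_cnt3 w4' ns') !(en al3) //; move: k13; clear; lia.
- split.
  + move=> a b dd h4 /negP h5 h6 h7; have [a0 ha0] := lat23 lL b dd.
    case: (old _ _ _ ha0 (h7 _)) => [[_ eb ed]|[_ eb ed]|[_ eb ed]|/(lat1 lL5 h4) ea]; subst.
    * have := fin1 _ _ _ x1 (h7 r1); rewrite (_ : _ \notin _) => [/(_ isT) /(lat1 lL5 h4) -> //|].
      by not_listed.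
    * have := fin2 _ _ _ y2 (h7 r2); rewrite (_ : _ \notin _) => [/(_ isT) /(lat1 lL5 h4) -> //|].
      by not_listed.
    * by case: h6.
    * by case: h5.
  + move=> a b dd h4 /negP h5 h6 h7; have [b0 hb0] := lat13 lL a dd.
    case: (old _ _ _ hb0 (h7 _)) => [[ea _ ed]|[ea _ ed]|[ea _ ed]|/(lat2 lL5 h4) eb]; subst.
    * have := fin1 _ _ _ x2 (h7 c1); rewrite (_ : _ \notin _) => [/(_ isT) /(lat2 lL5 h4) -> //|].
      by not_listed.
    * by case: h6.
    * have := fin _ _ _ u2 (h7 c4); rewrite (_ : _ \notin _) => [/(_ isT) /(lat2 lL5 h4) -> //|].
      by not_listed.
    * by case: h5.
  + move=> a b dd h4 /negP h5 h6 h7; have [d0 hd0] := lat12 lL a b.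
    case: (old _ _ _ hd0 (h7 _)) => [[ea eb _]|[ea eb _]|[ea eb _]|/(lat3 lL5 h4) ed]; subst.
    * by case: h6.
    * have := fin2 _ _ _ y4 (h7 s3); rewrite (_ : _ \notin _) => [/(_ isT) /(lat3 lL5 h4) -> //|].
      by not_listed.
    * have := fin _ _ _ u3 (h7 s4); rewrite (_ : _ \notin _) => [/(_ isT) /(lat3 lL5 h4) -> //|].
      by not_listed.
    * by case: h5.
Qed.

End Conj.

(** * Accounting *)

Section Account.
Variable T : finType.
Implicit Types (L F free : rel3 T) (X S rem : seq (T * T * T)) (g : T -> nat).

(** Along a line of a Latin square places and entries correspond one to one, so spoilt places are at
    most as many as spoilt entries. A single number, [defect], can then serve both readings of a
    line. *)
Lemma miss_swap (R h : T -> T -> bool) :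
  (forall b, exists c, R b c) -> (forall b b' c, R b c -> R b' c -> b = b') ->
  miss (fun b c => R b c && h b c) <= miss (fun c b => R b c && h b c).
Proof.
move=> tot inj; rewrite /miss.
apply: leq_trans (card_preim_rel _ inj).
apply/subset_leq_card/subsetP=> b; rewrite !inE => hb.
have [c hc] := tot b; apply/existsP; exists c; rewrite hc inE /=.
apply: contra hb => /existsP[b' /andP[hR hh]]; apply/existsP; exists c.
by rewrite hc -(inj _ _ _ hR hc).
Qed.

Lemma miss_sub (R R' : T -> T -> bool) :
  (forall x y, R x y -> R' x y) -> miss R' <= miss R.
Proof.
move=> h; apply/subset_leq_card/subsetP=> x; rewrite !inE; apply: contra.
by case/existsP=> y /h hy; apply/existsP; exists y.
Qed.

(* Outside [G1] the table [F] is empty, and only the pairs of [P] spoil a cell. *)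
Definition defect L F free (G1 : {set T}) a :=
  miss (fun b c => L a b c && (free a b c && ((a \in G1) ==> F a b c))).

(** A waiting triple forces damage on row [a] in two roles: as its own row, or because its column
    and symbol presently meet in row [a]. These are the [r] and [r0] of a trade. *)
Definition pending L S a :=
  count (fun p => p.1.1 == a) S + count (fun p => L a p.1.2 p.2) S.

(* A triple of [P] yet to be installed costs its line at most 6 further cells,
   which are charged in advance; [g] only grows on lines chosen freely by a
   trade, and this is done only while [g] is small. *)
Record budget L F free (G1 : {set T}) S base g cap tot : Prop := Half {
  h_u : forall a, defect L F free G1 a + 6 * pending L S a <= base + g a;
  h_cap : forall a, g a <= cap;
  h_tot : \sum_a g a <= tot }.

Lemma budget_drop L F free G1 p S base g cap cap' tot :
  cap <= cap' ->
  budget L F free G1 (p :: S) base g cap tot -> budget L F free G1 S base g cap' tot.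
Proof.
move=> hc h; split=> [a|a|]; last exact: h_tot h; last exact: leq_trans (h_cap h a) hc.
apply: leq_trans (h_u h a); rewrite leq_add2l leq_mul2l /= /pending /= addnACA.
exact: leq_addl.
Qed.

Lemma budget_cap L F free G1 S base g cap cap' tot :
  cap <= cap' ->
  budget L F free G1 S base g cap tot -> budget L F free G1 S base g cap' tot.
Proof.
move=> hc h; split=> [a|a|]; [exact: h_u h a | exact: leq_trans (h_cap h a) hc | exact: h_tot h].
Qed.

Definition changed L L' S :=
  count (fun p => [exists a, L' a p.1.2 p.2 && ~~ L a p.1.2 p.2]) S.

(** Free triples carry no pair of a waiting triple, so only the triples of [X] can move such a pair,
    and each of them moves at most one. *)
Lemma changed_le L L' free X rem S :
  latin L -> latin L' -> keeps L L' (X ++ rem) ->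
  (forall a b c, (a, b, c) \in rem -> free a b c) ->
  (forall p x, p \in S -> ~~ free x p.1.2 p.2) ->
  uniq [seq (p.1.2, p.2) | p <- S] ->
  changed L L' S <= size X.
Proof.
move=> lL lL' t fr nf un; rewrite /changed -size_filter.
rewrite -(size_map (fun p : T * T * T => (p.1.2, p.2))) -(size_map (fun p : T * T * T => (p.1.2, p.2)) X).
apply: uniq_leq_size; first by apply: subseq_uniq un; apply/map_subseq/filter_subseq.
move=> _ /mapP[[[r c] s] + ->]; rewrite mem_filter => /andP[/existsP[a /= /andP[h1 /negP h2]] pS].
have [a0 ha0] := lat23 lL c s; apply/mapP; exists (a0, c, s) => //.
apply: contraT => nX; case: h2; suff h : L' a0 c s by rewrite (lat1 lL' h1 h).
apply: t => //; rewrite mem_cat negb_or nX; apply/negP=> /fr.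
by move/negP: (nf _ a0 pS).
Qed.

Lemma count_diff (a b : pred (T * T * T)) S :
  count a S <= count b S + count (fun p => a p && ~~ b p) S.
Proof.
elim: S => //= p S IH; rewrite addnACA leq_add //.
by case: (a p) (b p) => [] [].
Qed.

Lemma budget_step L L' F free (G1 : {set T}) base g cap cap' tot th R A
    (al1 R2 R3 : {set T}) r r0 c s S X rem :
  latin L -> latin L' -> L r0 c s -> r != r0 ->
  keeps L L' (X ++ rem) ->
  (forall a b d, (a, b, d) \in X -> ~~ free a b d) ->
  within free (al1 :|: [set r; r0]) R2 R3 rem ->
  size rem <= R -> cnt1 r rem <= 6 -> cnt1 r0 rem <= 6 ->
  r \notin al1 -> r0 \notin al1 -> (forall a, a \in al1 -> g a <= th) ->
  cap <= cap' -> th + R + 6 * A <= cap' ->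
  (forall a p, p \in S -> L' a p.1.2 p.2 -> ~~ L a p.1.2 p.2 -> a \in al1) ->
  changed L L' S <= A ->
  budget L F free G1 ((r, c, s) :: S) base g cap tot ->
  exists g', budget L' F free G1 S base g' cap' (tot + R + 6 * A).
Proof.
move=> lL lL' Lz rr0 t nfX wi sR k1 k2 nr nr0 hth hcap hcap' harr hch H.
pose arr a := count (fun p => L' a p.1.2 p.2 && ~~ L a p.1.2 p.2) S.
pose g' a := if a \in [set r; r0] then g a else g a + cnt1 a rem + 6 * arr a.
have arr0 a : a \notin al1 -> arr a = 0.
  move=> na; apply/eqP; rewrite -leqn0 leqNgt -has_count; apply/hasPn=> p pS /=.
  by apply: contra na => /andP[h1 h2]; apply: harr pS h1 h2.
have arrA a : arr a <= A.
  apply: leq_trans hch; apply: sub_count => p /= h; apply/existsP; by exists a.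
have hu a : defect L' F free G1 a <= defect L F free G1 a + cnt1 a rem.
  pose X' := [seq (p.1.2, p.2) | p : T * T * T <- rem & p.1.1 == a].
  have -> : cnt1 a rem = size X' by rewrite size_map size_filter.
  apply: card_miss => b d /and3P[hL hf hF] nX; rewrite hf hF /= andbT.
  apply: t => //; rewrite mem_cat negb_or; apply/andP; split.
    by apply/negP=> /nfX; rewrite hf.
  apply: contra nX => hr; apply/mapP; exists (a, b, d) => //.
  by rewrite mem_filter eqxx.
have hp a : pending L' S a + (r == a) + L a c s <= pending L ((r, c, s) :: S) a + arr a.
  rewrite /pending /=.
  have := count_diff (fun p => L' a p.1.2 p.2) (fun p => L a p.1.2 p.2) S.
  by rewrite -/(arr a); lia.
exists g'; split.
- move=> a; rewrite /g'; have := hu a; have := hp a; have := h_u H a; rewrite !inE.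
  case: (eqVneq a r) => [->|nar] /=.
    by rewrite (arr0 _ nr); move: k1; move: (defect _ _ _ _ _) (defect _ _ _ _ _) (pending _ _ _) (pending _ _ _); clear; lia.
  case: (eqVneq a r0) => [->|nar0] /=.
    by rewrite Lz (arr0 _ nr0); move: k2; move: (defect _ _ _ _ _) (defect _ _ _ _ _) (pending _ _ _) (pending _ _ _); clear; lia.
  by move: (defect _ _ _ _ _) (defect _ _ _ _ _) (pending _ _ _) (pending _ _ _); clear; lia.
- move=> a; rewrite /g'; case: ifP => [_|ha]; first exact: leq_trans (h_cap H a) hcap.
  have [aal|naal] := boolP (a \in al1).
    have h1 : cnt1 a rem <= R by apply: leq_trans (count_size _ _) sR.
    by apply: leq_trans hcap'; rewrite leq_add ?leq_mul2l ?arrA ?orbT // leq_add ?hth.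
  rewrite arr0 // (within_cnt1 wi) ?inE ?negb_or ?naal //; last by move: ha; rewrite !inE => /negbT; rewrite negb_or.
  by rewrite muln0 !addn0; apply: leq_trans (h_cap H a) hcap.
- apply: (@leq_trans (\sum_a (g a + cnt1 a rem + 6 * arr a))).
    by apply: leq_sum => a _; rewrite /g'; case: ifP => // _; rewrite -addnA leq_addr.
  have e6 : \sum_a 6 * arr a = 6 * \sum_a arr a by rewrite big_distrr.
  rewrite big_split /= big_split /= e6; apply: leq_add; last rewrite leq_mul2l /=.
    apply: leq_add (h_tot H) _; apply: leq_trans sR.
    rewrite /cnt1; elim: (rem) => [|p l IH] /=; first by rewrite big1.
    by rewrite big_split /= (bigD1 p.1.1) //= eqxx big1 ?addn0 ?add1n // => x; rewrite eq_sym => /negPf ->.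
  apply: leq_trans hch; rewrite /arr /changed.
  elim: (S) => [|p l IH] /=; first by rewrite big1.
  rewrite big_split /=; apply: leq_add IH.
  case: (boolP [exists a, _]) => [/existsP[a ha]|/existsPn ha]; last first.
    by rewrite big1 // => a _; rewrite (negPf (ha a)).
  rewrite (bigD1 a) //= ha big1 ?addn0 // => x nx; case: (boolP (L' x _ _)) => // hx.
  by case/andP: ha => hLa _; rewrite (lat1 lL' hx hLa) eqxx in nx.
Qed.

End Account.

(** * Installing the triples of [P] one after the other *)

Section Run.
Variables (T : finType) (F : rel3 T) (G1 G2 G3 : {set T}) (h1 h2 h3 : T -> bool).
Variables (N2 base : nat) (P : seq (T * T * T)).
Hypothesis D : dihedral F G1 G2 G3 h1 h2 h3 N2.

Definition paired12 a b := [exists c, (a, b, c) \in P].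
Definition paired13 a c := [exists b, (a, b, c) \in P].
Definition paired23 b c := [exists a, (a, b, c) \in P].
Definition free : rel3 T := fun a b c => [&& ~~ paired12 a b, ~~ paired13 a c & ~~ paired23 b c].

Hypothesis P1 : forall a a' b c, (a, b, c) \in P -> (a', b, c) \in P -> a = a'.
Hypothesis P2 : forall a b b' c, (a, b, c) \in P -> (a, b', c) \in P -> b = b'.
Hypothesis P3 : forall a b c c', (a, b, c) \in P -> (a, b, c') \in P -> c = c'.
Hypothesis QG12 : forall a b, paired12 a b -> (a \in G1) || (b \in G2).
Hypothesis QG13 : forall a c, paired13 a c -> (a \in G1) || (c \in G3).
Hypothesis QG23 : forall b c, paired23 b c -> (b \in G2) || (c \in G3).

(** [S] lists the waiting triples. The three budgets are one notion read along the three axes.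
    [i_inside] ensures that any triple holding a pair of [P] can be displaced. *)
Record state (L : rel3 T) (S : seq (T * T * T)) (g1 g2 g3 : T -> nat) (cap tot : nat) : Prop := Inv {
  i_lat : latin L;
  i_1 : budget L F free G1 S base g1 cap tot;
  i_2 : budget (swap12 L) (swap12 F) (swap12 free) G2 (map (@tswap12 T) S) base g2 cap tot;
  i_3 : budget (swap13 L) (swap13 F) (swap13 free) G3 (map (@tswap13 T) S) base g3 cap tot;
  i_done : forall a b c : T, (a, b, c) \in P -> (a, b, c) \notin S -> L a b c;
  i_inside : forall a b c : T, L a b c -> ~~ free a b c -> almost_inside G1 G2 G3 a b c;
  i_uniq : uniq S;
  i_sub : {subset S <= P} }.

Lemma budget_env (L F' free' : rel3 T) (G : {set T}) S g cap tot : latin L ->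
  budget L F' free' G S base g cap tot ->
  [/\ forall a, a \in G -> miss (fun b c => [&& L a b c, F' a b c & free' a b c]) <= base + cap,
      forall a, a \in G -> miss (fun c b => [&& L a b c, F' a b c & free' a b c]) <= base + cap,
      forall a, miss (fun b c => L a b c && free' a b c) <= base + cap &
      forall a, miss (fun c b => L a b c && free' a b c) <= base + cap].
Proof.
move=> lL H.
have u a : defect L F' free' G a <= base + cap.
  by apply: leq_trans (leq_add (leqnn base) (h_cap H a)); apply: leq_trans (h_u H a); apply: leq_addr.
have u' a : miss (fun c b => L a b c && (free' a b c && ((a \in G) ==> F' a b c))) <= base + cap.
  apply: leq_trans (u a).
  by apply: (@miss_swap _ (fun c b => L a b c)) => [c|c c' b]; [exact: lat13 | exact: lat3].
split=> a.
- move=> aG; apply: leq_trans (u a); apply: miss_sub => b c.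
  by rewrite aG /= => /and3P[-> -> ->].
- move=> aG; apply: leq_trans (u' a); apply: miss_sub => b c.
  by rewrite aG /= => /and3P[-> -> ->].
- by apply: leq_trans (u a); apply: miss_sub => b c /and3P[-> ->].
- by apply: leq_trans (u' a); apply: miss_sub => b c /and3P[-> ->].
Qed.

Lemma state_env L S g1 g2 g3 cap tot :
  state L S g1 g2 g3 cap tot -> env L F free G1 G2 G3 h1 h2 h3 N2 (base + cap).
Proof.
move=> I; have lL := i_lat I.
have [e1 e2 e3 e4] := budget_env lL (i_1 I).
have [e5 e6 e7 e8] := budget_env (latin12 lL) (i_2 I).
have [e9 e10 e11 e12] := budget_env (latin13 lL) (i_3 I).
by split.
Qed.

Lemma not_free_P r c s : (r, c, s) \in P ->
  [/\ forall x, ~~ free r c x, forall x, ~~ free r x s & forall x, ~~ free x c s].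
Proof.
move=> p; have q12 : paired12 r c by apply/existsP; exists s.
have q13 : paired13 r s by apply/existsP; exists c.
have q23 : paired23 c s by apply/existsP; exists r.
by split=> x; rewrite /free ?q12 ?q13 ?q23 ?andbF.
Qed.

Lemma P_almost_inside r c s : (r, c, s) \in P -> almost_inside G1 G2 G3 r c s.
Proof.
move=> p; have q12 : paired12 r c by apply/existsP; exists s.
have q13 : paired13 r s by apply/existsP; exists c.
have q23 : paired23 c s by apply/existsP; exists r.
move: (QG12 q12) (QG13 q13) (QG23 q23); rewrite /almost_inside.
by case: (r \in G1) (c \in G2) (s \in G3) => [] [] [].
Qed.

(** Common to both kinds of trades. [A] bounds the waiting pairs that change place along an axis: 3
    for [install_any], which disturbs three arbitrary triples, and 0 for [install_clean]. *)
Lemma state_step L L' g1 g2 g3 cap cap' tot th R A (al1 al2 al3 : {set T})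
    r r0 c c0 s s' S rem :
  state L ((r, c, s) :: S) g1 g2 g3 cap tot ->
  latin L' -> L' r c s -> L r c s' -> L r c0 s -> L r0 c s -> s != s' ->
  keeps L L' ([:: (r, c, s'); (r, c0, s); (r0, c, s)] ++ rem) ->
  within free (al1 :|: [set r; r0]) (al2 :|: [set c; c0]) (al3 :|: [set s; s']) rem ->
  size rem <= R ->
  cnt1 r rem <= 6 /\ cnt1 r0 rem <= 6 ->
  cnt2 c rem <= 6 /\ cnt2 c0 rem <= 6 ->
  cnt3 s rem <= 6 /\ cnt3 s' rem <= 6 ->
  r \notin al1 -> r0 \notin al1 -> c \notin al2 -> c0 \notin al2 ->
  s \notin al3 -> s' \notin al3 ->
  (forall a, a \in al1 -> g1 a <= th) -> (forall a, a \in al2 -> g2 a <= th) ->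
  (forall a, a \in al3 -> g3 a <= th) ->
  al1 \subset G1 -> al2 \subset G2 -> al3 \subset G3 ->
  cap <= cap' -> th + R + 6 * A <= cap' ->
  (forall a b d, L' a b d -> ~~ L a b d -> (b, d) <> (c, s) ->
     paired23 b d -> a \in al1) ->
  (forall a b d, L' a b d -> ~~ L a b d -> (a, d) <> (r, s) ->
     paired13 a d -> b \in al2) ->
  (forall a b d, L' a b d -> ~~ L a b d -> (a, b) <> (r, c) ->
     paired12 a b -> d \in al3) ->
  changed L L' S <= A -> changed (swap12 L) (swap12 L') (map (@tswap12 T) S) <= A ->
  changed (swap13 L) (swap13 L') (map (@tswap13 T) S) <= A ->
  exists g1' g2' g3', state L' S g1' g2' g3' cap' (tot + R + 6 * A).
Proof.
move=> I lL' Lp Lx Ly Lz /eqP ss' t wi sR [k1 k1'] [k2 k2'] [k3 k3'] nr nr0 nc nc0 ns ns'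
  th1 th2 th3 S1 S2 S3 hcap hcap' a1 a2 a3 ch1 ch2 ch3.
have lL := i_lat I.
have /andP[pS uS] : uniq ((r, c, s) :: S) := i_uniq I.
have pP : (r, c, s) \in P by apply: (i_sub I); rewrite mem_head.
have SP : {subset S <= P} by move=> p hp; apply: (i_sub I); rewrite in_cons hp orbT.
have [nfx nfy nfz] := not_free_P pP.
have rr0 : r <> r0 by move=> e; apply: ss'; move: Lz; rewrite -e => /(lat3 lL) /(_ Lx).
have cc0 : c <> c0 by move=> e; apply: ss'; move: Ly; rewrite -e => /(lat3 lL) /(_ Lx).
have ndiff a b d : (a, b, d) \in S -> (a, b, d) <> (r, c, s) by move=> h e; rewrite -e h in pS.
pose X := [:: (r, c, s'); (r, c0, s); (r0, c, s)].
have nfX a b d : (a, b, d) \in X -> ~~ free a b d.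
  by rewrite !inE => /or3P[] /eqP[-> -> ->].
have [||g1' H1] := budget_step lL lL' Lz _ t nfX wi sR k1 k1' nr nr0 th1 hcap hcap' _ ch1 (i_1 I).
- exact/eqP.
- move=> a [[r2 c2] s2] /= p2 h4 h5; apply: (a1 _ _ _ h4 h5).
    by move=> [ec es]; apply: (ndiff _ _ _ p2); congr (_, _, _) => //; subst; apply: P1 (SP _ p2) pP.
  by apply/existsP; exists r2; apply: SP.
have t12 : keeps (swap12 L) (swap12 L') (map (@tswap12 T) X ++ map (@tswap12 T) rem) by rewrite -map_cat; apply: keeps12.
have t13 : keeps (swap13 L) (swap13 L') (map (@tswap13 T) X ++ map (@tswap13 T) rem) by rewrite -map_cat; apply: keeps13.
have [||||||g2' H2] := budget_step (latin12 lL) (latin12 lL') (Ly : swap12 L c0 r s) _ t12 _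
   (within12 wi) _ _ _ nc nc0 th2 hcap hcap' _ ch2 (i_2 I).
- exact/eqP.
- by move=> a b d; rewrite mem_tswap12 => /nfX.
- by rewrite size_map; apply: sR.
- by rewrite cnt_tswap12.
- by rewrite cnt_tswap12.
- move=> a [[r2 c2] s2]; rewrite mem_tswap12 => /= p2 h4 h5; apply: (a2 _ _ _ h4 h5).
    by move=> [ec es]; apply: (ndiff _ _ _ p2); congr (_, _, _) => //; subst; apply: P2 (SP _ p2) pP.
  by apply/existsP; exists r2; apply: SP.
have [||||||g3' H3] := budget_step (latin13 lL) (latin13 lL') (Lx : swap13 L s' c r) _ t13 _
   (within13 wi) _ _ _ ns ns' th3 hcap hcap' _ ch3 (i_3 I).
- exact/eqP.
- by move=> a b d; rewrite mem_tswap13 => /nfX.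
- by rewrite size_map; apply: sR.
- by rewrite cnt_tswap13.
- by rewrite cnt_tswap13.
- move=> a [[r2 c2] s2]; rewrite mem_tswap13 => /= p2 h4 h5; apply: (a3 _ _ _ h4 h5).
    by move=> [ec es]; apply: (ndiff _ _ _ p2); congr (_, _, _) => //; subst; apply: P3 (SP _ p2) pP.
  by apply/existsP; exists r2; apply: SP.
exists g1', g2', g3'; split=> //.
- move=> a b d abP abS; case: (eqVneq (a, b, d) (r, c, s)) => [[-> -> ->] //|/eqP ne].
  have hL : L a b d by apply: (i_done I) => //; rewrite in_cons negb_or abS andbT; apply/eqP.
  apply: t => //; rewrite mem_cat negb_or; apply/andP; split; last first.
    by apply/negP=> /wi[]; case: (not_free_P abP) => /(_ d) /negPf ->.
  rewrite !inE; apply/negP=> /or3P[] /eqP[ea eb ed]; apply: ne; subst.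
  + by rewrite (P3 abP pP).
  + by rewrite (P2 abP pP).
  + by rewrite (P1 abP pP).
(* A new triple through a pair of [P] other than those of [(r,c,s)] has its third line among the
   allowed ones, hence inside; the pair has a line inside by [QG12], [QG13] or [QG23]. *)
- move=> a b d hL' nf; case hL: (L a b d); first exact: (i_inside I).
  move/negbT: hL => hL.
  move: (nf); rewrite /free !negb_and !negbK => /or3P[] q.
  + have nfq x : ~~ free a b x by rewrite /free q.
    case: (eqVneq (a, b) (r, c)) => [[ea eb]|/eqP ne].
      subst; rewrite -(lat3 lL' Lp hL'); exact: P_almost_inside.
    have /(subsetP S3) dG := a3 _ _ _ hL' hL ne q.
    by move: (QG12 q); rewrite /almost_inside dG !andbT; case/orP=> ->; rewrite ?orbT.
  + have nfq x : ~~ free a x d by rewrite /free q andbF.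
    case: (eqVneq (a, d) (r, s)) => [[ea eb]|/eqP ne].
      subst; rewrite -(lat2 lL' Lp hL'); exact: P_almost_inside.
    have /(subsetP S2) dG := a2 _ _ _ hL' hL ne q.
    by move: (QG13 q); rewrite /almost_inside dG !andbT /=; case/orP=> ->; rewrite ?orbT.
  + have nfq x : ~~ free x b d by rewrite /free q !andbF.
    case: (eqVneq (b, d) (c, s)) => [[ea eb]|/eqP ne].
      subst; rewrite -(lat1 lL' Lp hL'); exact: P_almost_inside.
    have /(subsetP S1) dG := a1 _ _ _ hL' hL ne q.
    by move: (QG23 q); rewrite /almost_inside dG /=; case/orP=> ->; rewrite ?orbT.
Qed.

Definition clean_at (L : rel3 T) (p : T * T * T) := exists s' c0 r0,
  [/\ [/\ L p.1.1 p.1.2 s', F p.1.1 p.1.2 s', ~~ paired13 p.1.1 s' & ~~ paired23 p.1.2 s'],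
      [/\ L p.1.1 c0 p.2, F p.1.1 c0 p.2, ~~ paired12 p.1.1 c0 & ~~ paired23 c0 p.2] &
      [/\ L r0 p.1.2 p.2, F r0 p.1.2 p.2, ~~ paired12 r0 p.1.2 & ~~ paired13 r0 p.2]].

Definition ready (L : rel3 T) (p : T * T * T) := L p.1.1 p.1.2 p.2 \/ clean_at L p.

(** The three triples that witness [clean_at] for [p] each contain a pair of [p], so they are not
    free and escape [rem]; they contain no other pair of [P], so they are not among the three
    triples on the pairs of [(r,c,s)] either. *)
Lemma ready_step (L L' : rel3 T) r r0 c c0 s s' rem R1 R2 R3 p :
  keeps L L' ([:: (r, c, s'); (r, c0, s); (r0, c, s)] ++ rem) ->
  within free R1 R2 R3 rem -> (r, c, s) \in P -> p \in P -> p <> (r, c, s) ->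
  ready L p -> ready L' p.
Proof.
move=> t wi pP; case: p => [[r2 c2] s2] p2P ne.
have [qx qy qz] := not_free_P p2P.
have nP1 : (r, c) <> (r2, c2) by move=> [ea eb]; apply: ne; subst; rewrite (P3 p2P pP).
have nP2 : (r, s) <> (r2, s2) by move=> [ea eb]; apply: ne; subst; rewrite (P2 p2P pP).
have nP3 : (c, s) <> (c2, s2) by move=> [ea eb]; apply: ne; subst; rewrite (P1 p2P pP).
have q12 : paired12 r c by apply/existsP; exists s.
have q13 : paired13 r s by apply/existsP; exists c.
have q23 : paired23 c s by apply/existsP; exists r.
have keep a b d : L a b d -> ~~ free a b d -> (a, b) <> (r, c) -> (a, d) <> (r, s) ->
    (b, d) <> (c, s) -> L' a b d.
  move=> hL nf n1 n2 n3; apply: t => //; rewrite mem_cat negb_or; apply/andP; split.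
    by rewrite !inE; apply/negP=> /or3P[] /eqP[ea eb ed]; subst; [case: n1|case: n2|case: n3].
  by apply/negP=> /wi[]; rewrite (negPf nf).
case=> [hL|[s3 [c3 [r3 /= [[x1 x2 x3 x4] [y1 y2 y3 y4] [z1 z2 z3 z4]]]]]].
  by left=> /=; exact: (keep _ _ _ hL (qx _) (nesym nP1) (nesym nP2) (nesym nP3)).
right; exists s3, c3, r3 => /=; split; split=> //.
- apply: (keep _ _ _ x1 (qx _) (nesym nP1)).
  + by move=> [ea ed]; move: x3; rewrite ea ed q13.
  + by move=> [ea ed]; move: x4; rewrite ea ed q23.
- apply: (keep _ _ _ y1 (qy _) _ (nesym nP2)).
  + by move=> [ea ed]; move: y3; rewrite ea ed q12.
  + by move=> [ea ed]; move: y4; rewrite ea ed q23.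
- apply: (keep _ _ _ z1 (qz _) _ _ (nesym nP3)).
  + by move=> [ea ed]; move: z3; rewrite ea ed q12.
  + by move=> [ea ed]; move: z4; rewrite ea ed q13.
Qed.

Definition usable (g : T -> nat) (G Z : {set T}) th := [set a in G | g a <= th] :\: Z.

(** Markov's inequality: a line above the threshold carries at least [th.+1] of the total charge. *)
Lemma card_usable g (G Z : {set T}) th tot e :
  \sum_a g a <= tot -> #|~: G| <= e -> #|Z| <= 2 ->
  #|~: usable g G Z th| <= e + tot %/ th.+1 + 2.
Proof.
move=> hg hG hZ; rewrite /usable setCD; apply: cardU hZ.
have -> : ~: [set a in G | g a <= th] = ~: G :|: [set a | th < g a].
  by apply/setP=> a; rewrite !inE negb_and -ltnNge.
apply: cardU hG _; rewrite leq_divRL //; apply: leq_trans hg.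
rewrite -sum1_card big_distrl /= big_mkcond /=; apply: leq_sum => a _.
by rewrite inE; case: ifP => // h; rewrite mul1n.
Qed.

Lemma usableP g (G Z : {set T}) th :
  [/\ usable g G Z th \subset G, forall a, a \in usable g G Z th -> g a <= th &
    forall a, a \in Z -> a \notin usable g G Z th].
Proof.
split; first by apply/subsetP=> a; rewrite !inE => /and3P[].
  by move=> a; rewrite !inE => /and3P[].
by move=> a h; rewrite !inE h.
Qed.

Lemma budget_tot L' F' free' G S base' g cap tot tot' : tot <= tot' ->
  @budget T L' F' free' G S base' g cap tot -> budget L' F' free' G S base' g cap tot'.
Proof. by move=> h [? ? ht]; split=> //; apply: leq_trans h. Qed.

Lemma state_drop (L : rel3 T) (p : T * T * T) S g1 g2 g3 cap tot tot' : tot <= tot' ->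
  L p.1.1 p.1.2 p.2 -> state L (p :: S) g1 g2 g3 cap tot -> state L S g1 g2 g3 cap tot'.
Proof.
case: p => [[r c] s] ht /= hL [lL i1 i2 i3 id ia iu is'].
have /andP[_ uS] : uniq ((r, c, s) :: S) := iu.
split=> //.
- by apply: budget_tot ht _; apply: budget_drop i1.
- by apply: budget_tot ht _; apply: budget_drop i2.
- by apply: budget_tot ht _; apply: budget_drop i3.
- move=> a b d hP nS; case: (eqVneq (a, b, d) (r, c, s)) => [[-> -> ->] //|ne].
  by apply: id => //; rewrite in_cons negb_or ne.
- by move=> p hp; apply: is'; rewrite in_cons hp orbT.
Qed.

Lemma P_uniq S : uniq S -> {subset S <= P} ->
  [/\ uniq [seq (p.1.2, p.2) | p <- S],
      uniq [seq (p.1.2, p.2) | p <- map (@tswap12 T) S] &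
      uniq [seq (p.1.2, p.2) | p <- map (@tswap13 T) S]].
Proof.
move=> uS SP; split; rewrite -?map_comp map_inj_in_uniq // => -[[a b] d] [[a' b'] d'] /SP h /SP h' /= [].
- by move=> e1 e2; subst; rewrite (P1 h h').
- by move=> e1 e2; subst; rewrite (P2 h h').
- by move=> e1 e2; subst; rewrite (P3 h h').
Qed.

Lemma install_crowded_step (L : rel3 T) (p : T * T * T) S g1 g2 g3 cap tot th e TA :
  state L (p :: S) g1 g2 g3 cap tot -> th + 73 <= cap -> tot <= TA ->
  #|~: G1| <= e -> #|~: G2| <= e -> #|~: G3| <= e ->
  7 * (base + cap + 48) + 7 * (e + TA %/ th.+1 + 2 + 3) < N2 ->
  7 * (base + cap + 48) + 8 * (e + TA %/ th.+1 + 2 + 3) < #|T| ->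
  exists L' g1' g2' g3', state L' S g1' g2' g3' cap (tot + 73) /\
    forall p2, p2 \in P -> p2 \in S -> ready L p2 -> ready L' p2.
Proof.
case: p => [[r c] s] I hcap hTA c1 c2 c3 hn hT.
case hL: (L r c s).
  exists L, g1, g2, g3; split=> //; apply: state_drop I => //; exact: leq_addr.
have lL := i_lat I; have E := state_env I.
have [s' Lx] := lat12 lL r c; have [c0 Ly] := lat13 lL r s; have [r0 Lz] := lat23 lL c s.
have ss' : s != s' by apply/eqP=> e0; rewrite e0 Lx in hL.
pose al1 := usable g1 G1 [set r; r0] th; pose al2 := usable g2 G2 [set c; c0] th.
pose al3 := usable g3 G3 [set s; s'] th.
have [S1 th1 z1] := usableP g1 G1 [set r; r0] th.
have [S2 th2 z2] := usableP g2 G2 [set c; c0] th.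
have [S3 th3 z3] := usableP g3 G3 [set s; s'] th.
have dle : tot %/ th.+1 <= TA %/ th.+1 by apply: leq_div2r.
have cz (x y : T) : #|[set x; y]| <= 2 by rewrite cards2; case: (_ != _).
have A1 : #|~: al1| <= e + TA %/ th.+1 + 2 by apply: card_usable => //; apply: leq_trans hTA; apply: h_tot (i_1 I).
have A2 : #|~: al2| <= e + TA %/ th.+1 + 2 by apply: card_usable => //; apply: leq_trans hTA; apply: h_tot (i_2 I).
have A3 : #|~: al3| <= e + TA %/ th.+1 + 2 by apply: card_usable => //; apply: leq_trans hTA; apply: h_tot (i_3 I).
have pP : (r, c, s) \in P by apply: (i_sub I); rewrite mem_head.
have [nfx nfy nfz] := not_free_P pP.
have nr : r \notin al1 by apply: z1; rewrite !inE eqxx.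
have nr0 : r0 \notin al1 by apply: z1; rewrite !inE eqxx orbT.
have nc : c \notin al2 by apply: z2; rewrite !inE eqxx.
have nc0 : c0 \notin al2 by apply: z2; rewrite !inE eqxx orbT.
have ns : s \notin al3 by apply: z3; rewrite !inE eqxx.
have ns' : s' \notin al3 by apply: z3; rewrite !inE eqxx orbT.
have [L' [rem [lL' Lp t wi [sz k1 k2 k3 [a1 a2 a3]]]]] :=
  install_any E A1 A2 A3 S1 S2 S3 hn hT nr nr0 nc nc0 ns ns' ss' Lx Ly Lz
   (i_inside I Lx (nfx _)) (i_inside I Ly (nfy _)) (i_inside I Lz (nfz _)) nfx nfy nfz.
have /andP[pS uS] : uniq ((r, c, s) :: S) := i_uniq I.
have SP : {subset S <= P} by move=> p hp; apply: (i_sub I); rewrite in_cons hp orbT.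
have [u23 u13 u12] := P_uniq uS SP.
have fr a b d : (a, b, d) \in rem -> free a b d by move/wi=> [].
have ch1 : changed L L' S <= 3.
  apply: (changed_le lL lL' t fr _ u23) => -[[a b] d] x /SP h.
  by case: (not_free_P h).
have ch2 : changed (swap12 L) (swap12 L') (map (@tswap12 T) S) <= 3.
  have := keeps12 t; rewrite map_cat => t'.
  apply: (changed_le (latin12 lL) (latin12 lL') t' _ _ u13).
    by move=> a b d; rewrite mem_tswap12 => /fr; apply.
  move=> [[a b] d] x; rewrite mem_tswap12 => /SP h.
  by case: (not_free_P h) => _ h' _; apply: h'.
have ch3 : changed (swap13 L) (swap13 L') (map (@tswap13 T) S) <= 3.
  have := keeps13 t; rewrite map_cat => t'.
  apply: (changed_le (latin13 lL) (latin13 lL') t' _ _ u12).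
    by move=> a b d; rewrite mem_tswap13 => /fr; apply.
  move=> [[a b] d] x; rewrite mem_tswap13 => /SP h.
  by case: (not_free_P h) => h' _ _; apply: h'.
have hcap' : th + 55 + 6 * 3 <= cap by rewrite -addnA.
have nq1 a b x : paired12 a b -> ~~ free a b x by move=> q; rewrite /free q.
have nq2 a d x : paired13 a d -> ~~ free a x d by move=> q; rewrite /free q !andbF.
have nq3 b d x : paired23 b d -> ~~ free x b d by move=> q; rewrite /free q !andbF.
have [g1' [g2' [g3' I']]] := state_step I lL' Lp Lx Ly Lz ss' t wi sz k1 k2 k3 nr nr0 nc nc0 ns ns'
  th1 th2 th3 S1 S2 S3 (leqnn cap) hcap'
  (fun _ _ _ l n d q => a1 _ _ _ l n d (fun x => nq3 _ _ x q))
  (fun _ _ _ l n d q => a2 _ _ _ l n d (fun x => nq2 _ _ x q))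
  (fun _ _ _ l n d q => a3 _ _ _ l n d (fun x => nq1 _ _ x q)) ch1 ch2 ch3.
exists L', g1', g2', g3'; split; first by rewrite -[73]/(55 + 6 * 3) addnA.
move=> p2 p2P p2S; apply: (ready_step t wi pP p2P).
by move=> e0; rewrite e0 (negPf pS) in p2S.
Qed.

(** [TA] bounds the total charge at every stage, so one threshold serves the whole induction. [SB]
    is carried along because its triples must still be ready when their turn comes. *)
Lemma install_crowded_all SA SB (L : rel3 T) g1 g2 g3 cap tot th e TA :
  state L (SA ++ SB) g1 g2 g3 cap tot -> th + 73 <= cap -> tot + 73 * size SA <= TA ->
  #|~: G1| <= e -> #|~: G2| <= e -> #|~: G3| <= e ->
  7 * (base + cap + 48) + 7 * (e + TA %/ th.+1 + 2 + 3) < N2 ->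
  7 * (base + cap + 48) + 8 * (e + TA %/ th.+1 + 2 + 3) < #|T| ->
  (forall p, p \in SB -> ready L p) ->
  exists L' g1' g2' g3', state L' SB g1' g2' g3' cap (tot + 73 * size SA) /\
    forall p, p \in SB -> ready L' p.
Proof.
elim: SA L g1 g2 g3 tot => [|p SA IH] L g1 g2 g3 tot I hcap hTA c1 c2 c3 hn hT hr.
  by exists L, g1, g2, g3; rewrite muln0 addn0.
rewrite /= mulnS addnA in hTA *.
have hTA1 : tot <= TA by apply: leq_trans hTA; rewrite -addnA leq_addr.
have [L1 [k1 [k2 [k3 [I1 hp]]]]] := install_crowded_step I hcap hTA1 c1 c2 c3 hn hT.
apply: IH I1 hcap hTA c1 c2 c3 hn hT _ => p2 p2S.
have p2S' : p2 \in SA ++ SB by rewrite mem_cat p2S orbT.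
apply: hp => //; last exact: hr.
by apply: (i_sub I); rewrite in_cons p2S' orbT.
Qed.

(** Readiness means that the three disturbed triples carry no pair of [P] apart from those of [p].
    Hence no waiting pair moves, and the charge is only the seven triples of [install_clean]. *)
Lemma install_sparse_step (L : rel3 T) (p : T * T * T) S g1 g2 g3 cap tot th e TB :
  state L (p :: S) g1 g2 g3 cap tot -> th + 7 <= cap -> tot <= TB ->
  #|~: G1| <= e -> #|~: G2| <= e -> #|~: G3| <= e ->
  7 * (base + cap) + 6 * (e + TB %/ th.+1 + 2) < N2 ->
  ready L p ->
  exists L' g1' g2' g3', state L' S g1' g2' g3' cap (tot + 7) /\
    forall p2, p2 \in P -> p2 \in S -> ready L p2 -> ready L' p2.
Proof.
case: p => [[r c] s] I hcap hTB c1 c2 c3 hn.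
case=> [hL|].
  exists L, g1, g2, g3; split=> //; apply: state_drop I => //; exact: leq_addr.
case=> s' [c0 [r0 /= [[Lx Fx qx1 qx2] [Ly Fy qy1 qy2] [Lz Fz qz1 qz2]]]].
case: (eqVneq s s') => [ess|ss'].
  exists L, g1, g2, g3; split=> //; apply: state_drop I => //; [exact: leq_addr | by rewrite ess].
have lL := i_lat I; have E := state_env I.
pose al1 := usable g1 G1 [set r; r0] th; pose al2 := usable g2 G2 [set c; c0] th.
pose al3 := usable g3 G3 [set s; s'] th.
have [S1 th1 z1] := usableP g1 G1 [set r; r0] th.
have [S2 th2 z2] := usableP g2 G2 [set c; c0] th.
have [S3 th3 z3] := usableP g3 G3 [set s; s'] th.
have cz (x y : T) : #|[set x; y]| <= 2 by rewrite cards2; case: (_ != _).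
have A1 : #|~: al1| <= e + TB %/ th.+1 + 2 by apply: card_usable => //; apply: leq_trans hTB; apply: h_tot (i_1 I).
have A2 : #|~: al2| <= e + TB %/ th.+1 + 2 by apply: card_usable => //; apply: leq_trans hTB; apply: h_tot (i_2 I).
have A3 : #|~: al3| <= e + TB %/ th.+1 + 2 by apply: card_usable => //; apply: leq_trans hTB; apply: h_tot (i_3 I).
have pP : (r, c, s) \in P by apply: (i_sub I); rewrite mem_head.
have nr : r \notin al1 by apply: z1; rewrite !inE eqxx.
have nr0 : r0 \notin al1 by apply: z1; rewrite !inE eqxx orbT.
have nc : c \notin al2 by apply: z2; rewrite !inE eqxx.
have nc0 : c0 \notin al2 by apply: z2; rewrite !inE eqxx orbT.
have ns : s \notin al3 by apply: z3; rewrite !inE eqxx.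
have ns' : s' \notin al3 by apply: z3; rewrite !inE eqxx orbT.
have [L' [rem [lL' Lp t wi0 [sz k1 k2 k3 [k4 k5 k6]]]]] :=
  install_clean E A1 A2 A3 hn nr nr0 nc nc0 ns ns' ss' Lx Fx Ly Fy Lz Fz.
have wi : within free (al1 :|: [set r; r0]) (al2 :|: [set c; c0]) (al3 :|: [set s; s']) rem.
  by move=> a b d /wi0[/and3P[]].
have /andP[pS uS] : uniq ((r, c, s) :: S) := i_uniq I.
have SP : {subset S <= P} by move=> p hp; apply: (i_sub I); rewrite in_cons hp orbT.
have old a b d : L a b d -> ~~ free a b d ->
   [\/ (a, b, d) = (r, c, s'), (a, b, d) = (r, c0, s), (a, b, d) = (r0, c, s) | L' a b d].
  move=> h4 h5; case h6: ((a, b, d) \in [:: (r, c, s'); (r, c0, s); (r0, c, s)]).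
    by move: h6; rewrite !inE => /or3P[] /eqP ->; [constructor 1 | constructor 2 | constructor 3].
  constructor 4; apply: t => //; rewrite mem_cat negb_or h6 /=.
  by apply/negP=> /wi[]; rewrite (negPf h5).
have n1 a b d : L' a b d -> (b, d) <> (c, s) -> paired23 b d -> L a b d.
  move=> h4 h5 q; have [a0 ha0] := lat23 lL b d.
  have nf : ~~ free a0 b d by rewrite /free q !andbF.
  case: (old _ _ _ ha0 nf) => [[_ eb ed]|[_ eb ed]|[_ eb ed]|/(lat1 lL' h4) -> //]; subst.
  - by rewrite q in qx2.
  - by rewrite q in qy2.
  - by case: h5.
have n2 a b d : L' a b d -> (a, d) <> (r, s) -> paired13 a d -> L a b d.
  move=> h4 h5 q; have [b0 hb0] := lat13 lL a d.
  have nf : ~~ free a b0 d by rewrite /free q !andbF.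
  case: (old _ _ _ hb0 nf) => [[eb _ ed]|[eb _ ed]|[eb _ ed]|/(lat2 lL' h4) -> //]; subst.
  - by rewrite q in qx1.
  - by case: h5.
  - by rewrite q in qz2.
have n3 a b d : L' a b d -> (a, b) <> (r, c) -> paired12 a b -> L a b d.
  move=> h4 h5 q; have [d0 hd0] := lat12 lL a b.
  have nf : ~~ free a b d0 by rewrite /free q.
  case: (old _ _ _ hd0 nf) => [[eb ed _]|[eb ed _]|[eb ed _]|/(lat3 lL' h4) -> //]; subst.
  - by case: h5.
  - by rewrite q in qy1.
  - by rewrite q in qz1.
have Qfree a b d : ~~ free a b d -> [\/ paired12 a b, paired13 a d | paired23 b d].
  by rewrite /free !negb_and !negbK => /or3P.
have ndiff a b d : (a, b, d) \in S -> (a, b, d) <> (r, c, s) by move=> h e0; rewrite -e0 h in pS.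
have ch1 : changed L L' S <= 0.
  rewrite leqn0 /changed -leqn0 leqNgt -has_count; apply/hasPn=> -[[r2 k2'] s2] p2.
  apply/existsPn=> a /=; apply/negP=> /andP[h4 /negP[]]; apply: n1 => //.
    by move=> [ec es]; apply: (ndiff _ _ _ p2); congr (_, _, _) => //; subst; apply: P1 (SP _ p2) pP.
  by apply/existsP; exists r2; apply: SP.
have ch2 : changed (swap12 L) (swap12 L') (map (@tswap12 T) S) <= 0.
  rewrite leqn0 /changed -leqn0 leqNgt -has_count; apply/hasPn=> -[[r2 k2'] s2]; rewrite mem_tswap12 => p2.
  apply/existsPn=> a /=; apply/negP=> /andP[h4 /negP[]]; apply: n2 => //.
    by move=> [ec es]; apply: (ndiff _ _ _ p2); congr (_, _, _) => //; subst; apply: P2 (SP _ p2) pP.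
  by apply/existsP; exists r2; apply: SP.
have ch3 : changed (swap13 L) (swap13 L') (map (@tswap13 T) S) <= 0.
  rewrite leqn0 /changed -leqn0 leqNgt -has_count; apply/hasPn=> -[[r2 k2'] s2]; rewrite mem_tswap13 => p2.
  apply/existsPn=> a /=; apply/negP=> /andP[h4 /negP[]]; apply: n3 => //.
    by move=> [ec es]; apply: (ndiff _ _ _ p2); congr (_, _, _) => //; subst; apply: P3 (SP _ p2) pP.
  by apply/existsP; exists r2; apply: SP.
have le16 x : x <= 1 -> x <= 6 by move=> h; apply: leq_trans h _.
have le26 x : x <= 2 -> x <= 6 by move=> h; apply: leq_trans h _.
have [||||g1' [g2' [g3' I']]] := @state_step L L' _ _ _ cap cap tot th 7 0 al1 al2 al3 r r0 c c0 s s' S rem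
  I lL' Lp Lx Ly Lz ss' t wi (eq_leq sz) (conj (le16 _ k1) (le16 _ k4)) (conj (le16 _ k2) (le16 _ k5))
  (conj (le26 _ k3) (le16 _ k6)) nr nr0 nc nc0 ns ns' th1 th2 th3 S1 S2 S3 (leqnn cap) _ _ _ _ ch1 ch2 ch3.
- by rewrite muln0 addn0.
- by move=> a b d h4 /negP h5 h6 q; case: h5; apply: n1 h4 h6 q.
- by move=> a b d h4 /negP h5 h6 q; case: h5; apply: n2 h4 h6 q.
- by move=> a b d h4 /negP h5 h6 q; case: h5; apply: n3 h4 h6 q.
exists L', g1', g2', g3'; split; first by rewrite -[7]/(7 + 6 * 0) addnA.
move=> p2 p2P p2S; apply: (ready_step t wi pP p2P).
by move=> e0; rewrite e0 (negPf pS) in p2S.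
Qed.

Lemma install_sparse_all SB (L : rel3 T) g1 g2 g3 cap tot th e TB :
  state L SB g1 g2 g3 cap tot -> th + 7 <= cap -> tot + 7 * size SB <= TB ->
  #|~: G1| <= e -> #|~: G2| <= e -> #|~: G3| <= e ->
  7 * (base + cap) + 6 * (e + TB %/ th.+1 + 2) < N2 ->
  (forall p, p \in SB -> ready L p) ->
  exists2 L', latin L' & forall a b c, (a, b, c) \in P -> L' a b c.
Proof.
elim: SB L g1 g2 g3 tot => [|p SB IH] L g1 g2 g3 tot I hcap hTB c1 c2 c3 hn hr.
  by exists L; [exact: i_lat I | move=> a b c h; apply: (i_done I)].
rewrite /= mulnS addnA in hTB.
have hTB1 : tot <= TB by apply: leq_trans hTB; rewrite -addnA leq_addr.
have [L1 [k1 [k2 [k3 [I1 hp]]]]] := install_sparse_step I hcap hTB1 c1 c2 c3 hn (hr _ (mem_head _ _)).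
apply: IH I1 hcap hTB c1 c2 c3 hn _ => p2 p2S.
by apply: hp => //; [apply: (i_sub I) | apply: hr]; rewrite in_cons p2S orbT.
Qed.

End Run.

(** * Random relabelling *)

Section Random.
Variable T : finType.
Implicit Types (A : {set T}) (f : T -> T) (S : T -> {set T}).

Lemma perm_agree A (p0 : {perm T}) :
  #|[set p : {perm T} | [forall x in A, p x == p0 x]]| <= (#|T| - #|A|)`!.
Proof.
have -> : #|T| - #|A| = #|~: A| by rewrite -(cardsC A) addKn.
rewrite -(card_perm (~: A)) -(@card_imset _ _ (fun p : {perm T} => (p * p0^-1)%g)); last first.
  exact: mulIg.
apply/subset_leq_card/subsetP=> _ /imsetP[p + ->]; rewrite inE => /forallP h.
apply/subsetP=> x; rewrite !inE permM; apply: contraR; rewrite negbK => xA.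
by move: (h x); rewrite xA /= => /eqP ->; rewrite permK.
Qed.

(** Such a permutation takes one of at most [m ^ #|A|] admissible families of values on [f @: A],
    and each family extends in at most [(#|T| - #|A|)!] ways. *)
Lemma perm_hits A f S m : injective f -> (forall x, #|S x| <= m) ->
  #|[set p : {perm T} | [forall x in A, p (f x) \in S x]]| <= m ^ #|A| * (#|T| - #|A|)`!.
Proof.
move=> injf hS; set X := [set p | _].
pose key (p : {perm T}) := [ffun x => if x \in A then p (f x) else x].
pose R x := if x \in A then S x else [set x].
pose Ks := [set g : {ffun T -> T} | g \in family (fun x => mem (R x))].
have cK : #|Ks| <= m ^ #|A|.
  rewrite cardsE card_family /image_mem foldrE big_map big_enum /= -prod_nat_const [X in _ <= X]big_mkcond /=.
  by apply: leq_prod => x _; rewrite /R; case: ifP => _; rewrite ?cards1 ?hS.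
apply: leq_trans (leq_mul cK (leqnn _)).
have XK p : p \in X -> key p \in Ks.
  rewrite !inE => /forallP h; apply/familyP=> x; rewrite /R ffunE.
  by case: ifP => xA; [move: (h x); rewrite xA | rewrite inE].
rewrite -sum1_card (partition_big key (mem Ks)) //= -sum_nat_const; apply: leq_sum => k _.
rewrite sum1_card.
case: (pickP [pred p | (p \in X) && (key p == k)]) => [p0 /= /andP[_ /eqP ek]|h0]; last first.
  by rewrite (eq_card0 h0).
have cf : #|f @: A| = #|A| by rewrite card_imset.
rewrite -cf; apply: leq_trans (perm_agree _ p0).
apply/subset_leq_card/subsetP=> p /andP[_ /eqP ek'].
rewrite inE; apply/forallP=> y; apply/implyP=> /imsetP[x xA ->].
by move: (congr1 (fun g : {ffun T -> T} => g x) (etrans ek' (esym ek))); rewrite !ffunE xA => ->.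
Qed.

Definition hits f S (p : {perm T}) := #|[set x | p (f x) \in S x]|.

(* Union bound over the [K]-subsets of the arguments that are hit. *)
Lemma many_hits f S m K : injective f -> (forall x, #|S x| <= m) -> K <= #|T| ->
  #|[set p : {perm T} | K <= hits f S p]| * K`! <= m ^ K * #|T|`!.
Proof.
move=> injf hS hK.
rewrite -(bin_fact hK) (mulnC K`!) !mulnA leq_mul2r; apply/orP; right.
pose X A := [set p : {perm T} | [forall x in A, p (f x) \in S x]].
apply: (@leq_trans #|\bigcup_(A in [set A : {set T} | #|A| == K]) X A|).
  apply/subset_leq_card/subsetP=> p; rewrite inE => /card_geqP[s [us ss hs]].
  apply/bigcupP; exists [set x in s]; first by rewrite inE cardsE (card_uniqP us) ss.
  by rewrite inE; apply/forallP=> x; apply/implyP; rewrite inE => /hs; rewrite inE.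
apply: (@leq_trans (\sum_(A in [set A : {set T} | #|A| == K]) #|X A|)).
  elim/big_rec2: _ => [|A y B _ h]; first by rewrite cards0.
  by apply: leq_trans (leq_card_setU _ _) _; rewrite leq_add2l.
apply: (@leq_trans (\sum_(A in [set A : {set T} | #|A| == K]) m ^ K * (#|T| - K)`!)).
  by apply: leq_sum => A; rewrite inE => /eqP <-; apply: perm_hits.
by rewrite sum_nat_const card_draws -mulnA mulnCA mulnA.
Qed.

Lemma card_set_sum (Y : finType) (E : {set Y}) (Q : pred Y) :
  #|[set y in E | Q y]| = \sum_(y in E) (Q y : nat).
Proof.
rewrite -sum1_card big_mkcond [RHS]big_mkcond; apply: eq_bigr => y _.
by rewrite inE; case: (y \in E); case: (Q y).
Qed.

(** Each event [p (u y) = v y] has probability at most [1 / #|T|]; Markov's inequality does the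
    rest. *)
Lemma first_moment (Y : finType) (E : {set Y}) (u v : Y -> T) M :
  #|[set p : {perm T} | M < #|[set y in E | p (u y) == v y]|]| * M.+1 <= #|E| * #|T|.-1`!.
Proof.
apply: (@leq_trans (\sum_(p : {perm T}) #|[set y in E | p (u y) == v y]|)).
  rewrite -sum1_card big_distrl /= big_mkcond /=; apply: leq_sum => p _.
  by rewrite inE; case: ifP => // h; rewrite mul1n.
have -> : \sum_(p : {perm T}) #|[set y in E | p (u y) == v y]| =
   \sum_(y in E) #|[set p : {perm T} | p (u y) == v y]|.
  rewrite (eq_bigr (fun p : {perm T} => \sum_(y in E) (p (u y) == v y : nat))); last first.
    by move=> p _; apply: card_set_sum.
  rewrite exchange_big /=; apply: eq_bigr => y _.
  by rewrite -sum1_card [RHS]big_mkcond; apply: eq_bigr => p _; rewrite inE; case: (_ == _).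
rewrite -sum_nat_const; apply: leq_sum => y _.
have := @perm_hits [set u y] id (fun=> [set v y]) 1 (@inj_id T) (fun=> eq_leq (cards1 _)).
rewrite exp1n mul1n cards1 subn1; apply: leq_trans.
apply/subset_leq_card/subsetP=> p; rewrite !inE => /eqP h; apply/forallP=> x; apply/implyP.
by rewrite !inE => /eqP ->; rewrite h.
Qed.

(** The three kinds of failure have probabilities at most 1/8, 1/2 and 1/4, whose sum is below 1. *)
Lemma good_perm (J Y Y' : finType) (f : J -> T -> T) (S : J -> T -> {set T}) m K
    (E : {set Y}) (u v : Y -> T) M (E' : {set Y'}) (u' v' : Y' -> T) :
  (forall j, injective (f j)) -> (forall j x, #|S j x| <= m) -> K <= #|T| -> 0 < #|T| ->
  8 * #|J| * m ^ K <= K`! -> 2 * #|E| <= M.+1 * #|T| -> 4 * #|E'| <= #|T| ->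
  exists p : {perm T}, [/\ forall j, hits (f j) (S j) p < K,
    #|[set y in E | p (u y) == v y]| <= M &
    forall y, y \in E' -> p (u' y) != v' y].
Proof.
move=> injf hS hK T0 c1 c2 c3.
pose B1 j := [set p : {perm T} | K <= hits (f j) (S j) p].
pose B2 := [set p : {perm T} | M < #|[set y in E | p (u y) == v y]|].
pose B3 := [set p : {perm T} | 0 < #|[set y in E' | p (u' y) == v' y]|].
have fn : #|T|`! = #|T| * #|T|.-1`! by case: #|T| T0.
have f0 : 0 < #|T|`! by apply: fact_gt0.
have b1 : 8 * #|\bigcup_j B1 j| <= #|T|`!.
  have h : #|\bigcup_j B1 j| * K`! <= #|J| * (m ^ K * #|T|`!).
    apply: (@leq_trans (\sum_j #|B1 j| * K`!)).
      rewrite -big_distrl leq_mul2r /=; apply/orP; right.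
      elim/big_rec2: _ => [|A y B _ h]; first by rewrite cards0.
      by apply: leq_trans (leq_card_setU _ _) _; rewrite leq_add2l.
    by rewrite -sum_nat_const; apply: leq_sum => j _; apply: many_hits.
  rewrite -(leq_pmul2r (fact_gt0 K)) -mulnA; apply: leq_trans (leq_mul (leqnn 8) h) _.
  by rewrite mulnA mulnA (mulnC _ K`!) leq_mul2r c1 orbT.
have b2 : 2 * #|B2| <= #|T|`!.
  have h := first_moment E u v M.
  rewrite -(leq_pmul2r (ltn0Sn M)) -mulnA; apply: leq_trans (leq_mul (leqnn 2) h) _.
  by rewrite fn mulnA (mulnC (#|T| * _)) mulnA leq_mul2r c2 orbT.
have b3 : 4 * #|B3| <= #|T|`!.
  have h := first_moment E' u' v' 0; rewrite muln1 in h.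
  apply: leq_trans (leq_mul (leqnn 4) h) _.
  by rewrite fn mulnA leq_mul2r c3 orbT.
have cT : #|{perm T}| = #|T|`!.
  rewrite -cardsT -(card_perm [set: T]); apply: eq_card => p; rewrite !inE.
  by apply/esym/subsetP=> x _; rewrite inE.
have : #|(\bigcup_j B1 j) :|: (B2 :|: B3)| < #|{perm T}|.
  rewrite cT; apply: leq_ltn_trans (leq_card_setU _ _) _.
  apply: leq_ltn_trans (leq_add (leqnn _) (leq_card_setU _ _)) _.
  move: b1 b2 b3 f0; move: #|_| #|_| #|_| (_`!) => x1 x2 x3 x4; clear; lia.
rewrite -cardsT => h; have : [set: {perm T}] :\: ((\bigcup_j B1 j) :|: (B2 :|: B3)) != set0.
  by rewrite -card_gt0 cardsD setTI subn_gt0.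
case/set0Pn=> p; rewrite !inE !negb_or andbT => /and3P[n1 n2 n3]; exists p; split.
- move=> j; rewrite ltnNge; apply: contra n1 => hj; apply/bigcupP; exists j => //.
  by rewrite inE.
- by rewrite leqNgt.
- move=> y yE; apply: contra n3 => hy; rewrite card_gt0; apply/set0Pn; exists y.
  by rewrite inE yE.
Qed.

End Random.

(** * Relabelling the symbols of a Latin square *)

Section Relabel.
Variable T : finType.

Lemma card_bigcup (I : finType) (A : {set I}) (F : I -> {set T}) k :
  (forall i, #|F i| <= k) -> #|\bigcup_(i in A) F i| <= #|A| * k.
Proof.
move=> h; rewrite -sum_nat_const.
elim/big_rec2: _ => [|i y B _ hB]; first by rewrite cards0.
by apply: leq_trans (leq_card_setU _ _) _; rewrite leq_add.
Qed.

Lemma card_fan (R1 R2 : T -> T -> bool) m :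
  (forall a, #|[set b | R1 a b]| <= m) -> (forall a, #|[set c | R2 a c]| <= m) ->
  #|[set p : T * T * T | R1 p.1.1 p.1.2 && R2 p.1.1 p.2]| <= #|T| * (m * m).
Proof.
move=> h1 h2.
have -> : #|[set p : T * T * T | R1 p.1.1 p.1.2 && R2 p.1.1 p.2]| =
   \sum_a \sum_b \sum_c (R1 a b && R2 a c : nat).
  rewrite pair_bigA pair_bigA /= -sum1_card big_mkcond /=.
  by apply: eq_bigr => -[[a b] c] _; rewrite inE /=; case: (_ && _).
rewrite -sum_nat_const; apply: leq_sum => a _.
apply: (@leq_trans (\sum_b (R1 a b : nat) * m)).
  apply: leq_sum => b _; case: (R1 a b); last by rewrite big1.
  rewrite mul1n; apply: leq_trans (h2 a); rewrite -sum1_card [X in _ <= X]big_mkcond /=.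
  by apply: leq_sum => c _; rewrite inE; case: (R2 a c).
rewrite -big_distrl leq_mul2r /=; apply/orP; right; apply: leq_trans (h1 a).
by rewrite -sum1_card [X in _ <= X]big_mkcond /=; apply: leq_sum => c _; rewrite inE; case: (R1 a c).
Qed.

Variables (q12 q13 q23 : T -> T -> bool) (m : nat).
Hypotheses (g12 : forall a, #|[set b | q12 a b]| <= m) (g21 : forall b, #|[set a | q12 a b]| <= m).
Hypotheses (g13 : forall a, #|[set c | q13 a c]| <= m) (g31 : forall c, #|[set a | q13 a c]| <= m).
Hypotheses (g23 : forall b, #|[set c | q23 b c]| <= m) (g32 : forall c, #|[set b | q23 b c]| <= m).

Definition clash (p : T * T * T) :=
  [|| q12 p.1.1 p.1.2 && q13 p.1.1 p.2, q12 p.1.1 p.1.2 && q23 p.1.2 p.2 |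
      q13 p.1.1 p.2 && q23 p.1.2 p.2].

Lemma card_clash : #|[set p | clash p]| <= 3 * (#|T| * (m * m)).
Proof.
have -> : [set p | clash p] = [set p : T * T * T | q12 p.1.1 p.1.2 && q13 p.1.1 p.2] :|:
   ((@tswap12 T) @^-1: [set p : T * T * T | q12 p.1.2 p.1.1 && q23 p.1.1 p.2] :|:
    (@tswap13 T) @^-1: [set p : T * T * T | q23 p.1.2 p.1.1 && q13 p.2 p.1.1]).
  by apply/setP=> -[[a b] c]; rewrite !inE /clash /= (andbC (q13 a c)).
rewrite !mulSn mul0n addn0; apply: leq_trans (leq_card_setU _ _) _; apply: leq_add.
  exact: card_fan.
apply: leq_trans (leq_card_setU _ _) _; apply: leq_add.
  rewrite on_card_preimset; first exact: (@card_fan (fun b a => q12 a b) q23).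
  by apply: onW_bij; exists (@tswap12 T); apply: tswap12K.
rewrite on_card_preimset; first exact: (@card_fan (fun c b => q23 b c) (fun c a => q13 a c)).
by apply: onW_bij; exists (@tswap13 T); apply: tswap13K.
Qed.

(** There are [2 * #|T|] rows and columns in the union bound, hence the factor 16. By [card_clash]
    the expected number of clashes in the square is at most [3 * (m * m)], which is doubled to leave
    half of the probability. For the last clause at most [e * (2 * e * m)] coincidences are
    forbidden, those of an outer symbol with a symbol paired with an outer row or column. *)
Lemma relabel (B : rel3 T) (N1 N2 N3 : {set T}) e K : latin B ->
  #|N1| <= e -> #|N2| <= e -> #|N3| <= e -> 0 < #|T| -> K <= #|T| ->
  16 * #|T| * m ^ K <= K`! -> 8 * (e * e * m) <= #|T| ->
  exists s : {perm T}, [/\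
    forall a, #|[set b | [exists c, B a b (s c) && q23 b c]]| <= K,
    forall b, #|[set a | [exists c, B a b (s c) && q13 a c]]| <= K,
    #|[set p | B p.1.1 p.1.2 (s p.2) && clash p]| <= 6 * (m * m) &
    forall c, s c \in N3 -> (forall a, q13 a c -> a \notin N1) /\ (forall b, q23 b c -> b \notin N2)].
Proof.
move=> lB c1 c2 c3 T0 hK hf he.
pose sym a b := xchoose (lat12 lB a b).
have symP a b : B a b (sym a b) := xchooseP (lat12 lB a b).
pose f (j : T + T) x := match j with inl a => sym a x | inr b => sym x b end.
pose S (j : T + T) x := match j with inl a => [set c | q23 x c] | inr b => [set c | q13 x c] end.
have injf j : injective (f j).
  case: j => [a|b] x y /= h.
    by apply: (lat2 lB (symP a x)); rewrite h.
  by apply: (lat1 lB (symP x b)); rewrite h.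
have cS j x : #|S j x| <= m by case: j => ?; [apply: g23 | apply: g13].
pose C := (\bigcup_(a in N1) [set c | q13 a c]) :|: (\bigcup_(b in N2) [set c | q23 b c]).
have cC : #|C| <= e * m + e * m.
  apply: leq_trans (leq_card_setU _ _) _; apply: leq_add.
    by apply: leq_trans (card_bigcup _ g13) _; rewrite leq_mul2r c1 orbT.
  by apply: leq_trans (card_bigcup _ g23) _; rewrite leq_mul2r c2 orbT.
have [|||p [hp1 hp2 hp3]] := @good_perm T (T + T)%type (T * T * T)%type (T * T)%type f S m K [set p | clash p]
   (fun p => sym p.1.1 p.1.2) (fun p => p.2) (6 * (m * m)) (setX N3 C) fst snd injf cS hK T0.
- by rewrite card_sum; apply: leq_trans hf; rewrite leq_mul2r; apply/orP; right; move: #|T|; clear; lia.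
- by move: card_clash; move: #|_| #|_| (m * m); clear; nia.
- rewrite cardsX; have := leq_mul c3 cC; move: he; move: (#|N3| * _) #|T|; clear; nia.
have pV a b c : B a b ((p^-1)%g c) -> p (sym a b) = c.
  by move=> h; rewrite (lat3 lB (symP a b) h) permKV.
exists (p^-1)%g; split.
- move=> a; apply: leq_trans (ltnW (hp1 (inl a))); apply/subset_leq_card/subsetP=> b.
  by rewrite !inE => /existsP[c /andP[/pV /= -> h]].
- move=> b; apply: leq_trans (ltnW (hp1 (inr b))); apply/subset_leq_card/subsetP=> a.
  by rewrite !inE => /existsP[c /andP[/pV /= -> h]].
- apply: leq_trans hp2; apply/subset_leq_card/subsetP=> -[[a b] c].
  by rewrite !inE /= => /andP[/pV -> ->]; rewrite eqxx.
- move=> c hc; split=> x q; apply/negP=> xN.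
    suff : p ((p^-1)%g c) != c by rewrite permKV eqxx.
    apply: (hp3 ((p^-1)%g c, c)); rewrite in_setX hc /= in_setU; apply/orP; left.
    by apply/bigcupP; exists x; rewrite ?inE.
  suff : p ((p^-1)%g c) != c by rewrite permKV eqxx.
  apply: (hp3 ((p^-1)%g c, c)); rewrite in_setX hc /= in_setU; apply/orP; right.
  by apply/bigcupP; exists x; rewrite ?inE.
Qed.

End Relabel.

(* [k^k <= (k+1)...(2k) = 'C(2k, k) k!]. *)
Lemma leq_expn_fact k : k ^ k <= 4 ^ k * k`!.
Proof.
have h1 : k ^ k <= (2 * k) ^_ k.
  rewrite ffact_prod -[X in _ ^ X](card_ord k) -prod_nat_const; apply: leq_prod => i _.
  by have := ltn_ord i; lia.
apply: leq_trans h1 _; rewrite -bin_ffact leq_mul2r; apply/orP; right.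
rewrite -[4]/(2 ^ 2) -expnM -[X in 'C(X, _)](card_ord (2 * k)) -card_draws.
rewrite -[X in 2 ^ X](card_ord (2 * k)) -cardsT -card_powerset; apply/subset_leq_card/subsetP=> A _.
by rewrite powersetE subsetT.
Qed.

(** Here [12 = 4 * 3]: the factor 4 is lost to [leq_expn_fact], and the surplus [3 ^ (12 * m)] is
    there to beat the number of lines in the union bound. *)
Lemma fact_bound m : 3 ^ (12 * m) * m ^ (12 * m) <= (12 * m)`!.
Proof.
have := leq_expn_fact (12 * m); rewrite expnMn.
have -> : 12 ^ (12 * m) = 4 ^ (12 * m) * 3 ^ (12 * m) by rewrite -expnMn.
by rewrite -mulnA leq_pmul2l // expn_gt0.
Qed.

(** * Completing over a dihedral base *)

Section Init.
Variable T : finType.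

Lemma count_inj (Y : eqType) (Z : finType) (S : seq Y) (pr : pred Y) (g : Y -> Z) (A : {set Z}) :
  uniq S -> (forall p, p \in S -> pr p -> g p \in A) ->
  (forall p p', p \in S -> p' \in S -> pr p -> pr p' -> g p = g p' -> p = p') ->
  count pr S <= #|A|.
Proof.
move=> uS hA inj; rewrite -size_filter -(size_map g).
have u : uniq (map g (filter pr S)).
  rewrite map_inj_in_uniq ?filter_uniq // => p p'.
  by rewrite !mem_filter => /andP[h1 h2] /andP[h3 h4]; apply: inj.
rewrite -(card_uniqP u); apply/subset_leq_card/subsetP=> _ /mapP[p + ->].
by rewrite mem_filter => /andP[h1 h2]; apply: hA.
Qed.

(** At the start a line is spoilt by at most [2 * m + K] cells holding a pair of [P] and [2 * e]
    cells on outer lines, and at most [m + K] waiting triples force damage on it, prepaid at 6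
    each. *)
Lemma budget_init (L F free : rel3 T) (G1 G2 G3 : {set T}) (S : seq (T * T * T))
    (q12 q13 q23 : T -> T -> bool) m K e :
  latin L -> uniq S ->
  (forall a b c, ~~ free a b c -> [|| q12 a b, q13 a c | q23 b c]) ->
  (forall a b c, (a, b, c) \in S -> q12 a b && q23 b c) ->
  (forall a a' b c, (a, b, c) \in S -> (a', b, c) \in S -> a = a') ->
  (forall a b c c', (a, b, c) \in S -> (a, b, c') \in S -> c = c') ->
  (forall a, #|[set b | q12 a b]| <= m) -> (forall a, #|[set c | q13 a c]| <= m) ->
  (forall a, #|[set b | [exists c, L a b c && q23 b c]]| <= K) ->
  (forall a b c, L a b c -> a \in G1 -> b \in G2 -> c \in G3 -> F a b c) ->
  #|~: G2| <= e -> #|~: G3| <= e ->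
  budget L F free G1 S (8 * m + 7 * K + 2 * e) (fun=> 0) 0 0.
Proof.
move=> lL uS nf Sq S1 S3 g12 g13 k23 fin c2 c3; split=> // [a|]; last by rewrite big1.
have hu : defect L F free G1 a <= m + (m + (K + (e + e))).
  pose Q := [set b | q12 a b] :|:
    ([set b | [exists c, L a b c && (c \in [set c | q13 a c])]] :|:
    ([set b | [exists c, L a b c && q23 b c]] :|: (~: G2 :|:
     [set b | [exists c, L a b c && (c \in ~: G3)]]))).
  apply: (@leq_trans #|Q|).
    apply/subset_leq_card/subsetP=> b; rewrite !inE; have [c hc] := lat12 lL a b.
    apply: contraR; rewrite !negb_or negbK => /and5P[n1 n2 n3 n4 n5].
    apply/existsP; exists c; rewrite hc /=; apply/andP; split.
      apply: contraT => /nf /or3P[h|h|h]; first by rewrite h in n1.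
        by case/existsP: n2; exists c; rewrite hc inE.
      by case/existsP: n3; exists c; rewrite hc h.
    apply/implyP=> aG; apply: fin => //; first exact: negbNE n4.
    apply: contraT => ncG.
    by case/existsP: n5; exists c; rewrite hc inE.
  have inj x x' y : L a x y -> L a x' y -> x = x' by apply: (lat2 lL).
  apply: cardU (g12 a) _; apply: cardU (leq_trans (card_preim_rel _ inj) (g13 a)) _.
  by apply: cardU (k23 a) _; apply: cardU c2 (leq_trans (card_preim_rel _ inj) c3).
have hp : pending L S a <= m + K.
  apply: leq_add.
    apply: leq_trans (g12 a); apply: (count_inj (g := fun p : T * T * T => p.1.2)) => //.
      by move=> [[x b] c] /Sq /andP[h _] /= /eqP <-; rewrite inE.
    move=> [[x b] c] [[x' b'] c'] h h' /= /eqP e1 /eqP e2 e3; subst.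
    by rewrite (S3 _ _ _ _ h h').
  apply: leq_trans (k23 a); apply: (count_inj (g := fun p : T * T * T => p.1.2)) => //.
    move=> [[x b] c] /Sq /andP[_ h] /= hL; rewrite inE; apply/existsP; exists c.
    by rewrite hL h.
  move=> [[x b] c] [[x' b'] c'] h h' /= h1 h2 e3; subst.
  by have e4 := lat3 lL h1 h2; subst; rewrite (S1 _ _ _ _ h h').
move: hu hp; move: (defect _ _ _ _ _) (pending _ _ _); clear; lia.
Qed.

End Init.

Section Assemble.
Variables (T : finType) (F : rel3 T) (G1 G2 G3 : {set T}) (h1 h2 h3 : T -> bool).
Variables (N2 : nat) (P : seq (T * T * T)) (L : rel3 T) (m e : nat).
Hypothesis D : dihedral F G1 G2 G3 h1 h2 h3 N2.
Hypothesis lL : latin L.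
Hypothesis uP : uniq P.
Hypothesis P1 : forall a a' b c, (a, b, c) \in P -> (a', b, c) \in P -> a = a'.
Hypothesis P2 : forall a b b' c, (a, b, c) \in P -> (a, b', c) \in P -> b = b'.
Hypothesis P3 : forall a b c c', (a, b, c) \in P -> (a, b, c') \in P -> c = c'.
Notation paired12 := (paired12 P).
Notation paired13 := (paired13 P).
Notation paired23 := (paired23 P).
Notation free := (free P).
Hypothesis QG12 : forall a b, paired12 a b -> (a \in G1) || (b \in G2).
Hypothesis QG13 : forall a c, paired13 a c -> (a \in G1) || (c \in G3).
Hypothesis QG23 : forall b c, paired23 b c -> (b \in G2) || (c \in G3).
Hypotheses (c1 : #|~: G1| <= e) (c2 : #|~: G2| <= e) (c3 : #|~: G3| <= e).
Hypothesis fin : forall a b c, L a b c -> a \in G1 -> b \in G2 -> c \in G3 -> F a b c.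
Hypothesis inf : forall a b c, L a b c -> almost_inside G1 G2 G3 a b c \/
  [/\ a \notin G1, b \notin G2 & c \notin G3].
Hypotheses (g12 : forall a, #|[set b | paired12 a b]| <= m) (g21 : forall b, #|[set a | paired12 a b]| <= m).
Hypotheses (g13 : forall a, #|[set c | paired13 a c]| <= m) (g31 : forall c, #|[set a | paired13 a c]| <= m).
Hypotheses (g23 : forall b, #|[set c | paired23 b c]| <= m) (g32 : forall c, #|[set b | paired23 b c]| <= m).
Hypothesis k1 : forall a, #|[set b | [exists c, L a b c && paired23 b c]]| <= 12 * m.
Hypothesis k2 : forall b, #|[set a | [exists c, L a b c && paired13 a c]]| <= 12 * m.
Hypothesis k3 : forall c, #|[set a | [exists b, L a b c && paired12 a b]]| <= 12 * m.
Hypothesis kcl : #|[set p | L p.1.1 p.1.2 p.2 && clash paired12 paired13 paired23 p]| <= 6 * (m * m).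
Hypotheses (m0 : 0 < m) (e7 : e <= 7) (mn : 102 * 100 * m <= #|T|) (nN : #|T| = 2 * N2 + e).

(** The ways in which [clean_at] can fail at the start, separated so that each can be counted: an
    outer line of [p], an outer line of a triple on one of its pairs, or a further pair of [P] in
    such a triple, which then clashes. *)
Definition crowded (p : T * T * T) :=
  [|| p.1.1 \notin G1, p.1.2 \notin G2, p.2 \notin G3 |
  [|| [exists s, L p.1.1 p.1.2 s && (s \notin G3)], [exists c, L p.1.1 c p.2 && (c \notin G2)],
     [exists r, L r p.1.2 p.2 && (r \notin G1)] |
  [|| [exists s, L p.1.1 p.1.2 s && (paired13 p.1.1 s || paired23 p.1.2 s)],
      [exists c, L p.1.1 c p.2 && (paired12 p.1.1 c || paired23 c p.2)] |
      [exists r, L r p.1.2 p.2 && (paired12 r p.1.2 || paired13 r p.2)]]]].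

Let inQ a b c : (a, b, c) \in P -> [/\ paired12 a b, paired13 a c & paired23 b c].
Proof. by move=> h; split; apply/existsP; [exists c | exists b | exists a]. Qed.

Lemma ready_sparse p : p \in P -> ~~ crowded p -> ready F P L p.
Proof.
case: p => [[r c] s] pP; rewrite /crowded /= !negb_or.
move=> /and5P[/negbNE rG /negbNE cG /negbNE sG /existsPn n1 /and5P[/existsPn n2 /existsPn n3 /existsPn n4 /existsPn n5 /existsPn n6]].
right; have [s' Lx] := lat12 lL r c; have [c0 Ly] := lat13 lL r s; have [r0 Lz] := lat23 lL c s.
move: (n1 s') (n2 c0) (n3 r0) (n4 s') (n5 c0) (n6 r0); rewrite Lx Ly Lz /= !negbK !negb_or.
move=> s'G c0G r0G /andP[x1 x2] /andP[y1 y2] /andP[z1 z2].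
exists s', c0, r0 => /=; split; split=> //; exact: fin.
Qed.

Let Pset (R : pred (T * T * T)) := [set p | (p \in P) && R p].

Let card_line (A : {set T}) (R : T -> pred (T * T * T)) k :
  #|A| <= e -> (forall x, #|Pset (R x)| <= k) ->
  #|Pset (fun p => [exists x, R x p && (x \in A)])| <= e * k.
Proof.
move=> hA hR; apply: leq_trans (leq_mul hA (leqnn k)); apply: leq_trans (card_bigcup _ hR).
apply/subset_leq_card/subsetP=> p; rewrite inE => /andP[pP /existsP[x /andP[h xA]]].
by apply/bigcupP; exists x => //; rewrite inE pP.
Qed.

Let card_Pset (R : pred (T * T * T)) (g : T * T * T -> T) (A : {set T}) :
  (forall p, p \in P -> R p -> g p \in A) ->
  (forall p p', p \in P -> p' \in P -> R p -> R p' -> g p = g p' -> p = p') ->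
  #|Pset R| <= #|A|.
Proof.
move=> hA inj; apply: leq_trans (count_inj uP hA inj).
rewrite -size_filter cardE; apply: uniq_leq_size; first exact: enum_uniq.
by move=> p; rewrite mem_enum inE mem_filter andbC.
Qed.

(** [sh] says that a pair of a given kind is shared. As [P] never repeats a pair, a clashing triple
    of the square then accounts for at most one triple of [P]. *)
Let card_clashing (sh : T * T * T -> T * T * T -> bool) (R : pred (T * T * T)) :
  (forall p p' t, p \in P -> p' \in P -> sh p t -> sh p' t -> p = p') ->
  (forall p, p \in P -> R p -> exists t, [/\ sh p t, L t.1.1 t.1.2 t.2 & clash paired12 paired13 paired23 t]) ->
  #|Pset R| <= 6 * (m * m).
Proof.
move=> inj hR; apply: leq_trans kcl.
apply: leq_trans (@card_preim_rel _ _ (fun p t => (p \in P) && sh p t) _ _).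
  apply/subset_leq_card/subsetP=> p; rewrite !inE => /andP[pP /(hR _ pP)[t [s1 s2 s3]]].
  by apply/existsP; exists t; rewrite pP s1 inE s2.
by move=> p p' t /andP[? ?] /andP[? ?]; apply: (inj p p' t).
Qed.

(** [273 = 7 * (3 + 3 * 12)]: each of at most 7 outer lines per direction contains at most [m]
    triples of [P] and at most [12 * m] triples on pairs of a given kind. [18 = 3 * 6] counts the
    clashes for the three kinds of pairs. *)
Lemma card_crowded : size [seq p <- P | crowded p] <= 273 * m + 18 * (m * m).
Proof.
apply: (@leq_trans #|Pset crowded|).
  rewrite -(card_uniqP (filter_uniq crowded uP)).
  by apply/subset_leq_card/subsetP=> p; rewrite mem_filter inE andbC.
pose R1 x (p : T * T * T) := p.1.1 == x.
pose R2 x (p : T * T * T) := p.1.2 == x.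
pose R3 x (p : T * T * T) := p.2 == x.
pose R4 x (p : T * T * T) := L p.1.1 p.1.2 x.
pose R5 x (p : T * T * T) := L p.1.1 x p.2.
pose R6 x (p : T * T * T) := L x p.1.2 p.2.
pose R7 (p : T * T * T) := [exists s, L p.1.1 p.1.2 s && (paired13 p.1.1 s || paired23 p.1.2 s)].
pose R8 (p : T * T * T) := [exists c, L p.1.1 c p.2 && (paired12 p.1.1 c || paired23 c p.2)].
pose R9 (p : T * T * T) := [exists r, L r p.1.2 p.2 && (paired12 r p.1.2 || paired13 r p.2)].
have b1 : forall x, #|Pset (R1 x)| <= m.
  move=> x; apply: leq_trans (g12 x); apply: (card_Pset (g := fun p => p.1.2)).
    by move=> [[a b] c] /inQ[h _ _] /eqP /= <-; rewrite inE.
  by move=> [[a b] c] [[a' b'] c'] h h' /eqP /= ex /eqP /= ex' /= ey; subst; rewrite (P3 h h').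
have b2 : forall x, #|Pset (R2 x)| <= m.
  move=> x; apply: leq_trans (g21 x); apply: (card_Pset (g := fun p => p.1.1)).
    by move=> [[a b] c] /inQ[h _ _] /eqP /= <-; rewrite inE.
  by move=> [[a b] c] [[a' b'] c'] h h' /eqP /= ex /eqP /= ex' /= ey; subst; rewrite (P3 h h').
have b3 : forall x, #|Pset (R3 x)| <= m.
  move=> x; apply: leq_trans (g31 x); apply: (card_Pset (g := fun p => p.1.1)).
    by move=> [[a b] c] /inQ[_ h _] /eqP /= <-; rewrite inE.
  by move=> [[a b] c] [[a' b'] c'] h h' /eqP /= ex /eqP /= ex' /= ey; subst; rewrite (P2 h h').
have b4 : forall x, #|Pset (R4 x)| <= 12 * m.
  move=> x; apply: leq_trans (k3 x); apply: (card_Pset (g := fun p => p.1.1)).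
    by move=> [[a b] c] /inQ[h _ _] hL; rewrite inE; apply/existsP; exists b; rewrite h andbT; apply: hL.
  move=> [[a b] c] [[a' b'] c'] h h' hL hL' /= ey; subst.
  by have ez := lat2 lL hL hL'; simpl in ez; subst; rewrite (P3 h h').
have b5 : forall x, #|Pset (R5 x)| <= 12 * m.
  move=> x; apply: leq_trans (k2 x); apply: (card_Pset (g := fun p => p.1.1)).
    by move=> [[a b] c] /inQ[_ h _] hL; rewrite inE; apply/existsP; exists c; rewrite h andbT; apply: hL.
  move=> [[a b] c] [[a' b'] c'] h h' hL hL' /= ey; subst.
  by have ez := lat3 lL hL hL'; simpl in ez; subst; rewrite (P2 h h').
have b6 : forall x, #|Pset (R6 x)| <= 12 * m.
  move=> x; apply: leq_trans (k1 x); apply: (card_Pset (g := fun p => p.1.2)).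
    by move=> [[a b] c] /inQ[_ _ h] hL; rewrite inE; apply/existsP; exists c; rewrite h andbT; apply: hL.
  move=> [[a b] c] [[a' b'] c'] h h' hL hL' /= ey; subst.
  by have ez := lat3 lL hL hL'; simpl in ez; subst; rewrite (P1 h h').
have b7 : #|Pset R7| <= 6 * (m * m).
  apply: (@card_clashing (fun p t => (t.1.1 == p.1.1) && (t.1.2 == p.1.2))).
    move=> [[a b] c] [[a' b'] c'] [[x y] z] h h' /= /andP[/eqP e1 /eqP e2] /andP[/eqP e3 /eqP e4].
    by subst; rewrite (P3 h h').
  move=> [[a b] c] /inQ[q _ _] /existsP[s /= /andP[hL hq]].
  by exists (a, b, s); rewrite /clash /= !eqxx q /=; split=> //; case/orP: hq => ->; rewrite ?orbT.
have b8 : #|Pset R8| <= 6 * (m * m).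
  apply: (@card_clashing (fun p t => (t.1.1 == p.1.1) && (t.2 == p.2))).
    move=> [[a b] c] [[a' b'] c'] [[x y] z] h h' /= /andP[/eqP e1 /eqP e2] /andP[/eqP e3 /eqP e4].
    by subst; rewrite (P2 h h').
  move=> [[a b] c] /inQ[_ q _] /existsP[s /= /andP[hL hq]].
  by exists (a, s, c); rewrite /clash /= !eqxx q /= !andbT; split=> //; case/orP: hq => ->; rewrite ?orbT.
have b9 : #|Pset R9| <= 6 * (m * m).
  apply: (@card_clashing (fun p t => (t.1.2 == p.1.2) && (t.2 == p.2))).
    move=> [[a b] c] [[a' b'] c'] [[x y] z] h h' /= /andP[/eqP e1 /eqP e2] /andP[/eqP e3 /eqP e4].
    by subst; rewrite (P1 h h').
  move=> [[a b] c] /inQ[_ _ q] /existsP[s /= /andP[hL hq]].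
  by exists (s, b, c); rewrite /clash /= !eqxx q /= !andbT; split=> //; case/orP: hq => ->; rewrite ?orbT.
pose V (A : {set T}) (R : T -> pred (T * T * T)) := Pset (fun p => [exists x, R x p && (x \in A)]).
pose U := (V (~: G1) R1 :|: (V (~: G2) R2 :|: V (~: G3) R3)) :|:
  ((V (~: G3) R4 :|: (V (~: G2) R5 :|: V (~: G1) R6)) :|: (Pset R7 :|: (Pset R8 :|: Pset R9))).
apply: (@leq_trans #|U|).
  apply/subset_leq_card/subsetP=> p; rewrite in_set => /andP[pP].
  have VI (A : {set T}) (R : T -> pred (T * T * T)) x : R x p -> x \in A -> p \in V A R.
    by move=> h1' h2'; rewrite in_set pP; apply/existsP; exists x; rewrite h1' h2'.
  have VI2 (A : {set T}) (R : T -> pred (T * T * T)) : [exists x, R x p && (x \notin A)] -> p \in V (~: A) R.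
    by case/existsP=> x /andP[h1' h2']; apply: VI h1' _; rewrite in_setC.
  rewrite /U !in_setU /crowded.
  case/or4P=> [h|h|h|/or4P[/(VI2 _ R4) h|/(VI2 _ R5) h|/(VI2 _ R6) h|/or3P[h|h|h]]].
  - by rewrite (VI _ R1 p.1.1 (eqxx _)) ?in_setC.
  - by rewrite (VI _ R2 p.1.2 (eqxx _)) ?in_setC ?orbT.
  - by rewrite (VI _ R3 p.2 (eqxx _)) ?in_setC ?orbT.
  - by rewrite h !orbT.
  - by rewrite h !orbT.
  - by rewrite h !orbT.
  - by have -> : p \in Pset R7; rewrite ?orbT // in_set pP.
  - by have -> : p \in Pset R8; rewrite ?orbT // in_set pP.
  - by have -> : p \in Pset R9; rewrite ?orbT // in_set pP.
have v1 := card_line c1 b1. have v2 := card_line c2 b2. have v3 := card_line c3 b3.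
have v4 := card_line c3 b4. have v5 := card_line c2 b5. have v6 := card_line c1 b6.
apply: leq_trans (cardU (cardU v1 (cardU v2 v3)) (cardU (cardU v4 (cardU v5 v6)) (cardU b7 (cardU b8 b9)))) _.
by move: m0 e7; clear; nia.
Qed.

Lemma size_P : size P <= #|T| * m.
Proof.
rewrite -(card_uniqP uP).
apply: (@leq_trans #|\bigcup_(x in [set: T]) Pset (fun p => p.1.1 == x)|).
  apply/subset_leq_card/subsetP=> p pP; apply/bigcupP; exists p.1.1 => //.
  by rewrite inE pP eqxx.
rewrite -cardsT; apply: card_bigcup => x; apply: leq_trans (g12 x).
apply: (card_Pset (g := fun p => p.1.2)).
  by move=> [[a b] c] /inQ[h _ _] /eqP /= <-; rewrite inE.
by move=> [[a b] c] [[a' b'] c'] h h' /eqP /= ex /eqP /= ex' /= ey; subst; rewrite (P3 h h').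
Qed.

(* 55 + 6 * 3 = 73 and 7 are the charges of the two kinds of trades. Lines are
   reused up to a charge of 120 m while the crowded triples are installed, and
   of 260 m afterwards. *)
Lemma complete_structured : exists2 L', latin L' & forall a b c, (a, b, c) \in P -> L' a b c.
Proof.
pose SA := [seq p <- P | crowded p]; pose SB := [seq p <- P | ~~ crowded p].
pose S := SA ++ SB.
pose base := 8 * m + 7 * (12 * m) + 2 * e.
have memS p : (p \in S) = (p \in P).
  by rewrite mem_cat !mem_filter; case: (crowded p); rewrite ?orbF.
have uS : uniq S.
  rewrite cat_uniq !filter_uniq //= andbT; apply/hasPn=> p.
  by rewrite !mem_filter => /andP[/negPf -> _].
have lL12 := latin12 lL; have lL13 := latin13 lL.
have c12i := inv_inj (@tswap12K T); have c13i := inv_inj (@tswap13K T).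
have I : state F G1 G2 G3 base P L S (fun=> 0) (fun=> 0) (fun=> 0) 0 0.
  split=> //.
  - apply: (@budget_init _ _ _ _ _ G2 G3 _ paired12 paired13 paired23) => //.
    + by move=> a b c; rewrite /free !negb_and !negbK.
    + by move=> a b c; rewrite memS => /inQ[-> _ ->].
    + by move=> a a' b c; rewrite !memS; apply: P1.
    + by move=> a b c c'; rewrite !memS; apply: P3.
  - apply: (@budget_init _ _ _ _ _ G1 G3 _ (fun b a => paired12 a b) paired23 paired13) => //.
    + by rewrite map_inj_uniq.
    + by move=> a b c; rewrite /swap12 /free !negb_and !negbK => /or3P[] ->; rewrite ?orbT.
    + by move=> a b c; rewrite mem_tswap12 memS => /inQ[-> -> _].
    + by move=> a a' b c; rewrite !mem_tswap12 !memS; apply: P2.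
    + by move=> a b c c'; rewrite !mem_tswap12 !memS; apply: P3.
    + by move=> a b c /fin h ? ? ?; apply: h.
  - apply: (@budget_init _ _ _ _ _ G2 G1 _ (fun c b => paired23 b c) (fun c a => paired13 a c) (fun b a => paired12 a b)) => //.
    + by rewrite map_inj_uniq.
    + by move=> a b c; rewrite /swap13 /free !negb_and !negbK => /or3P[] ->; rewrite ?orbT.
    + by move=> a b c; rewrite mem_tswap13 memS => /inQ[-> _ ->].
    + by move=> a a' b c; rewrite !mem_tswap13 !memS; apply: P3.
    + by move=> a b c c'; rewrite !mem_tswap13 !memS; apply: P1.
    + move=> c; apply: leq_trans (k3 c).
      apply: leq_trans (@card_preim_rel _ _ (fun b a => L a b c && paired12 a b) _ _).
        apply/subset_leq_card/subsetP=> b; rewrite !inE => /existsP[a /andP[h1' h2']].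
        apply/existsP; exists a; rewrite h2' andbT; apply/andP; split; first exact: h1'.
        by rewrite inE; apply/existsP; exists b; rewrite h2' andbT; apply: h1'.
      by move=> b b' a /andP[h _] /andP[h' _]; apply: lat2 h h'.
    + by move=> a b c /fin h ? ? ?; apply: h.
  - by move=> a b c h; rewrite memS h.
  - move=> a b c /inf[//|[nG1 nG2 nG3]]; rewrite /free !negb_and !negbK => /or3P[].
    + by move/QG12; rewrite (negPf nG1) (negPf nG2).
    + by move/QG13; rewrite (negPf nG1) (negPf nG3).
    + by move/QG23; rewrite (negPf nG2) (negPf nG3).
  - by move=> p; rewrite memS.
pose TA := 73 * (273 * m + 18 * (m * m)).
have sA : 0 + 73 * size SA <= TA by rewrite add0n leq_mul2l card_crowded.
(* [TA] is quadratic in [m] and the threshold linear, so the worn-out lines are linear in [m]. *)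
have dA : TA %/ (120 * m).+1 * 120 <= 73 * (273 + 18 * m).
  have h := leq_trunc_div TA (120 * m).+1; rewrite -(leq_pmul2r m0).
  by move: h; rewrite /TA; move: (_ %/ _) => x; clear; nia.
pose TB := TA + 7 * (#|T| * m).
(* The triples of [P] number at most [#|T| * m], at charge 7, so little more than [7 / 260] of the
   lines can wear out; six times this stays well below a half. *)
have dB : TB %/ (260 * m).+1 * 260 <= 73 * (273 + 18 * m) + 7 * #|T|.
  have h := leq_trunc_div TB (260 * m).+1; rewrite -(leq_pmul2r m0).
  by move: h; rewrite /TB /TA; move: (_ %/ _) => x; move: #|T|; clear; nia.
(* The cap exceeds the threshold by 73, the most that one installation adds to a line; in the second
   phase the excess is 7. *)
have I' : state F G1 G2 G3 base P L S (fun=> 0) (fun=> 0) (fun=> 0) (120 * m + 73) 0.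
  by case: I => ? i1 i2 i3 ? ? ? ?; split=> //; apply: budget_cap i1 + apply: budget_cap i2 + apply: budget_cap i3.
have rB p : p \in SB -> ready F P L p.
  by rewrite mem_filter => /andP[h hP]; apply: ready_sparse.
have [||L1 [g1 [g2 [g3 [I1 r1]]]]] := install_crowded_all D P1 P2 P3 QG12 QG13 QG23 I' (leqnn _) sA c1 c2 c3 _ _ rB.
- by move: dA e7 mn nN m0; rewrite /base; move: (_ %/ _) #|T| => x y; clear; lia.
- by move: dA e7 mn nN m0; rewrite /base; move: (_ %/ _) #|T| => x y; clear; lia.
have I2 : state F G1 G2 G3 base P L1 SB g1 g2 g3 (260 * m + 7) (0 + 73 * size SA).
  have hc : 120 * m + 73 <= 260 * m + 7 by move: m0; clear; lia.
  by case: I1 => ? i1 i2 i3 ? ? ? ?; split=> //; [apply: budget_cap i1 | apply: budget_cap i2 | apply: budget_cap i3].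
have sB : 0 + 73 * size SA + 7 * size SB <= TB.
  apply: leq_add => //; rewrite leq_mul2l; apply: leq_trans size_P.
  by rewrite size_filter count_size.
apply: (install_sparse_all D P1 P2 P3 QG12 QG13 QG23 I2 (leqnn _) sB c1 c2 c3 _ r1).
by move: dB e7 mn nN m0; rewrite /base; move: (_ %/ _) #|T| => x y; clear; lia.
Qed.

End Assemble.

(** * The base square *)

Section Base.
Local Open Scope ring_scope.
Variables (R : finComNzRingType) (hf : R) (e : nat) (t : 'I_e -> R).
Hypothesis hfE : hf + hf = 1.
Hypothesis t_inj : injective t.

(* The finite points form the generalised dihedral group of the abelian group
   [Z/2 x R]; the first bit is the sign. *)
Definition base := ((bool * bool * R) + 'I_e)%type.

Definition xorp (x y : bool * bool) := (x.1 (+) y.1, x.2 (+) y.2).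
(* Multiplication by a primitive element of the field with four elements: [x],
   [om x] and their sum [om (om x)] each determine the other two. *)
Definition om (x : bool * bool) := (x.2, x.1 (+) x.2).
Definition sg (a : bool) (z : R) := if a then - z else z.
Arguments om : simpl never.
Arguments sg : simpl never.
Arguments xorp : simpl never.

Lemma sgK a : involutive (sg a). Proof. by case: a => z; rewrite /sg ?opprK. Qed.
Lemma sg_double s w : sg s (sg s w + sg s w) = w + w.
Proof. by case: s; rewrite /sg // opprD !opprK. Qed.
Lemma om_inj : injective om.
Proof. by case=> [[] []] [[] []]. Qed.
Lemma xorpK x y : xorp x (xorp x y) = y. Proof. by case: x y => [[] []] [[] []]. Qed.
Lemma xorpC x y : xorp x y = xorp y x. Proof. by case: x y => [[] []] [[] []]. Qed.

Lemma double_inj (x y : R) : x + x = y + y -> x = y.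
Proof.
move=> h; have k z : z = hf * (z + z) by rewrite mulrDr -mulrDl hfE mul1r.
by rewrite (k x) h -k.
Qed.

(** With the product [(x,i)(y,j) = (x + y, i + sg x.1 j)] the entry in row [g] and column [h] is
    [g^-1 h]. *)
Definition dtable (a b c : base) := match a, b, c with
  | inl (x, i), inl (y, j), inl (z, l) => (z == xorp x y) && (l == sg x.1 (j - i))
  | _, _, _ => false end.

(* For each [k] the cells in row [(x,i)] and column [(om x, 2i + t k)] form a
   transversal of [dtable]; its symbols are replaced by [inr k] and moved to a
   new row and a new column. *)
Definition prolong (a b c : base) := match a, b, c with
  | inl (x, i), inl (y, j), inl (z, l) =>
      dtable a b c && ~~ [exists k, (y == om x) && (j == i + i + t k)]
  | inl (x, i), inl (y, j), inr k => (y == om x) && (j == i + i + t k)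
  | inl (x, i), inr k, inl (z, l) => (z == om (om x)) && (l == sg x.1 (i + t k))
  | inr k, inl (y, j), inl (z, l) => (z == om y) && (j == sg (om z).1 (l + l) - t k)
  | inr k, inr k', inr k'' => ((k + k' + k'') %% e == 0)%N
  | _, _, _ => false end.

Lemma latin_fin (T : finType) (L : rel3 T) :
  (forall a b, exists c, L a b c) ->
  (forall a a' b c, L a b c -> L a' b c -> a = a') ->
  (forall a b b' c, L a b c -> L a b' c -> b = b') ->
  (forall a b c c', L a b c -> L a b c' -> c = c') -> latin L.
Proof.
move=> e3 u1 u2 u3.
pose f a b := xchoose (e3 a b).
have fP a b : L a b (f a b) := xchooseP (e3 a b).
split=> //.
- move=> a c; have inj : injective (f a).
    by move=> b b' h; apply: (u2 a b b' (f a b)); rewrite // h.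
  by have [g _ gK] := injF_bij inj; exists (g c); rewrite -{2}(gK c).
- move=> b c; have inj : injective (f^~ b).
    by move=> a a' h; apply: (u1 a a' b (f a b)); rewrite // h.
  by have [g _ gK] := injF_bij inj; exists (g c); rewrite -{2}(gK c).
Qed.

Lemma corner_inj (k1 k2 k : nat) : (k1 < e)%N -> (k2 < e)%N ->
  (k1 + k = k2 + k %[mod e])%N -> k1 = k2.
Proof. by move=> h1 h2 /eqP; rewrite eqn_modDr !modn_small // => /eqP. Qed.

Lemma xorpIl x x' y : xorp x y = xorp x' y -> x = x'.
Proof. by case: x x' y => [[] []] [[] []] [[] []]. Qed.
Lemma xorpIr x y y' : xorp x y = xorp x y' -> y = y'.
Proof. by case: x y y' => [[] []] [[] []] [[] []]. Qed.
Lemma sg_inj a : injective (sg a). Proof. exact: can_inj (sgK a). Qed.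

Lemma corner_eq (k1 k2 k : 'I_e) (n : nat) :
  ((k1 + n) %% e = 0 -> (k2 + n) %% e = 0 -> k1 = k2)%N.
Proof.
move=> h1 h2; apply: ord_inj; apply: (@corner_inj _ _ n) => //.
by rewrite h1 h2.
Qed.

(** The pairs given to the new row [inr k] are those of the cells of the [k]-th transversal. Solving
    for the cell shows that it lies on that transversal, where the entry of the table was
    replaced. *)
Lemma row_clash x i k y j z l :
  prolong (inl (x, i)) (inl (y, j)) (inl (z, l)) ->
  prolong (inr k) (inl (y, j)) (inl (z, l)) -> False.
Proof.
rewrite /= => /andP[/andP[/eqP hz /eqP hl] /existsPn nT] /andP[/eqP hz' /eqP hj].
have ey : y = om x by case: (x) (y) (z) hz hz' => [[] []] [[] []] [[] []].
have /negP[] := nT k; rewrite ey eqxx /=.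
have ex : z.2 = x.1 by rewrite hz' ey; case: (x) => [[] []].
rewrite ex hl sg_double in hj; apply/eqP.
have -> : j = 2%:R * j - j by ring.
by rewrite {2}hj; ring.
Qed.

Lemma col_clash x i k y j z l :
  prolong (inl (x, i)) (inl (y, j)) (inl (z, l)) ->
  prolong (inl (x, i)) (inr k) (inl (z, l)) -> False.
Proof.
rewrite /= => /andP[/andP[/eqP hz /eqP hl] /existsPn nT] /andP[/eqP hz' /eqP hj].
have ey : y = om x by case: (x) (y) (z) hz hz' => [[] []] [[] []] [[] []].
have /negP[] := nT k; rewrite ey eqxx /=.
move: hj; rewrite hl => /sg_inj h; apply/eqP.
by rewrite -addrA -h addrC subrK.
Qed.

Lemma sym_clash x i k y j z l :
  prolong (inl (x, i)) (inl (y, j)) (inl (z, l)) ->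
  prolong (inl (x, i)) (inl (y, j)) (inr k) -> False.
Proof.
by rewrite /= => /andP[_ /existsPn nT] h; move: (nT k); rewrite h.
Qed.

Lemma latin_prolong : latin prolong.
Proof.
apply: latin_fin.
- move=> [[x i]|k] [[y j]|k'].
  + case: (boolP [exists k, (y == om x) && (j == i + i + t k)]) => [/existsP[k hk]|hk].
      by exists (inr k).
    by exists (inl (xorp x y, sg x.1 (j - i))); rewrite /= !eqxx.
  + by exists (inl (om (om x), sg x.1 (i + t k'))); rewrite /= !eqxx.
  (* The equation for the symbol is [l + l = j + t k] up to sign, solved by halving with [hf]. *)
  + exists (inl (om y, sg (om (om y)).1 ((j + t k) * hf))) => /=.
    by rewrite eqxx sg_double -mulrDr hfE mulr1 addrK /=.
  (* The corner is the cyclic square [k + k' + k'' = 0] modulo [e]; the outer remainder matters when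
     [k + k'] is already a multiple of [e]. *)
  + have e0 : (0 < e)%N by apply: leq_ltn_trans (ltn_ord k).
    have lt : ((e - (k + k') %% e) %% e < e)%N by rewrite ltn_mod.
    exists (inr (Ordinal lt)) => /=; rewrite modnDmr -modnDml.
    by rewrite subnKC ?modnn // ltnW // ltn_mod.
- move=> [[x i]|k] [[x' i']|k2] [[y j]|k'] [[z l]|k''] //.
  + rewrite /= => /andP[/andP[/eqP -> /eqP ->] _] /andP[/andP[/eqP /xorpIl ex /eqP h2] _].
    rewrite -ex in h2 *; congr (inl (_, _)).
    by move/sg_inj: h2 => /addrI /oppr_inj.
  + rewrite /= => /andP[/eqP hy /eqP hj] /andP[/eqP hy' /eqP hj'].
    rewrite (om_inj (etrans (esym hy) hy')); congr (inl (_, _)).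
    by apply: double_inj; apply: (addIr (t k'')); rewrite -hj -hj'.
  + rewrite /= => /andP[/eqP -> /eqP ->] /andP[/eqP /om_inj /om_inj ex /eqP h2].
    rewrite -ex in h2 *; congr (inl (_, _)).
    by move/sg_inj: h2 => /addIr.
  + by move=> h1 h2; case: (row_clash h1 h2).
  + by move=> h1 h2; case: (row_clash h2 h1).
  + rewrite /= => /andP[_ /eqP ->] /andP[_ /eqP /addrI /oppr_inj /t_inj ->].
    by [].
  + rewrite /= -!addnA => /eqP h1 /eqP h2; congr inr; exact: corner_eq h1 h2.
- move=> [[x i]|k] [[y j]|k1] [[y' j']|k2] [[z l]|k''] //.
  + rewrite /= => /andP[/andP[/eqP -> /eqP ->] _] /andP[/andP[/eqP /xorpIr ey /eqP h2] _].
    rewrite -ey; congr (inl (_, _)).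
    by move/sg_inj: h2 => /addIr.
  + by rewrite /= => /andP[/eqP -> /eqP ->] /andP[/eqP -> /eqP ->].
  + by move=> h1 h2; case: (col_clash h1 h2).
  + by move=> h1 h2; case: (col_clash h2 h1).
  + by rewrite /= => /andP[_ /eqP ->] /andP[_ /eqP /sg_inj /addrI /t_inj ->].
  + by rewrite /= => /andP[/eqP hz /eqP ->] /andP[/eqP hz' /eqP ->]; rewrite (om_inj (etrans (esym hz) hz')).
  + rewrite /= => /eqP h1 /eqP h2; congr inr; rewrite addnAC (addnC _ (val k1)) in h1.
    by rewrite addnAC (addnC _ (val k2)) in h2; apply: corner_eq h1 h2.
- move=> [[x i]|k] [[y j]|k'] [[z l]|k1] [[z' l']|k2] //.
  + by rewrite /= => /andP[/andP[/eqP -> /eqP ->] _] /andP[/andP[/eqP -> /eqP ->] _].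
  + by move=> h1 h2; case: (sym_clash h1 h2).
  + by move=> h1 h2; case: (sym_clash h2 h1).
  + by rewrite /= => /andP[_ /eqP ->] /andP[_ /eqP /addrI /t_inj ->].
  + by rewrite /= => /andP[/eqP -> /eqP ->] /andP[/eqP -> /eqP ->].
  + rewrite /= => /andP[/eqP -> /eqP ->] /andP[/eqP -> /eqP /addIr /sg_inj h].
    by rewrite (double_inj h).
  + rewrite /= => /eqP h1 /eqP h2; congr inr; rewrite addnC in h1.
    by rewrite addnC in h2; apply: corner_eq h1 h2.
Qed.



Definition fin_line (a : base) := if a is inl _ then true else false.
Definition side (a : base) := if a is inl (x, _) then x.1 else false.

Lemma card_fin_line : (#|~: [set a | fin_line a]| <= e)%N.
Proof.
have h : ~: [set a | fin_line a] \subset [set inr k | k : 'I_e].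
  apply/subsetP=> -[x|k]; rewrite !inE //= => _; apply/imsetP.
  by exists k.
by apply: leq_trans (subset_leq_card h) _; rewrite (leq_trans (leq_imset_card _ _)) // card_ord.
Qed.

(** For columns [h] and [h'] in opposite halves [h' h^-1] lies outside the abelian subgroup and is
    therefore an involution; this closes the intercalates. A half has [2 * #|R|] of the [4 * #|R|]
    elements. *)
Lemma dihedral_dtable :
  let G := [set a | fin_line a] in
  dihedral dtable G G G side side side (2 * #|R|)%N.
Proof.
have hcard x : (2 * #|R| <= #|[set a in [set a | fin_line a] | side a == x]|)%N.
  rewrite -card_bool -card_prod.
  rewrite -(@card_imset _ _ (fun z : bool * R => inl ((x, z.1), z.2) : base)); last first.
    by move=> [z1 z2] [z1' z2'] [-> ->].
  by apply/subset_leq_card/subsetP=> _ /imsetP[z _ ->]; rewrite !inE /= eqxx.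
split; rewrite //.
- by move=> [[x i]|k] [[y j]|k1] [[z l]|k2] //; rewrite !inE.
- move=> [[x i]|k] [[y j]|k1] [[z l]|k2] //= /andP[/eqP -> _].
  by case: (x) (y) => [[] []] [[] []].
- move=> [[x i]|k] [[y j]|k1]; rewrite ?inE // => _ _.
  by exists (inl (xorp x y, sg x.1 (j - i))); rewrite /= !eqxx.
- move=> [[x i]|k] [[z l]|k1]; rewrite ?inE // => _ _.
  by exists (inl (xorp x z, i + sg x.1 l)); rewrite /= xorpK eqxx /= addrC addKr sgK.
- move=> [[y j]|k] [[z l]|k1]; rewrite ?inE // => _ _.
  exists (inl (xorp y z, j - sg (xorp y z).1 l)) => /=.
  rewrite (xorpC _ y) xorpK eqxx /= opprB addrC subrK.
  by rewrite -[X in sg X (sg X _)]/((xorp y z).1) sgK.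
- move=> [[x i]|k] [[x' i']|k2] [[y j]|k'] [[z l]|k''] //.
  rewrite /= => /andP[/eqP -> /eqP ->] /andP[/eqP /xorpIl ex /eqP h2].
  rewrite -ex in h2 *; congr (inl (_, _)).
  by move/sg_inj: h2 => /addrI /oppr_inj.
- move=> [[x i]|k] [[y j]|k1] [[y' j']|k2] [[z l]|k''] //.
  rewrite /= => /andP[/eqP -> /eqP ->] /andP[/eqP /xorpIr ey /eqP h2].
  by rewrite -ey; move/sg_inj: h2 => /addIr ->.
- move=> [[x i]|k] [[y j]|k'] [[z l]|k1] [[z' l']|k2] //.
  by rewrite /= => /andP[/eqP -> /eqP ->] /andP[/eqP -> /eqP ->].
- move=> [[x i]|k] [[y j]|k'] [[z l]|k1] [[y' j']|k2] //; rewrite ?inE // => /andP[/eqP hz /eqP hl] _ hh.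
  (* For row [g] and columns [h], [h'] these are the row [h' h^-1 g] and the symbol [g^-1 h']. *)
  exists (inl (xorp z y', j' + j - i)), (inl (xorp x y', sg x.1 (j' - i))); split.
  + by rewrite /= !eqxx.
  + have -> : xorp x y' = xorp (xorp z y') y by rewrite hz; case: (x) (y) (y') => [[] []] [[] []] [[] []].
    rewrite /= eqxx /=; apply/eqP.
    have -> : z.1 (+) y'.1 = ~~ x.1.
      by move: hh; rewrite hz /=; case: (x) (y) (y') => [[] []] [[] []] [[] []].
    by rewrite /sg; case: (x.1) => /=; ring.
  + have hz2 : z = xorp (xorp z y') y' by case: (z) (y') => [[] []] [[] []].
    rewrite /= -hz2 eqxx hl /=; apply/eqP.
    have -> : z.1 (+) y'.1 = ~~ x.1.
      by move: hh; rewrite hz /=; case: (x) (y) (y') => [[] []] [[] []] [[] []].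
    by rewrite /sg; case: (x.1) => /=; ring.
Qed.

Lemma prolong_fin a b c : prolong a b c -> fin_line a -> fin_line b -> fin_line c -> dtable a b c.
Proof. by case: a b c => [[x i]|k] [[y j]|k1] [[z l]|k2] //= /andP[]. Qed.

Lemma prolong_inf a b c : prolong a b c ->
  [|| fin_line a && fin_line b, fin_line a && fin_line c, fin_line b && fin_line c |
     [&& ~~ fin_line a, ~~ fin_line b & ~~ fin_line c]].
Proof. by case: a b c => [[x i]|k] [[y j]|k1] [[z l]|k2]. Qed.

End Base.

Section Transport.
Variables (T U : finType) (f1 f2 f3 : T -> U).
Hypotheses (b1 : bijective f1) (b2 : bijective f2) (b3 : bijective f3).

Definition pull (L : rel3 U) : rel3 T := fun a b c => L (f1 a) (f2 b) (f3 c).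

Lemma latin_pull L : latin L -> latin (pull L).
Proof.
case: b1 b2 b3 => g1 k1 k1' [g2 k2 k2'] [g3 k3 k3'] lL; split; rewrite /pull.
- by move=> a b; have [c hc] := lat12 lL (f1 a) (f2 b); exists (g3 c); rewrite k3'.
- by move=> a c; have [b hc] := lat13 lL (f1 a) (f3 c); exists (g2 b); rewrite k2'.
- by move=> b c; have [a hc] := lat23 lL (f2 b) (f3 c); exists (g1 a); rewrite k1'.
- by move=> a a' b c h h'; apply: (can_inj k1); apply: lat1 h h'.
- by move=> a b b' c h h'; apply: (can_inj k2); apply: lat2 h h'.
- by move=> a b c c' h h'; apply: (can_inj k3); apply: lat3 h h'.
Qed.

Lemma card_pull (f : T -> U) (A : {set U}) : bijective f -> #|f @^-1: A| = #|A|.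
Proof. by move=> bf; apply: on_card_preimset; apply: onW_bij. Qed.

Lemma dihedral_pull F G1 G2 G3 h1 h2 h3 N2 : dihedral F G1 G2 G3 h1 h2 h3 N2 ->
  dihedral (pull F) (f1 @^-1: G1) (f2 @^-1: G2) (f3 @^-1: G3) (h1 \o f1) (h2 \o f2) (h3 \o f3) N2.
Proof.
move=> D.
have hc (f : T -> U) (G : {set U}) (h : U -> bool) x : bijective f ->
    (forall x, N2 <= #|[set a in G | h a == x]|) ->
    N2 <= #|[set a in f @^-1: G | (h \o f) a == x]|.
  move=> bf /(_ x) /leq_trans; apply; rewrite -(card_pull _ bf).
  by apply/eq_leq/eq_card => a; rewrite !inE.
have [d_dom' d_par' d12' d13' d23' d1' d2' d3' dint' dh1 dh2 dh3] := D.
case: (b1) (b2) (b3) => g1 k1 k1' [g2 k2 k2'] [g3 k3 k3']; split; rewrite /pull.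
- by move=> a b c /d_dom'[]; rewrite !inE.
- by move=> a b c /d_par'.
- by move=> a b; rewrite !inE => ha hb; have [c h] := d12' _ _ ha hb; exists (g3 c); rewrite k3'.
- by move=> a b; rewrite !inE => ha hb; have [c h] := d13' _ _ ha hb; exists (g2 c); rewrite k2'.
- by move=> a b; rewrite !inE => ha hb; have [c h] := d23' _ _ ha hb; exists (g1 c); rewrite k1'.
- by move=> a a' b c h h'; apply: (can_inj k1); apply: d1' h h'.
- by move=> a b b' c h h'; apply: (can_inj k2); apply: d2' h h'.
- by move=> a b c c' h h'; apply: (can_inj k3); apply: d3' h h'.
- move=> a b c b' h; rewrite inE => hb hh; have [a' [c' [q1 q2 q3]]] := dint' _ _ _ _ h hb hh.
  by exists (g1 a'), (g3 c'); rewrite k1' k3'.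
- by move=> x; apply: hc.
- by move=> x; apply: hc.
- by move=> x; apply: hc.
Qed.

End Transport.

(** * The theorem *)

Lemma eq_card_bij (T U : finType) : #|T| = #|U| -> exists f : T -> U, bijective f.
Proof.
move=> h; exists (fun x => enum_val (cast_ord h (enum_rank x))).
exists (fun y => enum_val (cast_ord (esym h) (enum_rank y))) => x.
  by rewrite enum_valK cast_ordK enum_rankK.
by rewrite enum_valK cast_ordKV enum_rankK.
Qed.

(** Since [#|R|] is odd, [4 * #|R|] is 4 modulo 8, and a remainder of up to 7 is made up by adjoined
    lines. A large [n] makes [#|R|] exceed [e], so that the [e] shifts [t k] are distinct. *)
Lemma base_square n : 100 <= n -> exists (B F : rel3 'I_n) (G : {set 'I_n}) h N2 e,
  [/\ latin B, dihedral F G G G h h h N2, #|~: G| <= e, e <= 7 /\ n = 2 * N2 + e &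
   (forall a b c, B a b c -> a \in G -> b \in G -> c \in G -> F a b c) /\
   (forall a b c, B a b c -> almost_inside G G G a b c \/ [/\ a \notin G, b \notin G & c \notin G])].
Proof.
move=> n100.
pose a := ((n - 4) %/ 8).-1; pose e := (n - 4) %% 8.
have e7 : e < 8 by rewrite ltn_mod.
have ha : 2 < a.
  have := divn_eq (n - 4) 8; rewrite -/e /a; move: e7 n100; move: (_ %/ _) => x; lia.
have en : n = 4 * (2 * a + 3) + e.
  have h := divn_eq (n - 4) 8; rewrite -/e in h.
  by move: ha; rewrite /a; move: h e7; move: (_ %/ _) => x; lia.
(* The ring [Z/(2a + 3)], in which [a + 2] is the half of 1. *)
pose R : finComNzRingType := 'I_(2 * a).+1.+2.
pose hf : R := inZp (a + 2).
pose t (k : 'I_e) : R := inZp k.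
have hfE : (hf + hf = 1)%R.
  apply: val_inj => /=; rewrite modnDm.
  have -> : a + 2 + (a + 2) = (2 * a).+1.+2 + 1 by lia.
  by rewrite modnDl.
have t_inj : injective t.
  move=> k k' /(congr1 val) /= h; apply: ord_inj; move: h.
  have lt (i : 'I_e) : i < (2 * a).+1.+2 by apply: leq_trans (ltn_ord i) _; move: e7 ha; clear; lia.
  by rewrite !modn_small.
have cR : #|R| = 2 * a + 3 by rewrite card_ord; lia.
have cn : #|'I_n| = #|{: base R e}|.
  by rewrite card_sum !card_prod card_bool !card_ord en -cR; lia.
have [f bf] := eq_card_bij cn.
pose G := [set x : base R e | fin_line x].
exists (pull f f f (prolong t)), (pull f f f (@dtable R e)), (f @^-1: G), (@side R e \o f), (2 * #|R|), e.
split.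
- exact: (latin_pull bf bf bf (latin_prolong hfE t_inj)).
- exact: (dihedral_pull bf bf bf (dihedral_dtable _ _)).
- by rewrite -preimsetC card_pull //; apply: card_fin_line.
- by split; [rewrite -ltnS | rewrite cR {1}en; lia].
split=> x y z h; rewrite /almost_inside !inE; first exact: prolong_fin h.
by case/or4P: (prolong_inf h) => [->|->|->|/and3P[-> -> ->]]; rewrite ?orbT; [left|left|left|right].
Qed.

(** [relabel] is applied to the columns, with columns and symbols exchanged, and then to the
    symbols. The first application bounds the row-column pairs of [P] on each symbol and separates
    outer rows from outer columns; the second only permutes the symbols in these conclusions and
    adds those on the other two kinds of pairs. *)
Lemma complete_dense n m (P : seq ('I_n * 'I_n * 'I_n)) :
  uniq P -> 0 < m -> m * (100 * 100 * 100) <= 98 * n ->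
  98 * n < m.+1 * (100 * 100 * 100) ->
  (forall a a' b c, (a, b, c) \in P -> (a', b, c) \in P -> a = a') ->
  (forall a b b' c, (a, b, c) \in P -> (a, b', c) \in P -> b = b') ->
  (forall a b c c', (a, b, c) \in P -> (a, b, c') \in P -> c = c') ->
  (forall a, #|[set b | paired12 P a b]| <= m) -> (forall b, #|[set a | paired12 P a b]| <= m) ->
  (forall a, #|[set c | paired13 P a c]| <= m) -> (forall c, #|[set a | paired13 P a c]| <= m) ->
  (forall b, #|[set c | paired23 P b c]| <= m) -> (forall c, #|[set b | paired23 P b c]| <= m) ->
  exists2 L, latin L & forall a b c, (a, b, c) \in P -> L a b c.
Proof.
move=> uP m0 hm1 hm2 P1 P2 P3 g12 g21 g13 g31 g23 g32.
have nm : 102 * 100 * m <= n by move: hm1; clear; lia.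
have [|B [F [G [h [N2 [e [lB D cG [e7 en] [fin inf]]]]]]]] := @base_square n.
  by move: nm m0; clear; lia.
have cn : #|'I_n| = n := card_ord n.
have T0 : 0 < #|'I_n| by rewrite cn; move: nm m0; clear; lia.
have hK : 12 * m <= #|'I_n| by rewrite cn; move: nm m0; clear; lia.
(* The surplus [3 ^ (12 * m)] is at least [81 ^ 3 * m], with [81 ^ 3 = 531441], while [16 * n] is
   below [16 * (m + 1) * 10^6 / 98], less than [326531 * m]. *)
have hf : 16 * #|'I_n| * m ^ (12 * m) <= (12 * m)`!.
  apply: leq_trans (fact_bound m); rewrite leq_mul2r cn; apply/orP; right.
  have k1 : m <= 3 ^ (12 * m.-1).
    rewrite -{1}(prednK m0); apply: leq_trans (ltn_expl _ (isT : 1 < 3)) _.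
    by rewrite leq_exp2l // leq_pmull.
  have -> : 12 * m = 12 + 12 * m.-1 by move: m0; clear; lia.
  rewrite expnD -[12 in X in _ <= X * _]/(4 * 3) expnM.
  apply: leq_trans (leq_mul (leqnn (81 ^ 3)) k1).
  by rewrite !expnS expn0; move: hm2 m0; clear; lia.
have he : 8 * (e * e * m) <= #|'I_n|.
  apply: (@leq_trans (8 * (7 * 7 * m))); first by rewrite leq_mul2l leq_mul2r (leq_mul e7 e7) orbT.
  by rewrite cn; move: nm; clear; lia.
have lBt : latin (fun a c b => B a b c) by case: lB => *; split; eauto.
have [s2 [_ y2 _ x2]] := relabel g13 g31 g12 g21 g32 g23 lBt cG cG cG T0 hK hf he.
have lB2 : latin (fun a b c => B a (s2 b) c).
  have bs2 : bijective s2 by exists (s2^-1)%g; [exact: permK | exact: permKV].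
  exact: (latin_pull (inv_bij (fun x => erefl x)) bs2 (inv_bij (fun x => erefl x)) lB).
have cG2 : #|s2 @^-1: (~: G)| <= e.
  by rewrite card_pull //; exists (s2^-1)%g; [exact: permK | exact: permKV].
have [s3 [y3 z3 w3 x3]] := relabel g12 g21 g13 g31 g23 g32 lB2 cG cG2 cG T0 hK hf he.
have bid : bijective (@id 'I_n) by exists id.
have bs2 : bijective s2 by exists (s2^-1)%g; [exact: permK | exact: permKV].
have bs3 : bijective s3 by exists (s3^-1)%g; [exact: permK | exact: permKV].
apply: (@complete_structured _ (pull id s2 s3 F) (id @^-1: G) (s2 @^-1: G) (s3 @^-1: G)
  _ _ _ N2 P (pull id s2 s3 B) m e (dihedral_pull bid bs2 bs3 D) (latin_pull bid bs2 bs3 lB)) => //.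
- move=> a b q; rewrite !inE; apply: contraT; rewrite negb_or => /andP[na nb].
  by have [|/(_ a q)] := x2 b _; rewrite ?inE // na.
- move=> a c q; rewrite !inE; apply: contraT; rewrite negb_or => /andP[na nc].
  by have [|/(_ a q)] := x3 c _; rewrite ?inE // na.
- move=> b c q; rewrite !inE; apply: contraT; rewrite negb_or => /andP[nb nc].
  by have [|_ /(_ b q)] := x3 c _; rewrite ?inE // nb.
- by rewrite -preimsetC card_pull.
- by rewrite -preimsetC card_pull.
- by rewrite -preimsetC card_pull.
- by move=> a b c hB; rewrite !inE => ha hb hc; apply: fin hB ha hb hc.
- by move=> a b c /inf; rewrite /almost_inside !inE.
- move=> c; apply: leq_trans (y2 (s3 c)); apply: subset_leq_card; apply/subsetP=> a.
  by rewrite !inE.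
- by rewrite cn.
- by rewrite cn.
Qed.

Local Open Scope ring_scope.

Lemma dense_bound (k n : nat) :
  k%:R <= (98 / 10 ^+ 6 : rat) * n%:R -> (k * (100 * 100 * 100) <= 98 * n)%N.
Proof.
have -> : (10 ^+ 6 : rat) = (100 * 100 * 100)%N%:R.
  by rewrite !natrM -[6%N]/(2 * 3)%N exprM !exprS expr0 mulr1 mulrA -natrM.
rewrite mulrAC ler_pdivlMr; last by rewrite ltr0n !muln_gt0.
by rewrite -!natrM ler_nat.
Qed.

Theorem corollary2p4p6 (n : nat) (P : 'M[option 'I_n]_n) :
  (0 < n)%N ->
  partial_latin_square P ->
  eps_dense (98 / 10 ^+ 6 : rat) P ->
  completable P.
Proof.
move=> n0 [Prow Pcol] [hrow hcol hsym].
pose m := ((98 * n) %/ (100 * 100 * 100))%N.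
have le_m k : k%:R <= (98 / 10 ^+ 6 : rat) * n%:R -> (k <= m)%N.
  by move/dense_bound; rewrite leq_divRL.
(* If [m = 0] the density allows less than one filled cell per line; [P] is blank and the addition
   table of [Z/n] completes it. *)
have [m0|m0] := posnP m.
  have none i j : P i j = None.
    apply/eqP; move: (le_m _ (hrow i)); rewrite m0 leqn0 => /eqP/cards0_eq/setP/(_ j).
    by rewrite !inE => /negbFE.
  case: n n0 P {Prow Pcol hrow hcol hsym m le_m m0} none => // n _ P none.
  exists (\matrix_(i, j) (i + j)); split=> [|i j s]; last by rewrite none.
  split=> [i j j'|j i i']; rewrite !mxE; [exact: addrI | exact: addIr].
pose A := [set p : 'I_n * 'I_n * 'I_n | P p.1.1 p.1.2 == Some p.2].
have memA a b c : ((a, b, c) \in enum A) = (P a b == Some c) by rewrite mem_enum inE.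
have [|||||||||||L lL hL] := @complete_dense n m (enum A) (enum_uniq _) m0.
- exact: leq_trunc_div.
- by rewrite ltn_ceil.
- by move=> a a' b c; rewrite !memA => /eqP h1 /eqP h2; apply: Pcol h1 h2.
- by move=> a b b' c; rewrite !memA => /eqP h1 /eqP h2; apply: Prow h1 h2.
- by move=> a b c c'; rewrite !memA => /eqP -> /eqP [].
- move=> a; apply: leq_trans (le_m _ (hrow a)); apply/subset_leq_card/subsetP=> b.
  by rewrite !inE => /existsP[c]; rewrite memA => /eqP ->.
- move=> b; apply: leq_trans (le_m _ (hcol b)); apply/subset_leq_card/subsetP=> a.
  by rewrite !inE => /existsP[c]; rewrite memA => /eqP ->.
- move=> a; apply: leq_trans (le_m _ (hrow a)).
  apply: leq_trans (@card_preim_rel _ _ (fun c b => P a b == Some c) _ _).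
    apply/subset_leq_card/subsetP=> c; rewrite !inE => /existsP[b]; rewrite memA => h.
    by apply/existsP; exists b; rewrite h inE (eqP h).
  by move=> c c' b /eqP -> /eqP [].
- move=> c; apply: leq_trans (le_m _ (hsym c)).
  apply: leq_trans (@card_preim_rel _ _ (fun a (p : 'I_n * 'I_n) => (p.1 == a) && (P p.1 p.2 == Some c)) _ _).
    apply/subset_leq_card/subsetP=> a; rewrite !inE => /existsP[b]; rewrite memA => h.
    by apply/existsP; exists (a, b); rewrite inE /= h eqxx.
  by move=> a a' p /andP[/eqP <- _] /andP[/eqP <- _].
- move=> b; apply: leq_trans (le_m _ (hcol b)).
  apply: leq_trans (@card_preim_rel _ _ (fun c a => P a b == Some c) _ _).
    apply/subset_leq_card/subsetP=> c; rewrite !inE => /existsP[a]; rewrite memA => h.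
    by apply/existsP; exists a; rewrite h inE (eqP h).
  by move=> c c' a /eqP -> /eqP [].
- move=> c; apply: leq_trans (le_m _ (hsym c)).
  apply: leq_trans (@card_preim_rel _ _ (fun b (p : 'I_n * 'I_n) => (p.2 == b) && (P p.1 p.2 == Some c)) _ _).
    apply/subset_leq_card/subsetP=> b; rewrite !inE => /existsP[a]; rewrite memA => h.
    by apply/existsP; exists (a, b); rewrite inE /= h eqxx.
  by move=> a a' p /andP[/eqP <- _] /andP[/eqP <- _].
pose f i j := xchoose (lat12 lL i j).
have fP i j : L i j (f i j) := xchooseP (lat12 lL i j).
exists (\matrix_(i, j) f i j); split; last first.
  move=> i j s h; rewrite mxE; apply: (lat3 lL (fP i j)); apply: hL.
  by rewrite memA h.
split=> [i j j'|j i i'] /=; rewrite !mxE => h.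
  by apply: (lat2 lL (fP i j)); rewrite h.
by apply: (lat1 lL (fP i j)); rewrite h.
Qed.
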